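(* Let $p,p'>0$ and let $(\lambda_n)_{n\ge1}$, $(\lambda_n')_{n\ge1}$ be the increasing sequences of positive roots of $\tan(\pi y)=-y/p$ and of $\tan(\pi y)=-y/p'$, respectively. Let $\sigma(t)=\frac{p+t}{p-t}$ and $\sigma'(t)=\frac{p'+t}{p'-t}$. Then for every $x>0$, $$\sum_{n=1}^{\infty}\frac{p^{2}+\lambda_{n}^{2}}{p(p+\frac{1}{\pi})+\lambda_{n}^{2}}\cdot\frac{1}{\sigma'\!\left(\frac{\lambda_{n}^{2}x}{2\pi}\right)e^{\lambda_{n}^{2}x}-1}=\frac{1}{4(1+\frac{1}{\pi p})}+\frac{\pi^{2}}{6x}\,\frac{1+\frac{3}{\pi p}(1+\frac{1}{\pi p})}{(1+\frac{1}{\pi p'})(1+\frac{1}{\pi p})^{2}}+\frac{1}{2}\sqrt{\frac{\pi}{x}}\,\zeta_{p'}\!\left(\tfrac{1}{2}\right)+\frac{1}{2}\sqrt{\frac{\pi}{x}}\sum_{n=1}^{\infty}\frac{p'^{2}+\lambda_{n}'^{2}}{p'(p'+\frac{1}{\pi})+\lambda_{n}'^{2}}\,\frac{1}{\sqrt{\lambda_{n}'}}\,G_{p}\!\left(\frac{2\pi\lambda_{n}'}{x}\right),$$ where for $a>0$ $$G_{p}(a)=\frac{(p^{2}-a)\{\cos(\pi\sqrt{2a})-\sin(\pi\sqrt{2a})\}-e^{-\pi\sqrt{2a}}(p^{2}-\sqrt{2a}\,p+a)-\sqrt{2a}\,p\{\cos(\pi\sqrt{2a})+\sin(\pi\sq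rt{2a})\}}{p^{2}(\cosh(\pi\sqrt{2a})-\cos(\pi\sqrt{2a}))+\sqrt{2a}\,p(\sinh(\pi\sqrt{2a})+\sin(\pi\sqrt{2a}))+a(\cosh(\pi\sqrt{2a})+\cos(\pi\sqrt{2a}))}.$$
   Context: For $q>0$ let $(\mu_n)_{n\ge1}$ be the increasing sequence of positive roots of $\tan(\pi y)=-y/q$ (so $n-\frac12<\mu_n<n$). Koshliakov's zeta function is $\zeta_q(s)=\sum_{n\ge1}\frac{q^2+\mu_n^2}{q(q+\frac1\pi)+\mu_n^2}\mu_n^{-s}$ for $\mathrm{Re}(s)>1$; it extends meromorphically to $\mathbb{C}$ with only a simple pole at $s=1$, and $\zeta_{q}(1/2)$ denotes the value of this continuation. *)

(* Defs.v *)
From Stdlib Require Import Reals.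
From Coquelicot Require Import Coquelicot.
Open Scope R_scope.

(* In Stdlib [tan y] is [sin y / cos y] with [/ 0 = 0]; the condition on [cos]
   keeps only the points where the tangent is really defined. *)
Definition koshliakov_root (q y : R) : Prop :=
  0 < y /\ cos (PI * y) <> 0 /\ tan (PI * y) = - y / q.

(* Sequences are indexed from 0: [mu n] stands for $\mu_{n+1}$. *)
Definition koshliakov_root_seq (q : R) (mu : nat -> R) : Prop :=
  (forall n : nat, mu n < mu (S n)) /\
  (forall y : R, koshliakov_root q y <-> exists n : nat, mu n = y).

Definition koshliakov_weight (q y : R) : R :=
  (q ^ 2 + y ^ 2) / (q * (q + 1 / PI) + y ^ 2).

Definition Cexp (z : C) : C :=
  (exp (Re z) * cos (Im z), exp (Re z) * sin (Im z)).

(* $y^s$ for real $y > 0$ and complex $s$. *)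
Definition Rcpow (y : R) (s : C) : C := Cexp (s * RtoC (ln y))%C.

(* [Z] is the meromorphic continuation of $\zeta_q$ to the complex plane, [mu]
   being the sequence of roots attached to [q]: the Dirichlet-type series for
   Re s > 1, complex differentiability away from 1, a simple pole at 1.  The
   value [Z 1] is irrelevant. *)
Definition is_koshliakov_zeta (q : R) (mu : nat -> R) (Z : C -> C) : Prop :=
  (forall s : C, 1 < Re s ->
     is_series (K := C_AbsRing) (V := C_NormedModule)
       (fun n : nat =>
          (RtoC (koshliakov_weight q (mu n)) * Rcpow (mu n) (- s))%C)
       (Z s)) /\
  (forall s : C, s <> RtoC 1 ->
     ex_derive (K := C_AbsRing) (V := C_NormedModule) Z s) /\
  (exists r : C, r <> RtoC 0 /\
     filterlim (fun s : C => ((s - RtoC 1) * Z s)%C)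
       (locally' (RtoC 1)) (locally r)).

Definition koshliakov_sigma (q t : R) : R := (q + t) / (q - t).

(* $1/(\sigma(z/2\pi) e^z - 1)$ for z > 0.  At z = 2 pi q, where $\sigma$ has
   its pole, the quotient has a removable singularity with value 0; since
   [/ 0 = 0] in Stdlib, the plain formula would give -1 there. *)
Definition koshliakov_kernel (q z : R) : R :=
  if Req_EM_T (z / (2 * PI)) q then 0
  else 1 / (koshliakov_sigma q (z / (2 * PI)) * exp z - 1).

Definition koshliakov_G (p a : R) : R :=
  let b := sqrt (2 * a) in
  ((p ^ 2 - a) * (cos (PI * b) - sin (PI * b))
     - exp (- (PI * b)) * (p ^ 2 - b * p + a)
     - b * p * (cos (PI * b) + sin (PI * b)))
  / (p ^ 2 * (cosh (PI * b) - cos (PI * b))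
     + b * p * (sinh (PI * b) + sin (PI * b))
     + a * (cosh (PI * b) + cos (PI * b))).

(* Main.v *)
(* Idea.  Write K_q(2 pi z) + 1/2 = N(z) / (2 D(z)) with N = q cosh(pi z) + z sinh(pi z) and
   D = q sinh(pi z) + z cosh(pi z); the zeros of D are 0 and the points +-i mu_n, and the
   residues there are the weights.  The residue theorem on rectangles gives, for Re w > 0,
     sum_n weight(mu_n) / (mu_n^2 + w^2)
       = (pi / w) (K_q(2 pi w) + 1/2) - c_q / (2 w^2),   c_q = 1 / (1 + 1 / (pi q)).
   Used at w = y > 0 for p', this expands the kernel of the left-hand side in partial
   fractions; used at w^2 = i a for p, its real part produces G_p(a).  The double series
   obtained in this way diverges, so it is cut off by the factor B^2 / (B^2 + mu_m^2), for
   which both orders of summation can still be evaluated: one contains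
   (pi/4) sqrt(2 pi B / x) - c_p/4, the other a multiple of sqrt B plus a term proportional to
   zeta_{p'}(1/2).  Letting B go to infinity, the coefficients of sqrt B must agree and the
   constant terms give the theorem.
   The value zeta_{p'}(1/2) is known only through analytic continuation; it is identified
   with lim (sum_{m<M} weight(mu_m) mu_m^{-1/2} - 2 sqrt(M+1)) by propagating the convergence
   of the entire functions [zH] from Re s >= 2 to Re s >= 1/2 with a two-constants
   inequality. *)

Require Import Defs.
From Stdlib Require Import Reals ZArith Lra Lia Psatz ClassicalEpsilon.
From Coquelicot Require Import Coquelicot.
Open Scope R_scope.

(** * Complex differentiability *)

(** The continued zeta function is only known to be complex differentiable at each point, with
    nothing said about its derivative. Hence Cauchy's theorem is proved in Goursat's form, by
    bisection, and rectangles are the only contours; the factor $2\pi i$ then comes from an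
    arctangent, without a choice of logarithm. The uncut double series diverges because each row sum
    contains the constant 1/2, while the column sums decay only like $\mu_m^{-1/2}$. The cut-off is
    a rational function of $\mu_m^2$: every term stays positive, so that both orders of summation
    agree, and its product with $1/(y^2+\mu_m^2)$ splits again into simple fractions. The
    coefficient of sqrt B contains an integral that is kept as an unnamed real number. Everything
    else converges while sqrt B does not, so the total coefficient has to vanish. The two-constants
    argument requires a bound that is uniform in the truncation on a half-plane larger than Re s >=
    1/2. The line Re s = 1/4 serves: to its right the increments of the corrected partial sums are
    $O(m^{-5/4})$, hence summable. *)

Lemma Cmod_pair (x y : R) : Cmod (x, y) <= Rabs x + Rabs y.
Proof.
  replace ((x, y) : C) with (RtoC x + Ci * RtoC y)%C
    by (apply injective_projections; simpl; ring).
  eapply Rle_trans. { apply Cmod_triangle. }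
  rewrite Cmod_mult, Cmod_Ci, !Cmod_R; lra.
Qed.

Lemma im_le_Cmod (z : C) : Rabs (Im z) <= Cmod z.
Proof. eapply Rle_trans; [apply Rmax_r | apply Rmax_Cmod]. Qed.

Lemma Cmod_minus_triangle (u v : C) : Cmod (u - v)%C <= Cmod u + Cmod v.
Proof.
  unfold Cminus. eapply Rle_trans; [apply Cmod_triangle|]. rewrite Cmod_opp; lra.
Qed.

Lemma Cmod_reverse_triangle (u v : C) : Cmod u - Cmod v <= Cmod (u + v)%C.
Proof.
  pose proof (Cmod_minus_triangle (u + v)%C v) as H.
  replace (u + v - v)%C with u in H by ring. lra.
Qed.

(** The form without a quotient admits [h = 0], so the chain rule has no separate case for an inner
    function whose increment vanishes. *)
Definition Cderiv (f : C -> C) (z l : C) : Prop :=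
  forall eps, 0 < eps -> exists d, 0 < d /\ forall h : C, Cmod h < d ->
    Cmod (f (z + h) - f z - l * h)%C <= eps * Cmod h.

Definition holo (f : C -> C) (z : C) : Prop := exists l, Cderiv f z l.

Definition Ccts (f : C -> C) (z : C) : Prop :=
  forall eps, 0 < eps -> exists d, 0 < d /\ forall u : C, Cmod (u - z)%C < d ->
    Cmod (f u - f z)%C < eps.

Lemma Cderiv_cts f z l : Cderiv f z l -> Ccts f z.
Proof.
  intros H eps He. destruct (H 1 Rlt_0_1) as [d [Hd Hf]].
  pose proof (Cmod_ge_0 l) as Hl.
  exists (Rmin d (eps / (2 + Cmod l))). split.
  { apply Rmin_pos; auto. apply Rdiv_lt_0_compat; lra. }
  intros u Hu.
  pose proof (Rlt_le_trans _ _ _ Hu (Rmin_l _ _)) as H1.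
  pose proof (Rlt_le_trans _ _ _ Hu (Rmin_r _ _)) as H2.
  specialize (Hf _ H1). replace (z + (u - z))%C with u in Hf by ring.
  replace (f u - f z)%C with ((f u - f z - l * (u - z)) + l * (u - z))%C by ring.
  eapply Rle_lt_trans; [apply Cmod_triangle|]. rewrite Cmod_mult.
  apply (Rmult_lt_compat_r (2 + Cmod l)) in H2; [|lra].
  unfold Rdiv in H2; rewrite Rmult_assoc, Rinv_l, Rmult_1_r in H2 by lra.
  pose proof (Cmod_ge_0 (u - z)). nra.
Qed.

Lemma holo_cts f z : holo f z -> Ccts f z.
Proof. intros [l H]; eapply Cderiv_cts; eauto. Qed.

Lemma Cderiv_const k z : Cderiv (fun _ => k) z 0.
Proof.
  intros eps He; exists 1; split; [lra|]; intros h _.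
  replace (k - k - 0 * h)%C with (RtoC 0) by ring. rewrite Cmod_0.
  pose proof (Cmod_ge_0 h); nra.
Qed.

Lemma Cderiv_id z : Cderiv (fun u => u) z 1.
Proof.
  intros eps He; exists 1; split; [lra|]; intros h _.
  replace (z + h - z - 1 * h)%C with (RtoC 0) by ring. rewrite Cmod_0.
  pose proof (Cmod_ge_0 h); nra.
Qed.

Lemma Cderiv_plus f g z l m :
  Cderiv f z l -> Cderiv g z m -> Cderiv (fun u => f u + g u)%C z (l + m)%C.
Proof.
  intros Hf Hg eps He.
  destruct (Hf (eps / 2)) as [d1 [Hd1 H1]]; [lra|].
  destruct (Hg (eps / 2)) as [d2 [Hd2 H2]]; [lra|].
  exists (Rmin d1 d2); split; [apply Rmin_pos; auto|]. intros h Hh.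
  specialize (H1 h (Rlt_le_trans _ _ _ Hh (Rmin_l _ _))).
  specialize (H2 h (Rlt_le_trans _ _ _ Hh (Rmin_r _ _))).
  replace (f (z + h) + g (z + h) - (f z + g z) - (l + m) * h)%C
    with ((f (z + h) - f z - l * h) + (g (z + h) - g z - m * h))%C by ring.
  eapply Rle_trans; [apply Cmod_triangle|]. lra.
Qed.

Lemma Cderiv_mult f g z l m :
  Cderiv f z l -> Cderiv g z m ->
  Cderiv (fun u => f u * g u)%C z (l * g z + f z * m)%C.
Proof.
  intros Hf Hg eps He.
  pose proof (Cmod_ge_0 l) as Hl. pose proof (Cmod_ge_0 (f z)%C) as Hfz.
  pose proof (Cmod_ge_0 (g z)%C) as Hgz.
  (* With [e = eps / (2 * k)] the four error terms below add up to at most [e * Cmod h * (1 + Cmod l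
     + Cmod (f z) + Cmod (g z))], which is within [eps * Cmod h]. *)
  set (k := 2 + Cmod l + Cmod (f z) + Cmod (g z)).
  assert (Hk : 0 < k) by (unfold k; lra).
  destruct (Hf (eps / (2 * k))) as [d1 [Hd1 H1]]; [apply Rdiv_lt_0_compat; lra|].
  destruct (Hg (eps / (2 * k))) as [d2 [Hd2 H2]]; [apply Rdiv_lt_0_compat; lra|].
  destruct (Cderiv_cts _ _ _ Hg (Rmin 1 (eps / (2 * k)))) as [d3 [Hd3 H3]].
  { apply Rmin_pos; [lra|apply Rdiv_lt_0_compat; lra]. }
  exists (Rmin d1 (Rmin d2 d3)); split; [repeat apply Rmin_pos; auto|]. intros h Hh.
  specialize (H1 h (Rlt_le_trans _ _ _ Hh (Rmin_l _ _))).
  pose proof (Rlt_le_trans _ _ _ Hh (Rmin_r _ _)) as Hh'.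
  specialize (H2 h (Rlt_le_trans _ _ _ Hh' (Rmin_l _ _))).
  pose proof (Rlt_le_trans _ _ _ Hh' (Rmin_r _ _)) as Hh3.
  specialize (H3 (z + h)%C). replace (z + h - z)%C with h in H3 by ring.
  specialize (H3 Hh3).
  pose proof (Rlt_le_trans _ _ _ H3 (Rmin_l _ _)) as H3a.
  pose proof (Rlt_le_trans _ _ _ H3 (Rmin_r _ _)) as H3b.
  set (e := eps / (2 * k)) in *.
  assert (Hek : 2 * e * k = eps) by (unfold e; field; lra).
  assert (He' : 0 < e) by (unfold e; apply Rdiv_lt_0_compat; lra).
  replace (f (z + h) * g (z + h) - f z * g z - (l * g z + f z * m) * h)%C
    with ((f (z + h) - f z - l * h) * (g (z + h) - g z) + (f (z + h) - f z - l * h) * g z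
          + f z * (g (z + h) - g z - m * h) + l * h * (g (z + h) - g z))%C by ring.
  pose proof (Cmod_ge_0 h) as Hh0.
  pose proof (Cmod_ge_0 (g (z + h) - g z)%C) as Hg0.
  eapply Rle_trans; [apply Cmod_triangle|]. rewrite !Cmod_mult.
  pose proof (Cmod_triangle ((f (z + h) - f z - l * h) * (g (z + h) - g z)
     + (f (z + h) - f z - l * h) * g z)%C (f z * (g (z + h) - g z - m * h))%C) as T1.
  pose proof (Cmod_triangle ((f (z + h) - f z - l * h) * (g (z + h) - g z))%C
     ((f (z + h) - f z - l * h) * g z)%C) as T2.
  rewrite Cmod_mult in T1. rewrite !Cmod_mult in T2.
  set (X := Cmod (f (z + h) - f z - l * h)%C) in *.
  set (W := Cmod (g (z + h) - g z - m * h)%C) in *.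
  set (Y := Cmod (g (z + h) - g z)%C) in *. set (H := Cmod h) in *.
  set (L := Cmod l) in *. set (F := Cmod (f z)) in *. set (G := Cmod (g z)) in *.
  assert (X * Y <= e * H) by (assert (0 <= X) by apply Cmod_ge_0; nra).
  assert (X * G <= e * H * G) by nra.
  assert (F * W <= F * (e * H)) by nra.
  assert (L * H * Y <= L * H * e) by (apply Rmult_le_compat_l; [apply Rmult_le_pos|]; lra).
  assert (0 <= e * H) by nra.
  assert (0 <= (e * H) * L) by nra. assert (0 <= (e * H) * F) by nra.
  assert (0 <= (e * H) * G) by nra.
  replace (eps * H) with (4 * (e * H) + 2 * (e * H * L) + 2 * (e * H * F) + 2 * (e * H * G))
    by (rewrite <- Hek; unfold k; ring).
  replace (F * (e * H)) with (e * H * F) in * by ring.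
  replace (L * H * e) with (e * H * L) in * by ring.
  lra.
Qed.

Lemma Cderiv_comp f g z l m :
  Cderiv f z l -> Cderiv g (f z) m -> Cderiv (fun u => g (f u)) z (m * l)%C.
Proof.
  intros Hf Hg eps He.
  pose proof (Cmod_ge_0 l) as Hl. pose proof (Cmod_ge_0 m) as Hm.
  set (e2 := eps / (2 * (Cmod l + 1))).
  assert (He2 : 0 < e2) by (unfold e2; apply Rdiv_lt_0_compat; lra).
  set (e1 := Rmin 1 (eps / (2 * (Cmod m + 1)))).
  assert (He1 : 0 < e1).
  { apply Rmin_pos; [lra|]; apply Rdiv_lt_0_compat; lra. }
  destruct (Hg e2 He2) as [d2 [Hd2 H2]].
  destruct (Hf e1 He1) as [d1 [Hd1 H1]].
  destruct (Cderiv_cts _ _ _ Hf d2 Hd2) as [d3 [Hd3 H3]].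
  exists (Rmin d1 d3); split; [apply Rmin_pos; auto|]. intros h Hh.
  specialize (H1 h (Rlt_le_trans _ _ _ Hh (Rmin_l _ _))).
  specialize (H3 (z + h)%C). replace (z + h - z)%C with h in H3 by ring.
  specialize (H3 (Rlt_le_trans _ _ _ Hh (Rmin_r _ _))).
  specialize (H2 _ H3). replace (f z + (f (z + h) - f z))%C with (f (z + h)%C) in H2 by ring.
  replace (g (f (z + h)) - g (f z) - m * l * h)%C
    with ((g (f (z + h)) - g (f z) - m * (f (z + h) - f z)) + m * (f (z + h) - f z - l * h))%C by ring.
  eapply Rle_trans; [apply Cmod_triangle|]. rewrite Cmod_mult.
  pose proof (Cmod_triangle (f (z + h) - f z - l * h)%C (l * h)%C) as T.
  replace (f (z + h) - f z - l * h + l * h)%C with (f (z + h) - f z)%C in T by ring.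
  rewrite Cmod_mult in T.
  pose proof (Cmod_ge_0 h) as Hh0.
  assert (Ha : e1 <= 1) by apply Rmin_l.
  assert (Hb : e1 <= eps / (2 * (Cmod m + 1))) by apply Rmin_r.
  assert (Hc : Cmod m * e1 <= eps / 2).
  { apply Rle_trans with (Cmod m * (eps / (2 * (Cmod m + 1)))); [nra|].
    replace (eps / 2) with ((Cmod m + 1) * (eps / (2 * (Cmod m + 1)))) by (field; lra).
    apply Rmult_le_compat_r; [apply Rlt_le, Rdiv_lt_0_compat; lra|lra]. }
  assert (Hd : e2 * (Cmod l + 1) = eps / 2) by (unfold e2; field; lra).
  set (X := Cmod (f (z + h) - f z - l * h)%C) in *.
  set (Y := Cmod (f (z + h) - f z)%C) in *. set (H := Cmod h) in *.
  assert (X <= H) by nra.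
  assert (e2 * Y <= e2 * ((Cmod l + 1) * H)) by (apply Rmult_le_compat_l; nra).
  assert (Cmod m * X <= Cmod m * (e1 * H)) by (apply Rmult_le_compat_l; lra).
  nra.
Qed.

Lemma Cderiv_inv (f : C -> C) (z l : C) :
  f z <> 0 -> Cderiv f z l -> Cderiv (fun u => / f u)%C z (- l / (f z * f z))%C.
Proof.
  intros Hz Hf eps He.
  pose proof (Cmod_ge_0 l) as Hl. pose proof (proj1 (Cmod_gt_0 _) Hz) as HF.
  set (F := Cmod (f z)) in *.
  (* The first bound keeps [f (z + h)] at modulus at least [F / 2]; the second pays for the
     denominator [f z * f z * f (z + h)], whose modulus is then at least [F ^ 3 / 2]. *)
  set (e := Rmin (F / 2) (eps * (F * F * F) / (4 * (F + Cmod l + 1)))).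
  assert (He' : 0 < e).
  { apply Rmin_pos; [lra|]. apply Rdiv_lt_0_compat; [|lra].
    apply Rmult_lt_0_compat; [lra|]. repeat apply Rmult_lt_0_compat; lra. }
  destruct (Hf e He') as [d1 [Hd1 H1]].
  destruct (Cderiv_cts _ _ _ Hf e He') as [d2 [Hd2 H2]].
  exists (Rmin d1 d2); split; [apply Rmin_pos; auto|]. intros h Hh.
  specialize (H1 h (Rlt_le_trans _ _ _ Hh (Rmin_l _ _))).
  specialize (H2 (z + h)%C). replace (z + h - z)%C with h in H2 by ring.
  specialize (H2 (Rlt_le_trans _ _ _ Hh (Rmin_r _ _))).
  assert (Ha : e <= F / 2) by apply Rmin_l.
  assert (Hb : e <= eps * (F * F * F) / (4 * (F + Cmod l + 1))) by apply Rmin_r.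
  assert (HG : F / 2 <= Cmod (f (z + h))%C).
  { pose proof (Cmod_minus_triangle (f (z + h))%C (f (z + h) - f z)%C) as T.
    replace (f (z + h) - (f (z + h) - f z))%C with (f z) in T by ring. fold F in T. lra. }
  assert (HGz : f (z + h)%C <> 0) by (apply Cmod_gt_0; lra).
  replace (/ f (z + h) - / f z - - l / (f z * f z) * h)%C
    with ((- f z * (f (z + h) - f z - l * h) + l * h * (f (z + h) - f z))
            / (f z * f z * f (z + h)))%C by (field; auto).
  rewrite Cmod_div by (repeat apply Cmult_neq_0; auto).
  pose proof (Cmod_triangle (- f z * (f (z + h) - f z - l * h))%C (l * h * (f (z + h) - f z))%C) as T.
  rewrite !Cmod_mult, Cmod_opp in T. rewrite !Cmod_mult. fold F. fold F in T.
  pose proof (Cmod_ge_0 h) as Hh0.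
  set (H := Cmod h) in *. set (G := Cmod (f (z + h))%C) in *.
  set (X := Cmod (f (z + h) - f z - l * h)%C) in *. set (Y := Cmod (f (z + h) - f z)%C) in *.
  assert (HFG : 0 < F * F * G) by (repeat apply Rmult_lt_0_compat; lra).
  apply Rle_div_l; [exact HFG|].
  eapply Rle_trans; [exact T|].
  assert (E : e * (F + Cmod l + 1) <= eps * (F * F * F) / 4).
  { apply Rle_trans with (eps * (F * F * F) / (4 * (F + Cmod l + 1)) * (F + Cmod l + 1)).
    - apply Rmult_le_compat_r; lra.
    - right; field; lra. }
  assert (F * X <= F * (e * H)) by (apply Rmult_le_compat_l; lra).
  assert (Cmod l * H * Y <= Cmod l * H * e) by (apply Rmult_le_compat_l; [apply Rmult_le_pos|]; lra).
  assert (H * (e * (F + Cmod l + 1)) <= H * (eps * (F * F * F) / 4)) by (apply Rmult_le_compat_l; lra).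
  assert (eps * H * (F * F) * (F / 2) <= eps * H * (F * F) * G).
  { apply Rmult_le_compat_l; [|lra]. apply Rmult_le_pos; nra. }
  assert (0 <= e * H) by nra.
  assert (0 <= eps * H * (F * F * F)).
  { apply Rmult_le_pos; [nra|]. repeat apply Rmult_le_pos; lra. }
  nra.
Qed.

(** * The complex exponential *)

Lemma Cexp_plus (u v : C) : Cexp (u + v) = (Cexp u * Cexp v)%C.
Proof.
  unfold Cexp. destruct u as [a b], v as [c d]; simpl.
  apply injective_projections; simpl; rewrite exp_plus, ?cos_plus, ?sin_plus; ring.
Qed.

Lemma Cexp_0 : Cexp 0 = RtoC 1.
Proof.
  unfold Cexp; simpl. rewrite exp_0, cos_0, sin_0.
  apply injective_projections; simpl; ring.
Qed.

Lemma Cmod_Cexp (z : C) : Cmod (Cexp z) = exp (Re z).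
Proof.
  unfold Cexp, Cmod; simpl.
  replace (exp (Re z) * cos (Im z) * (exp (Re z) * cos (Im z) * 1) +
     exp (Re z) * sin (Im z) * (exp (Re z) * sin (Im z) * 1))
    with (Rsqr (exp (Re z)) * (Rsqr (sin (Im z)) + Rsqr (cos (Im z)))) by (unfold Rsqr; ring).
  rewrite sin2_cos2, Rmult_1_r. apply sqrt_Rsqr, Rlt_le, exp_pos.
Qed.

Lemma Cexp_nz (z : C) : Cexp z <> 0.
Proof. apply Cmod_gt_0. rewrite Cmod_Cexp. apply exp_pos. Qed.

Lemma Cexp_opp (z : C) : Cexp (- z) = (/ Cexp z)%C.
Proof.
  assert (H : (Cexp (- z) * Cexp z = 1)%C).
  { rewrite <- Cexp_plus. replace (- z + z)%C with (RtoC 0) by ring. apply Cexp_0. }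
  pose proof (Cexp_nz z).
  replace (Cexp (- z)) with (Cexp (- z) * Cexp z / Cexp z)%C by (field; auto).
  rewrite H. field; auto.
Qed.

Lemma exp_le (x y : R) : x <= y -> exp x <= exp y.
Proof. intros [H| ->]; [left; apply exp_increasing; auto|lra]. Qed.

Lemma derivable_pt_lim_0_bound f l eps :
  derivable_pt_lim f 0 l -> 0 < eps -> exists d, 0 < d /\ forall h, Rabs h < d ->
  Rabs (f h - f 0 - l * h) <= eps * Rabs h.
Proof.
  intros H He. destruct (H eps He) as [d Hd]. exists d; split; [apply cond_pos|].
  intros h Hh. destruct (Req_dec h 0) as [->|Hn].
  { replace (f 0 - f 0 - l * 0) with 0 by ring. rewrite Rabs_R0; lra. }
  specialize (Hd h Hn Hh). rewrite Rplus_0_l in Hd.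
  replace (f h - f 0 - l * h) with (((f h - f 0) / h - l) * h) by (field; auto).
  rewrite Rabs_mult. apply Rmult_le_compat_r; [apply Rabs_pos|lra].
Qed.

(** Only the origin requires estimates, taken from the real derivatives of [exp], [sin] and [cos]
    there; [Cexp_plus] carries the result to every other point. *)
Lemma Cderiv_Cexp_0 : Cderiv Cexp 0 1.
Proof.
  intros eps He. set (e := Rmin (eps / 16) 1).
  assert (He' : 0 < e) by (apply Rmin_pos; lra).
  assert (He1 : e <= 1) by apply Rmin_r. assert (He2 : e <= eps / 16) by apply Rmin_l.
  clearbody e.
  assert (L1 : derivable_pt_lim exp 0 1) by (rewrite <- exp_0; apply derivable_pt_lim_exp).
  assert (L2 : derivable_pt_lim sin 0 1) by (rewrite <- cos_0; apply derivable_pt_lim_sin).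
  assert (L3 : derivable_pt_lim cos 0 0).
  { pose proof (derivable_pt_lim_cos 0) as L. rewrite sin_0, Ropp_0 in L. exact L. }
  destruct (derivable_pt_lim_0_bound _ _ _ L1 He') as [d1 [Hd1 H1]].
  destruct (derivable_pt_lim_0_bound _ _ _ L2 He') as [d2 [Hd2 H2]].
  destruct (derivable_pt_lim_0_bound _ _ _ L3 He') as [d3 [Hd3 H3]].
  exists (Rmin (Rmin d1 e) (Rmin d2 d3)); split; [repeat apply Rmin_pos; auto|].
  intros [x y] Hh.
  rewrite Cexp_0. replace (0 + (x, y))%C with ((x, y) : C) by (apply injective_projections; simpl; ring).
  pose proof (re_le_Cmod (x, y)) as Hx. pose proof (im_le_Cmod (x, y)) as Hy. simpl in Hx, Hy.
  set (r := Cmod (x, y)) in *.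
  pose proof (Rmin_l (Rmin d1 e) (Rmin d2 d3)). pose proof (Rmin_r (Rmin d1 e) (Rmin d2 d3)).
  pose proof (Rmin_l d1 e). pose proof (Rmin_r d1 e). pose proof (Rmin_l d2 d3). pose proof (Rmin_r d2 d3).
  assert (B1 := H1 x ltac:(lra)). assert (B2 := H2 y ltac:(lra)). assert (B3 := H3 y ltac:(lra)).
  rewrite exp_0 in B1. rewrite sin_0 in B2. rewrite cos_0 in B3.
  replace (Cexp (x, y) - 1 - 1 * (x, y))%C
    with ((exp x - 1 - 1 * x) + exp x * (cos y - 1 - 0 * y),
          exp x * (sin y - 0 - 1 * y) + (exp x - 1 - 1 * x) * y + x * y).
  2:{ unfold Cexp; simpl. apply injective_projections; simpl; ring. }
  eapply Rle_trans; [apply Cmod_pair|].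
  assert (Hex : exp x <= 3).
  { apply Rle_trans with (exp 1); [|apply exp_le_3].
    apply exp_le. pose proof (Rle_abs x); lra. }
  pose proof (exp_pos x) as Hep.
  pose proof (Rabs_pos x). pose proof (Rabs_pos y).
  assert (Q1 : Rabs (exp x - 1 - 1 * x + exp x * (cos y - 1 - 0 * y)) <= 4 * e * r).
  { eapply Rle_trans; [apply Rabs_triang|]. rewrite Rabs_mult, (Rabs_pos_eq (exp x)) by lra.
    assert (exp x * Rabs (cos y - 1 - 0 * y) <= 3 * (e * r)); [|nra].
    apply Rmult_le_compat; try lra; [apply Rabs_pos|nra]. }
  assert (Q2 : Rabs (exp x * (sin y - 0 - 1 * y) + (exp x - 1 - 1 * x) * y + x * y) <= 5 * e * r).
  { eapply Rle_trans; [apply Rabs_triang|].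
    eapply Rle_trans; [apply Rplus_le_compat_r, Rabs_triang|].
    rewrite !Rabs_mult, (Rabs_pos_eq (exp x)) by lra.
    assert (exp x * Rabs (sin y - 0 - 1 * y) <= 3 * (e * r)).
    { apply Rmult_le_compat; try lra; [apply Rabs_pos|nra]. }
    assert (Rabs (exp x - 1 - 1 * x) * Rabs y <= e * r).
    { apply Rle_trans with (e * 1 * r); [|lra]. apply Rmult_le_compat; try apply Rabs_pos; nra. }
    assert (Rabs x * Rabs y <= e * r) by (apply Rmult_le_compat; lra). lra. }
  assert (0 <= r) by apply Cmod_ge_0. nra.
Qed.

Lemma Cderiv_Cexp (z : C) : Cderiv Cexp z (Cexp z).
Proof.
  intros eps He. pose proof (exp_pos (Re z)) as Hp.
  destruct (Cderiv_Cexp_0 (eps / exp (Re z))) as [d [Hd H]].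
  { apply Rdiv_lt_0_compat; auto. }
  exists d; split; auto. intros h Hh. specialize (H h Hh).
  rewrite Cexp_0 in H. replace (0 + h)%C with h in H by ring.
  rewrite Cexp_plus.
  replace (Cexp z * Cexp h - Cexp z - Cexp z * h)%C with (Cexp z * (Cexp h - 1 - 1 * h))%C by ring.
  rewrite Cmod_mult, Cmod_Cexp.
  apply Rle_trans with (exp (Re z) * (eps / exp (Re z) * Cmod h)).
  - apply Rmult_le_compat_l; lra.
  - right; field; lra.
Qed.

Lemma holo_const k z : holo (fun _ => k) z.
Proof. eexists; apply Cderiv_const. Qed.
Lemma holo_id z : holo (fun u => u) z.
Proof. eexists; apply Cderiv_id. Qed.
Lemma holo_plus f g z : holo f z -> holo g z -> holo (fun u => f u + g u)%C z.
Proof. intros [l H] [m K]; eexists; apply Cderiv_plus; eauto. Qed.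
Lemma holo_mult f g z : holo f z -> holo g z -> holo (fun u => f u * g u)%C z.
Proof. intros [l H] [m K]; eexists; apply Cderiv_mult; eauto. Qed.
Lemma holo_ext f g z : (forall u, f u = g u) -> holo f z -> holo g z.
Proof.
  intros E [l H]; exists l. intros eps He. destruct (H eps He) as [d [Hd K]].
  exists d; split; auto. intros h Hh. rewrite <- !E. auto.
Qed.
Lemma holo_opp f z : holo f z -> holo (fun u => - f u)%C z.
Proof.
  intros H. apply holo_ext with (fun u => RtoC (-1) * f u)%C.
  - intros u. replace (RtoC (-1)) with (- (1))%C by (apply injective_projections; simpl; ring). ring.
  - apply holo_mult; [apply holo_const|auto].
Qed.
Lemma holo_minus f g z : holo f z -> holo g z -> holo (fun u => f u - g u)%C z.
Proof. intros; apply holo_plus; [|apply holo_opp]; auto. Qed.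
Lemma holo_inv (f : C -> C) z : f z <> 0 -> holo f z -> holo (fun u => / f u)%C z.
Proof. intros Hz [l H]; eexists; apply Cderiv_inv; eauto. Qed.
Lemma holo_div (f g : C -> C) z : g z <> 0 -> holo f z -> holo g z -> holo (fun u => f u / g u)%C z.
Proof. intros; apply holo_mult; [|apply holo_inv]; auto. Qed.
Lemma holo_Cexp f z : holo f z -> holo (fun u => Cexp (f u)) z.
Proof. intros [l H]; eexists; apply Cderiv_comp; [eauto|apply Cderiv_Cexp]. Qed.

(** * Rectangle integrals and the theorem of Goursat *)

Definition Cint (f : R -> C) (a b : R) : C :=
  (RInt (fun t => fst (f t)) a b, RInt (fun t => snd (f t)) a b).

Definition ex_Cint (f : R -> C) (a b : R) : Prop :=
  ex_RInt (fun t => fst (f t)) a b /\ ex_RInt (fun t => snd (f t)) a b.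

Lemma Cint_ext f g a b :
  (forall t, Rmin a b < t < Rmax a b -> f t = g t) -> Cint f a b = Cint g a b.
Proof.
  intros H. unfold Cint. f_equal; apply RInt_ext; intros t Ht; rewrite H; auto.
Qed.

Lemma Cint_const k a b : Cint (fun _ => k) a b = (RtoC (b - a) * k)%C.
Proof.
  unfold Cint. rewrite !RInt_const. unfold scal; simpl; unfold mult; simpl.
  apply injective_projections; simpl; ring.
Qed.

Lemma Cint_plus f g a b : ex_Cint f a b -> ex_Cint g a b ->
  Cint (fun t => f t + g t)%C a b = (Cint f a b + Cint g a b)%C.
Proof.
  intros [F1 F2] [G1 G2]. unfold Cint. apply injective_projections; simpl.
  - apply (RInt_plus (V := R_CompleteNormedModule) (fun t => fst (f t)) (fun t => fst (g t))); auto.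
  - apply (RInt_plus (V := R_CompleteNormedModule) (fun t => snd (f t)) (fun t => snd (g t))); auto.
Qed.

Lemma ex_Cint_plus f g a b : ex_Cint f a b -> ex_Cint g a b ->
  ex_Cint (fun t => f t + g t)%C a b.
Proof.
  intros [F1 F2] [G1 G2]. split; simpl.
  - apply (ex_RInt_plus (V := R_NormedModule) (fun t => fst (f t)) (fun t => fst (g t))); auto.
  - apply (ex_RInt_plus (V := R_NormedModule) (fun t => snd (f t)) (fun t => snd (g t))); auto.
Qed.

Lemma Cint_opp f a b : ex_Cint f a b ->
  Cint (fun t => - f t)%C a b = (- Cint f a b)%C.
Proof.
  intros [F1 F2]. unfold Cint. apply injective_projections; simpl.
  - apply (RInt_opp (V := R_CompleteNormedModule) (fun t => fst (f t))); auto.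
  - apply (RInt_opp (V := R_CompleteNormedModule) (fun t => snd (f t))); auto.
Qed.

Lemma ex_Cint_opp f a b : ex_Cint f a b -> ex_Cint (fun t => - f t)%C a b.
Proof.
  intros [F1 F2]. split; simpl.
  - apply (ex_RInt_opp (V := R_NormedModule) (fun t => fst (f t))); auto.
  - apply (ex_RInt_opp (V := R_NormedModule) (fun t => snd (f t))); auto.
Qed.

Lemma Cint_minus f g a b : ex_Cint f a b -> ex_Cint g a b ->
  Cint (fun t => f t - g t)%C a b = (Cint f a b - Cint g a b)%C.
Proof.
  intros F G. unfold Cminus. rewrite <- (Cint_opp g) by auto.
  apply Cint_plus; auto. apply ex_Cint_opp; auto.
Qed.

Lemma ex_Cint_minus f g a b : ex_Cint f a b -> ex_Cint g a b ->
  ex_Cint (fun t => f t - g t)%C a b.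
Proof. intros F G. apply ex_Cint_plus; auto. apply ex_Cint_opp; auto. Qed.

Lemma Cint_scal k f a b : ex_Cint f a b ->
  Cint (fun t => k * f t)%C a b = (k * Cint f a b)%C.
Proof.
  intros [F1 F2]. unfold Cint. destruct k as [k1 k2].
  assert (S : forall (r : R) g, ex_RInt g a b -> RInt (fun t => r * g t) a b = r * RInt g a b)
    by (intros r g; apply (RInt_scal (V := R_CompleteNormedModule))).
  assert (E : forall (r : R) g, ex_RInt g a b -> ex_RInt (fun t => r * g t) a b)
    by (intros r g; apply (ex_RInt_scal (V := R_CompleteNormedModule))).
  apply injective_projections; simpl.
  - rewrite <- !S by auto.
    apply (RInt_minus (V := R_CompleteNormedModule) (fun t => k1 * fst (f t)) (fun t => k2 * snd (f t))); auto.
  - rewrite <- !S by auto.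
    apply (RInt_plus (V := R_CompleteNormedModule) (fun t => k1 * snd (f t)) (fun t => k2 * fst (f t))); auto.
Qed.

Lemma Cint_Chasles f a b c : ex_Cint f a b -> ex_Cint f b c ->
  (Cint f a b + Cint f b c)%C = Cint f a c.
Proof.
  intros [F1 F2] [G1 G2]. unfold Cint. apply injective_projections; simpl.
  - apply (RInt_Chasles (V := R_CompleteNormedModule) (fun t => fst (f t))); auto.
  - apply (RInt_Chasles (V := R_CompleteNormedModule) (fun t => snd (f t))); auto.
Qed.

(** The factor 2 comes from estimating the two real components separately; later uses only ask for
    some fixed constant. *)
Lemma Cint_bound f a b M : a <= b -> ex_Cint f a b ->
  (forall t, a <= t <= b -> Cmod (f t) <= M) -> Cmod (Cint f a b) <= 2 * M * (b - a).
Proof.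
  intros Hab [F1 F2] H. unfold Cint. eapply Rle_trans; [apply Cmod_pair|].
  assert (B1 : Rabs (RInt (fun t => fst (f t)) a b) <= (b - a) * M).
  { apply abs_RInt_le_const; auto. intros t Ht. eapply Rle_trans; [apply re_le_Cmod|auto]. }
  assert (B2 : Rabs (RInt (fun t => snd (f t)) a b) <= (b - a) * M).
  { apply abs_RInt_le_const; auto. intros t Ht. eapply Rle_trans; [apply im_le_Cmod|auto]. }
  lra.
Qed.

Lemma Ccts_line (f : C -> C) (g : R -> C) t :
  (forall s, Cmod (g s - g t) <= Rabs (s - t)) -> Ccts f (g t) ->
  continuous (fun s => fst (f (g s))) t /\ continuous (fun s => snd (f (g s))) t.
Proof.
  intros Hg H. split; apply continuity_pt_filterlim; intros eps He;
    destruct (H eps He) as [d [Hd K]]; exists d; split; auto;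
    intros s [_ Hs]; simpl in *; unfold R_dist in *;
    specialize (K (g s) (Rle_lt_trans _ _ _ (Hg s) Hs));
    eapply Rle_lt_trans; [|exact K| |exact K].
  - apply (re_le_Cmod (f (g s) - f (g t))%C).
  - apply (im_le_Cmod (f (g s) - f (g t))%C).
Qed.

Lemma ex_Cint_h f a b c : a <= b -> (forall x, a <= x <= b -> Ccts f (x, c)) ->
  ex_Cint (fun x => f (x, c)) a b.
Proof.
  intros Hab H. split; apply (ex_RInt_continuous (V := R_CompleteNormedModule)); intros x Hx;
    rewrite Rmin_left, Rmax_right in Hx by auto;
    apply (Ccts_line f (fun x => (x, c)) x); auto; intros s;
    unfold Cmod; simpl; apply Req_le; rewrite <- sqrt_Rsqr_abs; f_equal; unfold Rsqr; ring.
Qed.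

Lemma ex_Cint_v f a c d : c <= d -> (forall y, c <= y <= d -> Ccts f (a, y)) ->
  ex_Cint (fun y => f (a, y)) c d.
Proof.
  intros Hab H. split; apply (ex_RInt_continuous (V := R_CompleteNormedModule)); intros x Hx;
    rewrite Rmin_left, Rmax_right in Hx by auto;
    apply (Ccts_line f (fun y => (a, y)) x); auto; intros s;
    unfold Cmod; simpl; apply Req_le; rewrite <- sqrt_Rsqr_abs; f_equal; unfold Rsqr; ring.
Qed.

(* Counterclockwise integral over the boundary of [a, b] x [c, d], opposite sides paired. *)
Definition rint (f : C -> C) (a b c d : R) : C :=
  (Cint (fun x => f (x, c) - f (x, d)) a b
   + Ci * Cint (fun y => f (b, y) - f (a, y)) c d)%C.

Definition cts_boundary (f : C -> C) (a b c d : R) : Prop :=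
  (forall x, a <= x <= b -> Ccts f (x, c) /\ Ccts f (x, d)) /\
  (forall y, c <= y <= d -> Ccts f (a, y) /\ Ccts f (b, y)).

Lemma cts_boundary_ex f a b c d : a <= b -> c <= d -> cts_boundary f a b c d ->
  ex_Cint (fun x => f (x, c)) a b /\ ex_Cint (fun x => f (x, d)) a b /\
  ex_Cint (fun y => f (a, y)) c d /\ ex_Cint (fun y => f (b, y)) c d.
Proof.
  intros Hab Hcd [H1 H2].
  split; [|split; [|split]].
  - apply ex_Cint_h; auto; intros x Hx; apply (H1 x Hx).
  - apply ex_Cint_h; auto; intros x Hx; apply (H1 x Hx).
  - apply ex_Cint_v; auto; intros y Hy; apply (H2 y Hy).
  - apply ex_Cint_v; auto; intros y Hy; apply (H2 y Hy).
Qed.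

Lemma rint_plus f g a b c d : a <= b -> c <= d ->
  cts_boundary f a b c d -> cts_boundary g a b c d ->
  rint (fun z => f z + g z)%C a b c d = (rint f a b c d + rint g a b c d)%C.
Proof.
  intros Hab Hcd F G.
  destruct (cts_boundary_ex _ _ _ _ _ Hab Hcd F) as (F1 & F2 & F3 & F4).
  destruct (cts_boundary_ex _ _ _ _ _ Hab Hcd G) as (G1 & G2 & G3 & G4).
  unfold rint.
  rewrite (Cint_ext _ (fun x => (f (x, c) - f (x, d)) + (g (x, c) - g (x, d)))%C a b)
    by (intros; ring).
  rewrite (Cint_ext _ (fun y => (f (b, y) - f (a, y)) + (g (b, y) - g (a, y)))%C c d)
    by (intros; ring).
  rewrite !Cint_plus by (apply ex_Cint_minus; auto). ring.
Qed.

Lemma rint_bound f a b c d M : a <= b -> c <= d -> cts_boundary f a b c d ->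
  (forall x, a <= x <= b -> Cmod (f (x, c)) <= M /\ Cmod (f (x, d)) <= M) ->
  (forall y, c <= y <= d -> Cmod (f (a, y)) <= M /\ Cmod (f (b, y)) <= M) ->
  Cmod (rint f a b c d) <= 4 * M * ((b - a) + (d - c)).
Proof.
  intros Hab Hcd F B1 B2.
  destruct (cts_boundary_ex _ _ _ _ _ Hab Hcd F) as (F1 & F2 & F3 & F4).
  unfold rint. eapply Rle_trans; [apply Cmod_triangle|].
  rewrite Cmod_mult, Cmod_Ci, Rmult_1_l.
  assert (Cmod (Cint (fun x => f (x, c) - f (x, d))%C a b) <= 2 * (2 * M) * (b - a)).
  { apply Cint_bound; auto. apply ex_Cint_minus; auto. intros x Hx.
    eapply Rle_trans; [apply Cmod_minus_triangle|]. destruct (B1 x Hx); lra. }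
  assert (Cmod (Cint (fun y => f (b, y) - f (a, y))%C c d) <= 2 * (2 * M) * (d - c)).
  { apply Cint_bound; auto. apply ex_Cint_minus; auto. intros x Hx.
    eapply Rle_trans; [apply Cmod_minus_triangle|]. destruct (B2 x Hx); lra. }
  lra.
Qed.

(** Pairing opposite sides makes both integrands constant, and the two contributions cancel. This
    lets [goursat] subtract a tangent map without any notion of primitive. *)
Lemma rint_affine A B a b c d :
  rint (fun z => A + B * z)%C a b c d = 0.
Proof.
  unfold rint.
  rewrite (Cint_ext _ (fun _ => B * (0%R, (c - d)%R))%C a b)
    by (intros; apply injective_projections; simpl; ring).
  rewrite (Cint_ext _ (fun _ => B * RtoC (b - a))%C c d)
    by (intros; apply injective_projections; simpl; ring).
  rewrite !Cint_const. apply injective_projections; simpl; ring.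
Qed.

Lemma rint_split_x f a m b c d : a <= m <= b -> c <= d ->
  cts_boundary f a m c d -> cts_boundary f m b c d ->
  rint f a b c d = (rint f a m c d + rint f m b c d)%C.
Proof.
  intros Hm Hcd F G.
  destruct (cts_boundary_ex _ _ _ _ _ (proj1 Hm) Hcd F) as (F1 & F2 & F3 & F4).
  destruct (cts_boundary_ex _ _ _ _ _ (proj2 Hm) Hcd G) as (G1 & G2 & G3 & G4).
  unfold rint.
  rewrite <- (Cint_Chasles (fun x => f (x, c) - f (x, d))%C a m b)
    by (apply ex_Cint_minus; auto).
  rewrite (Cint_ext (fun y => f (b, y) - f (a, y))%C
    (fun y => (f (m, y) - f (a, y)) + (f (b, y) - f (m, y)))%C c d) by (intros; ring).
  rewrite (Cint_plus (fun y => f (m, y) - f (a, y))%C (fun y => f (b, y) - f (m, y))%C)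
    by (apply ex_Cint_minus; auto). ring.
Qed.

Lemma rint_split_y f a b c m d : a <= b -> c <= m <= d ->
  cts_boundary f a b c m -> cts_boundary f a b m d ->
  rint f a b c d = (rint f a b c m + rint f a b m d)%C.
Proof.
  intros Hab Hm F G.
  destruct (cts_boundary_ex _ _ _ _ _ Hab (proj1 Hm) F) as (F1 & F2 & F3 & F4).
  destruct (cts_boundary_ex _ _ _ _ _ Hab (proj2 Hm) G) as (G1 & G2 & G3 & G4).
  unfold rint.
  rewrite <- (Cint_Chasles (fun y => f (b, y) - f (a, y))%C c m d)
    by (apply ex_Cint_minus; auto).
  rewrite (Cint_ext (fun x => f (x, c) - f (x, d))%C
    (fun x => (f (x, c) - f (x, m)) + (f (x, m) - f (x, d)))%C a b) by (intros; ring).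
  rewrite (Cint_plus (fun x => f (x, c) - f (x, m))%C (fun x => f (x, m) - f (x, d))%C)
    by (apply ex_Cint_minus; auto). ring.
Qed.

Lemma nested_intervals (u w : nat -> R) : (forall k, u k <= u (S k)) ->
  (forall k, u (S k) + w (S k) <= u k + w k) -> (forall k, 0 <= w k) ->
  exists l, forall k, u k <= l <= u k + w k.
Proof.
  intros H1 H2 H3.
  assert (M : forall k n, u k <= u (k + n)%nat /\ u (k + n)%nat + w (k + n)%nat <= u k + w k).
  { intros k n. induction n as [|n [I1 I2]].
    - rewrite Nat.add_0_r; lra.
    - replace (k + S n)%nat with (S (k + n)) by lia.
      pose proof (H1 (k + n)%nat). pose proof (H2 (k + n)%nat). lra. }
  assert (B : forall j k, u k <= u j + w j).
  { intros j k. destruct (Nat.le_ge_cases j k) as [L|L].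
    - destruct (M j (k - j)%nat) as [_ I]. replace (j + (k - j))%nat with k in I by lia.
      pose proof (H3 k). lra.
    - destruct (M k (j - k)%nat) as [I _]. replace (k + (j - k))%nat with j in I by lia.
      pose proof (H3 j). lra. }
  destruct (completeness (fun x => exists k, x = u k)) as [l [L1 L2]].
  - exists (u 0%nat + w 0%nat). intros x [k ->]. apply B.
  - exists (u 0%nat), 0%nat; auto.
  - exists l. intros k. split; [apply L1; eauto|]. apply L2. intros x [j ->]. apply B.
Qed.

(** Here [k] is the depth: a rectangle at depth [k] has sides [W / 2 ^ k] and [H / 2 ^ k]. Working
    with an arbitrary predicate separates the choice of nested rectangles from the estimates of
    [goursat]. *)
Lemma rect_bisection (P : nat -> R -> R -> Prop) (a c W H : R) :
  let inR k x y := a <= x /\ x + W / 2 ^ k <= a + W /\ c <= y /\ y + H / 2 ^ k <= c + H in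
  0 <= W -> 0 <= H ->
  (forall k x y, inR k x y ->
     P (S k) x y -> P (S k) (x + W / 2 ^ S k) y -> P (S k) x (y + H / 2 ^ S k) ->
     P (S k) (x + W / 2 ^ S k) (y + H / 2 ^ S k) -> P k x y) ->
  (forall x0 y0, a <= x0 <= a + W -> c <= y0 <= c + H ->
     exists K, forall k x y, (K <= k)%nat -> inR k x y ->
       x <= x0 <= x + W / 2 ^ k -> y <= y0 <= y + H / 2 ^ k -> P k x y) ->
  P 0%nat a c.
Proof.
  (* If the property failed for the whole rectangle, every failing rectangle would have a failing
     quarter. The quarters selected by [epsilon] shrink to a point, where the local hypothesis is
     violated. *)
  intros inR HW HH Hjoin Hloc. apply NNPP. intros Hn.
  assert (Hhalf : forall (V : R) k, V / 2 ^ k = V / 2 ^ S k + V / 2 ^ S k).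
  { intros V k. simpl. field. apply pow_nonzero; lra. }
  assert (Hpos : forall (V : R) k, 0 <= V -> 0 <= V / 2 ^ k).
  { intros V k HV. apply Rmult_le_pos; auto. apply Rlt_le, Rinv_0_lt_compat, pow_lt; lra. }
  set (bad k s := inR k (fst s) (snd s) /\ ~ P k (fst s) (snd s)).
  set (nxt k (s t : R * R) := bad (S k) t /\
     fst s <= fst t /\ fst t + W / 2 ^ S k <= fst s + W / 2 ^ k /\
     snd s <= snd t /\ snd t + H / 2 ^ S k <= snd s + H / 2 ^ k).
  assert (Hstep : forall k s, bad k s -> exists t, nxt k s t).
  { intros k [x y] [Hin HP]. apply NNPP. intros HN. apply HP. simpl in Hin; simpl.
    pose proof (Hhalf W k) as E1. pose proof (Hhalf H k) as E2.
    pose proof (Hpos W (S k) HW) as G1. pose proof (Hpos H (S k) HH) as G2.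
    destruct Hin as (I1 & I2 & I3 & I4).
    assert (Q : forall x' y', x <= x' -> x' + W / 2 ^ S k <= x + W / 2 ^ k ->
      y <= y' -> y' + H / 2 ^ S k <= y + H / 2 ^ k -> P (S k) x' y').
    { intros x' y' J1 J2 J3 J4. apply NNPP. intros HP'. apply HN. exists (x', y').
      unfold nxt, bad, inR; simpl fst; simpl snd. repeat split; auto; lra. }
    apply Hjoin; [unfold inR; auto| | | |]; apply Q; lra. }
  set (step k s := epsilon (inhabits s) (nxt k s)).
  set (sq := fix sq k := match k with O => (a, c) | S k => step k (sq k) end).
  assert (Hbad : forall k, bad k (sq k)).
  { induction k as [|k IH].
    - unfold bad, inR; simpl. split; auto. rewrite !Rdiv_1_r. lra.
    - simpl. apply (epsilon_spec (inhabits (sq k)) (nxt k (sq k))). auto. }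
  assert (Hnxt : forall k, nxt k (sq k) (sq (S k))).
  { intros k. simpl. apply (epsilon_spec (inhabits (sq k)) (nxt k (sq k))). auto. }
  destruct (nested_intervals (fun k => fst (sq k)) (fun k => W / 2 ^ k)) as [x0 Hx0].
  { intros k; apply Hnxt. } { intros k; apply Hnxt. } { intros k; auto. }
  destruct (nested_intervals (fun k => snd (sq k)) (fun k => H / 2 ^ k)) as [y0 Hy0].
  { intros k; apply Hnxt. } { intros k; apply Hnxt. } { intros k; auto. }
  assert (Rx : a <= x0 <= a + W) by (specialize (Hx0 0%nat); simpl in Hx0; lra).
  assert (Ry : c <= y0 <= c + H) by (specialize (Hy0 0%nat); simpl in Hy0; lra).
  destruct (Hloc x0 y0 Rx Ry) as [K HK].
  destruct (Hbad K) as [B1 B2]. apply B2. apply (HK K); auto.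
Qed.

Lemma Cminus_pair (x y x0 y0 : R) :
  Cmod ((x, y) - (x0, y0))%C <= Rabs (x - x0) + Rabs (y - y0).
Proof. apply (Cmod_pair (x - x0) (y - y0)). Qed.

(** The bisected property is the bound [4 * eps * s ^ 2] with [s] the half-perimeter. Quartering
    divides [s ^ 2] by four, so four quarters yield the whole; on a small rectangle the tangent map
    integrates to 0 and the remainder is at most [eps * s] on the boundary. *)
Theorem goursat f a b c d : a <= b -> c <= d ->
  (forall x y, a <= x <= b -> c <= y <= d -> holo f (x, y)) -> rint f a b c d = 0.
Proof.
  intros Hab Hcd Hf. apply Cmod_eq_0. apply Rle_antisym; [|apply Cmod_ge_0].
  set (W := b - a). set (H := d - c).
  assert (HW : 0 <= W) by (unfold W; lra). assert (HH : 0 <= H) by (unfold H; lra).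
  assert (Hpos : forall (V : R) k, 0 <= V -> 0 <= V / 2 ^ k).
  { intros V k HV. apply Rmult_le_pos; auto. apply Rlt_le, Rinv_0_lt_compat, pow_lt; lra. }
  assert (Hct : forall x x' y y', a <= x -> x <= x' -> x' <= b -> c <= y -> y <= y' -> y' <= d ->
     cts_boundary f x x' y y').
  { intros. split; intros; split; apply holo_cts, Hf; lra. }
  apply le_epsilon. intros e0 He0. rewrite Rplus_0_l.
  (* The [+ 1] covers the degenerate rectangle with [W + H = 0]. *)
  set (eps := e0 / (4 * (W + H) ^ 2 + 1)).
  assert (Hden : 0 < 4 * (W + H) ^ 2 + 1) by (pose proof (pow2_ge_0 (W + H)); lra).
  assert (Heps : 0 < eps) by (unfold eps; apply Rdiv_lt_0_compat; auto).
  apply Rle_trans with (4 * eps * ((W + H) / 2 ^ 0) ^ 2).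
  2:{ simpl (2 ^ 0). rewrite Rdiv_1_r.
      replace e0 with (eps * (4 * (W + H) ^ 2 + 1)) by (unfold eps; field; lra). nra. }
  assert (G : Cmod (rint f a (a + W / 2 ^ 0) c (c + H / 2 ^ 0)) <= 4 * eps * ((W + H) / 2 ^ 0) ^ 2).
  2:{ simpl (2 ^ 0) in *. rewrite !Rdiv_1_r in *. unfold W, H in *.
      replace (a + (b - a)) with b in G by ring. replace (c + (d - c)) with d in G by ring. exact G. }
  apply (rect_bisection (fun k x y =>
    Cmod (rint f x (x + W / 2 ^ k) y (y + H / 2 ^ k)) <= 4 * eps * ((W + H) / 2 ^ k) ^ 2) a c W H HW HH).
  - intros k x y (I1 & I2 & I3 & I4) B1 B2 B3 B4.
    assert (E1 : W / 2 ^ k = W / 2 ^ S k + W / 2 ^ S k) by (simpl; field; apply pow_nonzero; lra).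
    assert (E2 : H / 2 ^ k = H / 2 ^ S k + H / 2 ^ S k) by (simpl; field; apply pow_nonzero; lra).
    assert (E3 : (W + H) / 2 ^ k = 2 * ((W + H) / 2 ^ S k)) by (simpl; field; apply pow_nonzero; lra).
    pose proof (Hpos W (S k) HW) as G1. pose proof (Hpos H (S k) HH) as G2.
    rewrite E3. rewrite E1, E2 in *. set (h := W / 2 ^ S k) in *. set (l := H / 2 ^ S k) in *.
    rewrite <- !Rplus_assoc in *. unfold W, H in I2, I4.
    rewrite (rint_split_x f x (x + h)) by (try apply Hct; lra).
    rewrite (rint_split_y f x (x + h) y (y + l)) by (try apply Hct; lra).
    rewrite (rint_split_y f (x + h) (x + h + h) y (y + l)) by (try apply Hct; lra).
    eapply Rle_trans; [apply Cmod_triangle|].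
    pose proof (Cmod_triangle (rint f x (x + h) y (y + l)) (rint f x (x + h) (y + l) (y + l + l))).
    pose proof (Cmod_triangle (rint f (x + h) (x + h + h) y (y + l)) (rint f (x + h) (x + h + h) (y + l) (y + l + l))).
    set (q := (W + H) / 2 ^ S k) in *.
    replace (4 * eps * (2 * q) ^ 2) with (4 * (4 * eps * q ^ 2)) by ring. lra.
  - intros x0 y0 Hx0 Hy0. unfold W in Hx0. unfold H in Hy0.
    destruct (Hf x0 y0 ltac:(lra) ltac:(lra)) as [l Hl].
    destruct (Hl eps Heps) as [dl [Hdl K]].
    destruct (pow_lt_1_zero (/ 2) ltac:(rewrite Rabs_pos_eq; lra) (dl / (W + H + 1)))
      as [N HN]. { apply Rdiv_lt_0_compat; lra. }
    exists N. intros k x y Hk (I1 & I2 & I3 & I4) Jx Jy.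
    assert (EW : a + W = b) by (unfold W; ring). assert (EH : c + H = d) by (unfold H; ring).
    pose proof (Hpos W k HW) as G1. pose proof (Hpos H k HH) as G2.
    assert (Hsz : W / 2 ^ k + H / 2 ^ k < dl).
    { specialize (HN k Hk). rewrite pow_inv in HN.
      assert (P2 : 0 < / 2 ^ k) by (apply Rinv_0_lt_compat, pow_lt; lra).
      rewrite Rabs_pos_eq in HN by lra.
      replace dl with (dl / (W + H + 1) * (W + H + 1)) by (field; lra).
      unfold Rdiv at 1 2. nra. }
    replace ((W + H) / 2 ^ k) with (W / 2 ^ k + H / 2 ^ k) by (field; apply pow_nonzero; lra).
    set (w := W / 2 ^ k) in *. set (h := H / 2 ^ k) in *.
    set (z0 := (x0, y0) : C).
    (* The remainder after subtracting the tangent map at the limit point; by [rint_affine] its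
       integral equals that of [f]. *)
    set (g := fun z => (f z - (f z0 - l * z0 + l * z))%C).
    assert (Hg : forall z, Ccts f z -> Ccts g z).
    { intros z Hz eps' He'. destruct (Hz (eps' / 2)) as [d1 [Hd1 D1]]; [lra|].
      pose proof (Cmod_ge_0 l).
      exists (Rmin d1 (eps' / (2 * (Cmod l + 1)))). split.
      { apply Rmin_pos; auto. apply Rdiv_lt_0_compat; lra. }
      intros u Hu. specialize (D1 u (Rlt_le_trans _ _ _ Hu (Rmin_l _ _))).
      pose proof (Rlt_le_trans _ _ _ Hu (Rmin_r _ _)) as D2.
      unfold g. replace (f u - (f z0 - l * z0 + l * u) - (f z - (f z0 - l * z0 + l * z)))%C
        with ((f u - f z) - l * (u - z))%C by ring.
      eapply Rle_lt_trans; [apply Cmod_minus_triangle|]. rewrite Cmod_mult.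
      assert (Cmod l * Cmod (u - z)%C <= eps' / 2); [|lra].
      replace (eps' / 2) with ((Cmod l + 1) * (eps' / (2 * (Cmod l + 1)))) by (field; lra).
      apply Rmult_le_compat; try apply Cmod_ge_0; lra. }
    assert (E : rint f x (x + w) y (y + h) = rint g x (x + w) y (y + h)).
    { transitivity (rint (fun z => (f z0 - l * z0 + l * z) + g z)%C x (x + w) y (y + h)).
      - unfold rint. f_equal; [|f_equal]; apply Cint_ext; intros; unfold g; ring.
      - rewrite rint_plus; [rewrite rint_affine; ring|lra|lra| |].
        + split; intros; split; apply holo_cts; apply holo_plus; try apply holo_const;
            apply holo_mult; try apply holo_const; apply holo_id.
        + destruct (Hct x (x + w) y (y + h)) as [C1 C2]; try lra.
          split; intros t Ht; split; apply Hg; apply C1 || apply C2; auto. }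
    rewrite E.
    assert (Hb : forall u v, x <= u <= x + w -> y <= v <= y + h -> Cmod (g (u, v)) <= eps * (w + h)).
    { intros u v Hu Hv.
      assert (D : Cmod ((u, v) - z0)%C <= w + h).
      { eapply Rle_trans; [apply Cminus_pair|]. apply Rplus_le_compat; apply Rabs_le; lra. }
      specialize (K ((u, v) - z0)%C ltac:(lra)). fold z0 in K.
      replace (z0 + ((u, v) - z0))%C with ((u, v) : C) in K by (apply injective_projections; simpl; ring).
      unfold g. replace (f (u, v) - (f z0 - l * z0 + l * (u, v)))%C
        with (f (u, v) - f z0 - l * ((u, v) - z0))%C by ring.
      eapply Rle_trans; [exact K|]. apply Rmult_le_compat_l; lra. }
    eapply Rle_trans; [apply (rint_bound g x (x + w) y (y + h) (eps * (w + h)))| right; ring].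
    + lra. + lra.
    + destruct (Hct x (x + w) y (y + h)) as [C1 C2]; try lra.
      split; intros t Ht; split; apply Hg; apply C1 || apply C2; auto.
    + intros; split; apply Hb; lra.
    + intros; split; apply Hb; lra.
Qed.

(** * Residues *)

(** A limit in place of a Laurent expansion: a quotient with a simple zero in the denominator yields
    it directly, and [r = 0] is allowed. *)
Definition simple_pole (f : C -> C) (z0 r : C) : Prop :=
  forall eps, 0 < eps -> exists d, 0 < d /\ forall u : C, u <> z0 -> Cmod (u - z0)%C < d ->
    Cmod ((u - z0) * f u - r)%C <= eps.

(** The primitive [2 * atan ((x - x0) / e)] runs from $-\pi/2$ to $\pi/2$. The kernel is what two
    opposite sides of a square centred at $z_0$ produce from $1/(z-z_0)$. *)
Lemma is_RInt_atan_kernel (x0 e : R) : 0 < e ->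
  is_RInt (fun x => 2 * e / ((x - x0) ^ 2 + e ^ 2)) (x0 - e) (x0 + e) PI.
Proof.
  intros He.
  assert (Hd : forall x, (x - x0) ^ 2 + e ^ 2 <> 0)
    by (intros x; apply Rgt_not_eq; pose proof (pow2_ge_0 (x - x0)); nra).
  replace PI with (minus (2 * atan ((x0 + e - x0) / e)) (2 * atan ((x0 - e - x0) / e))).
  - apply (is_RInt_derive (fun x => 2 * atan ((x - x0) / e))).
    + intros x _. specialize (Hd x).
      auto_derive; auto. field. repeat split; try lra; intros E; apply Hd; rewrite <- E; ring.
    + intros x _. apply continuity_pt_filterlim. specialize (Hd x).
      apply derivable_continuous_pt. apply ex_derive_Reals_0. auto_derive.
      replace ((x + - x0) * ((x + - x0) * 1) + e * (e * 1)) with ((x - x0) ^ 2 + e ^ 2) by ring. auto.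
  - replace ((x0 + e - x0) / e) with 1 by (field; lra).
    replace ((x0 - e - x0) / e) with (-1) by (field; lra).
    rewrite (atan_opp 1 : atan (-1) = _). rewrite atan_1. unfold minus, plus, opp; simpl. field.
Qed.

Lemma rint_ext f g a b c d :
  (forall x y, f (x, y) = g (x, y)) -> rint f a b c d = rint g a b c d.
Proof. intros H. unfold rint. f_equal; [|f_equal]; apply Cint_ext; intros; rewrite !H; auto. Qed.

(** On a square centred at the pole the real or imaginary parts of opposite sides cancel and the
    arctangent kernel remains, so each pair of sides contributes $\pi i$. *)
Lemma rint_inv_square (x0 y0 e : R) : 0 < e ->
  rint (fun z => / (z - (x0, y0)))%C (x0 - e) (x0 + e) (y0 - e) (y0 + e) = (0, 2 * PI).
Proof.
  intros He.
  assert (Hd : forall t s, (t - s) ^ 2 + e ^ 2 <> 0)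
    by (intros t s; apply Rgt_not_eq; pose proof (pow2_ge_0 (t - s)); nra).
  unfold rint.
  rewrite (Cint_ext _ (fun x => (0, 2 * e / ((x - x0) ^ 2 + e ^ 2))) (x0 - e) (x0 + e)).
  2:{ intros x _. specialize (Hd x x0). unfold Cminus, Cinv, Cplus, Copp; simpl.
      apply injective_projections; simpl; field;
      repeat split; intros E; apply Hd; rewrite <- E; ring. }
  rewrite (Cint_ext _ (fun y => (2 * e / ((y - y0) ^ 2 + e ^ 2), 0)) (y0 - e) (y0 + e)).
  2:{ intros x _. specialize (Hd x y0). unfold Cminus, Cinv, Cplus, Copp; simpl.
      apply injective_projections; simpl; field;
      repeat split; intros E; apply Hd; rewrite <- E; ring. }
  unfold Cint; cbn [fst snd].
  rewrite !(is_RInt_unique _ _ _ _ (is_RInt_atan_kernel _ _ He)).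
  rewrite !RInt_const. unfold scal; simpl; unfold mult; simpl.
  apply injective_projections; simpl; ring.
Qed.

Lemma square_boundary_dist (x y x0 y0 e : R) : 0 <= e ->
  x = x0 - e \/ x = x0 + e \/ y = y0 - e \/ y = y0 + e -> e <= Cmod ((x, y) - (x0, y0))%C.
Proof.
  intros He Hxy.
  pose proof (re_le_Cmod ((x, y) - (x0, y0))%C) as L1.
  pose proof (im_le_Cmod ((x, y) - (x0, y0))%C) as L2.
  simpl in L1, L2.  revert L1 L2.
  unfold Rabs. repeat destruct Rcase_abs; lra.
Qed.

(** [goursat] on the four rectangles around a small centred square reduces the contour to that
    square. There [f] differs from [r / (z - z0)] by a small multiple of [1 / e], while the
    perimeter is proportional to [e]. *)
Theorem rint_residue f x0 y0 r a b c d : a < x0 < b -> c < y0 < d ->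
  (forall x y, a <= x <= b -> c <= y <= d -> (x, y) <> (x0, y0) -> holo f (x, y)) ->
  simple_pole f (x0, y0) r -> rint f a b c d = (RtoC (2 * PI) * Ci * r)%C.
Proof.
  intros Hx0 Hy0 Hf Hr.
  assert (Hsq : forall e, 0 < e -> a <= x0 - e -> x0 + e <= b -> c <= y0 - e -> y0 + e <= d ->
    rint f a b c d = rint f (x0 - e) (x0 + e) (y0 - e) (y0 + e)).
  { intros e He Ha Hb Hc Hd.
    assert (Hct : forall x x' y y', a <= x -> x <= x' -> x' <= b -> c <= y -> y <= y' -> y' <= d ->
      x <> x0 -> x' <> x0 -> y <> y0 -> y' <> y0 -> cts_boundary f x x' y y').
    { intros. split; intros; split; apply holo_cts, Hf; try lra; intros E; injection E; lra. }
    assert (Hg : forall x x' y y', a <= x -> x <= x' -> x' <= b -> c <= y -> y <= y' -> y' <= d ->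
      (x0 < x \/ x' < x0 \/ y0 < y \/ y' < y0) -> rint f x x' y y' = 0).
    { intros. apply goursat; auto. intros; apply Hf; try lra. intros E; injection E; lra. }
    rewrite (rint_split_x f a (x0 - e) b) by (try apply Hct; lra).
    rewrite (rint_split_x f (x0 - e) (x0 + e) b) by (try apply Hct; lra).
    rewrite (rint_split_y f (x0 - e) (x0 + e) c (y0 - e)) by (try apply Hct; lra).
    rewrite (rint_split_y f (x0 - e) (x0 + e) (y0 - e) (y0 + e)) by (try apply Hct; lra).
    rewrite (Hg a (x0 - e)) by lra. rewrite (Hg (x0 + e) b) by lra.
    rewrite (Hg (x0 - e) (x0 + e) c) by lra. rewrite (Hg (x0 - e) (x0 + e) (y0 + e) d) by lra.
    ring. }
  apply Ceq_minus. apply Cmod_eq_0. apply Rle_antisym; [|apply Cmod_ge_0].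
  apply le_epsilon. intros eta He. rewrite Rplus_0_l.
  (* On a square of side [2 * e], [rint_bound] gives [4 * M * (4 * e)]; with [M = eta / 16 / e] this
     is [eta]. *)
  destruct (Hr (eta / 16) ltac:(lra)) as [dl [Hdl Hp]].
  set (m := Rmin (Rmin (x0 - a) (b - x0)) (Rmin (y0 - c) (d - y0))).
  assert (Hm : 0 < m) by (unfold m; repeat apply Rmin_pos; lra).
  assert (Hm1 : m <= x0 - a /\ m <= b - x0 /\ m <= y0 - c /\ m <= d - y0).
  { unfold m. pose proof (Rmin_l (Rmin (x0 - a) (b - x0)) (Rmin (y0 - c) (d - y0))).
    pose proof (Rmin_r (Rmin (x0 - a) (b - x0)) (Rmin (y0 - c) (d - y0))).
    pose proof (Rmin_l (x0 - a) (b - x0)). pose proof (Rmin_r (x0 - a) (b - x0)).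
    pose proof (Rmin_l (y0 - c) (d - y0)). pose proof (Rmin_r (y0 - c) (d - y0)). lra. }
  clearbody m.
  (* Boundary points of the square lie within [2 * e] of the pole, hence closer than [dl]. *)
  set (e := Rmin m (dl / 4)).
  assert (He0 : 0 < e) by (apply Rmin_pos; lra).
  assert (He1 : e <= m) by apply Rmin_l. assert (He2 : e <= dl / 4) by apply Rmin_r.
  clearbody e.
  rewrite (Hsq e) by lra.
  set (z0 := (x0, y0) : C).
  set (k := fun z => (r * / (z - z0))%C).
  assert (Hnz : forall x y, (x = x0 - e \/ x = x0 + e \/ y = y0 - e \/ y = y0 + e) -> (x, y) <> (x0, y0)).
  { intros x y Hxy E. injection E; lra. }
  assert (Hk : forall x y, (x, y) <> (x0, y0) -> holo k (x, y)).
  { intros x y Hxy. apply holo_mult; [apply holo_const|]. apply holo_inv.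
    - intros E. apply Hxy. apply Ceq_minus in E. exact E.
    - apply holo_minus; [apply holo_id|apply holo_const]. }
  assert (Bd : forall g : C -> C, (forall x y, (x, y) <> (x0, y0) -> a <= x <= b -> c <= y <= d -> holo g (x, y)) ->
     cts_boundary g (x0 - e) (x0 + e) (y0 - e) (y0 + e)).
  { intros g Hgg. split; intros t Ht; split; apply holo_cts, Hgg; try lra; apply Hnz; auto. }
  assert (E1 : rint k (x0 - e) (x0 + e) (y0 - e) (y0 + e) = (RtoC (2 * PI) * Ci * r)%C).
  { unfold k. pose proof (rint_inv_square x0 y0 e He0) as I. fold z0 in I.
    assert (S : rint (fun z => r * / (z - z0))%C (x0 - e) (x0 + e) (y0 - e) (y0 + e)
       = (r * rint (fun z => / (z - z0))%C (x0 - e) (x0 + e) (y0 - e) (y0 + e))%C).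
    { destruct (cts_boundary_ex (fun z => / (z - z0))%C (x0 - e) (x0 + e) (y0 - e) (y0 + e))
        as (F1 & F2 & F3 & F4); try lra.
      { apply Bd. intros x y Hxy _ _. apply holo_inv.
        - intros E. apply Hxy. apply Ceq_minus in E. exact E.
        - apply holo_minus; [apply holo_id|apply holo_const]. }
      unfold rint.
      rewrite (Cint_ext _ (fun x => r * (/ ((x, (y0 - e)%R) - z0) - / ((x, (y0 + e)%R) - z0)))%C) by (intros; ring).
      rewrite Cint_scal by (apply ex_Cint_minus; auto).
      rewrite (Cint_ext (fun y => r * / (((x0 + e)%R, y) - z0) - r * / (((x0 - e)%R, y) - z0))%C
        (fun y => r * (/ (((x0 + e)%R, y) - z0) - / (((x0 - e)%R, y) - z0)))%C) by (intros; ring).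
      rewrite Cint_scal by (apply ex_Cint_minus; auto). ring. }
    rewrite S, I. apply injective_projections; simpl; ring. }
  assert (E2 : rint f (x0 - e) (x0 + e) (y0 - e) (y0 + e)
     = (rint k (x0 - e) (x0 + e) (y0 - e) (y0 + e)
        + rint (fun z => f z - k z)%C (x0 - e) (x0 + e) (y0 - e) (y0 + e))%C).
  { rewrite <- rint_plus; try lra.
    - apply rint_ext; intros; ring.
    - apply Bd; intros; apply Hk; auto.
    - apply Bd; intros; apply holo_minus; [apply Hf|apply Hk]; auto. }
  rewrite E2, E1.
  match goal with |- Cmod (?u + ?v - ?w)%C <= _ => replace (u + v - w)%C with v by ring end.
  assert (Hb : forall x y, (x = x0 - e \/ x = x0 + e \/ y = y0 - e \/ y = y0 + e) ->
     Rabs (x - x0) <= e -> Rabs (y - y0) <= e -> Cmod (f (x, y) - k (x, y))%C <= eta / 16 / e).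
  { intros x y Hxy Bx By. pose proof (Hnz x y Hxy) as Hn.
    assert (U : Cmod ((x, y) - z0)%C <= 2 * e).
    { eapply Rle_trans; [apply Cminus_pair|lra]. }
    assert (L : e <= Cmod ((x, y) - z0)%C).
    { apply square_boundary_dist; auto. lra. }
    specialize (Hp (x, y) Hn). fold z0 in Hp. specialize (Hp ltac:(lra)).
    assert (Hnz' : ((x, y) - z0)%C <> 0) by (apply Cmod_gt_0; lra).
    unfold k. replace (f (x, y) - r * / ((x, y) - z0))%C
      with ((((x, y) - z0) * f (x, y) - r) / ((x, y) - z0))%C by (field; auto).
    rewrite Cmod_div by auto.
    apply Rmult_le_compat; [apply Cmod_ge_0|left; apply Rinv_0_lt_compat; lra|lra|].
    apply Rinv_le_contravar; lra. }
  eapply Rle_trans; [apply (rint_bound _ _ _ _ _ (eta / 16 / e))| right; field; lra]; try lra.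
  - apply Bd; intros; apply holo_minus; [apply Hf|apply Hk]; auto.
  - intros x Hx; split; apply Hb; auto; apply Rabs_le; lra.
  - intros y Hy; split; apply Hb; auto; apply Rabs_le; lra.
Qed.

(** * The roots *)

(* The roots are the points where the increasing function
   [y + atan (y / q) / PI] takes positive integer values. *)
Definition root_phase (q y : R) : R := y + atan (y / q) / PI.

Lemma root_phase_increasing q y z : 0 < q -> y < z -> root_phase q y < root_phase q z.
Proof.
  intros Hq Hyz. unfold root_phase. pose proof PI_RGT_0.
  assert (y / q < z / q) by (apply Rmult_lt_compat_r; [apply Rinv_0_lt_compat|]; lra).
  pose proof (atan_increasing _ _ H0).
  apply Rplus_lt_compat; auto. apply Rmult_lt_compat_r; [apply Rinv_0_lt_compat|]; lra.
Qed.

(** The combination [q * sin (PI * y) + y * cos (PI * y)] is a single sine, of amplitude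
    [q / cos (atan (y / q))] and with its argument shifted by [atan (y / q)]. *)
Lemma sin_root_phase q y : 0 < q ->
  sin (PI * root_phase q y) = cos (atan (y / q)) * (q * sin (PI * y) + y * cos (PI * y)) / q.
Proof.
  intros Hq. unfold root_phase. pose proof PI_RGT_0.
  replace (PI * (y + atan (y / q) / PI)) with (PI * y + atan (y / q)) by (field; lra).
  rewrite sin_plus.
  assert (Hc : cos (atan (y / q)) <> 0)
    by (pose proof (atan_bound (y / q)); apply Rgt_not_eq, cos_gt_0; lra).
  assert (Hs : sin (atan (y / q)) = cos (atan (y / q)) * (y / q)).
  { rewrite <- (tan_atan (y / q)) at 3. unfold tan. field; auto. }
  rewrite Hs. field; lra.
Qed.

(** From right to left, a vanishing cosine would force the sine to vanish as well, which contradicts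
    $\sin^2+\cos^2=1$. *)
Lemma koshliakov_root_iff q y : 0 < q -> 0 < y ->
  (koshliakov_root q y <-> q * sin (PI * y) + y * cos (PI * y) = 0).
Proof.
  intros Hq Hy. unfold koshliakov_root. split.
  - intros (_ & Hc & Ht). unfold tan in Ht.
    assert (E : sin (PI * y) = - y / q * cos (PI * y)) by (rewrite <- Ht; field; auto).
    rewrite E. field; lra.
  - intros E.
    assert (Hc : cos (PI * y) <> 0).
    { intros Hc. rewrite Hc, Rmult_0_r, Rplus_0_r in E.
      apply Rmult_integral in E. destruct E as [E|E]; [lra|].
      pose proof (sin2_cos2 (PI * y)) as S. rewrite E, Hc in S. unfold Rsqr in S; lra. }
    split; [auto|split; auto]. unfold tan.
    replace (sin (PI * y)) with (- y / q * cos (PI * y)); [field; split; lra|].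
    apply (Rmult_eq_reg_l q); [|lra].
    transitivity (- (y * cos (PI * y))); [field; lra|lra].
Qed.

Lemma koshliakov_root_phase q y : 0 < q -> 0 < y ->
  (koshliakov_root q y <-> exists k : nat, root_phase q y = INR k).
Proof.
  intros Hq Hy. rewrite koshliakov_root_iff by auto.
  pose proof (sin_root_phase q y Hq) as S. pose proof PI_RGT_0 as HP.
  assert (Hc : 0 < cos (atan (y / q)))
    by (pose proof (atan_bound (y / q)); apply cos_gt_0; lra).
  assert (Hphi : 0 < root_phase q y).
  { pose proof (root_phase_increasing q 0 y Hq Hy) as I.
    unfold root_phase at 1 in I. unfold Rdiv at 2 in I. rewrite Rmult_0_l, atan_0 in I. lra. }
  split.
  - intros E. rewrite E in S.
    replace (cos (atan (y / q)) * 0 / q) with 0 in S by (field; lra).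
    apply sin_eq_0_0 in S. destruct S as [k Hk].
    assert (E2 : root_phase q y = IZR k).
    { apply (Rmult_eq_reg_l PI); lra. }
    assert (Hk0 : (0 <= k)%Z) by (apply le_IZR; lra).
    exists (Z.to_nat k). rewrite INR_IZR_INZ, Z2Nat.id by auto. exact E2.
  - intros [k Hk]. rewrite Hk in S.
    assert (S0 : sin (PI * INR k) = 0).
    { apply sin_eq_0_1. exists (Z.of_nat k). rewrite <- INR_IZR_INZ. ring. }
    rewrite S0 in S. unfold Rdiv in S. symmetry in S. apply Rmult_integral in S.
    destruct S as [S|S].
    + apply Rmult_integral in S. destruct S; auto; lra.
    + pose proof (Rinv_0_lt_compat q Hq). lra.
Qed.

Lemma root_phase_onto q k : 0 < q -> (1 <= k)%nat -> exists y, 0 < y /\ root_phase q y = INR k.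
Proof.
  intros Hq Hk. apply le_INR in Hk. simpl in Hk.
  assert (H0 : root_phase q 0 = 0).
  { unfold root_phase. unfold Rdiv at 2. rewrite Rmult_0_l, atan_0. field. apply PI_neq0. }
  assert (Hc : continuity (fun y => root_phase q y - INR k)).
  { intros y. apply continuity_pt_minus; [|apply continuity_pt_const; intros ? ?; auto].
    apply derivable_continuous_pt. apply ex_derive_Reals_0. unfold root_phase. auto_derive. auto. }
  destruct (IVT (fun y => root_phase q y - INR k) 0 (INR k) Hc) as [y [Hy E]].
  - lra.
  - rewrite H0. lra.
  - pose proof (root_phase_increasing q 0 (INR k) Hq ltac:(lra)) as I. rewrite H0 in I.
    unfold root_phase. pose proof PI_RGT_0.
    assert (0 < INR k / q) by (apply Rdiv_lt_0_compat; lra).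
    pose proof (atan_increasing _ _ H1) as A. rewrite atan_0 in A.
    assert (0 < atan (INR k / q) / PI) by (apply Rdiv_lt_0_compat; lra). lra.
  - exists y. split; [|lra]. destruct (Rle_lt_or_eq_dec 0 y (proj1 Hy)) as [L|L]; auto.
    subst y. rewrite H0 in E. lra.
Qed.

(** An enumeration of all roots cannot skip an integer. The phases are increasing positive integers,
    so the phase at [n] is at least [n + 1]; the root of phase [n + 1] from [root_phase_onto] has an
    index that is not below [n] by induction, so monotonicity gives the reverse bound. *)
Lemma root_seq_phase q mu n : 0 < q -> koshliakov_root_seq q mu ->
  0 < mu n /\ root_phase q (mu n) = INR n + 1.
Proof.
  intros Hq [Hinc Hall].
  assert (Hpos : forall n, 0 < mu n).
  { intros m. apply (proj2 (Hall (mu m)) (ex_intro _ m eq_refl)). }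
  split; auto.
  assert (Hk : forall m, exists k, root_phase q (mu m) = INR k).
  { intros m. apply koshliakov_root_phase; auto. apply Hall; eauto. }
  assert (Hmono : forall i j, (i <= j)%nat -> root_phase q (mu i) <= root_phase q (mu j)).
  { intros i j Hij. induction Hij as [|j Hij IH]; [lra|].
    pose proof (root_phase_increasing q _ _ Hq (Hinc j)). lra. }
  assert (Hlow : forall m, INR m + 1 <= root_phase q (mu m)).
  { induction m as [|m IH].
    - destruct (Hk 0%nat) as [k E].
      pose proof (root_phase_increasing q 0 (mu 0%nat) Hq (Hpos 0%nat)) as I.
      assert (H0 : root_phase q 0 = 0).
      { unfold root_phase. unfold Rdiv at 2. rewrite Rmult_0_l, atan_0. field. apply PI_neq0. }
      rewrite E, H0 in *. change 0 with (INR 0) in I. apply INR_lt in I.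
      apply (le_INR 1) in I. simpl in *; lra.
    - destruct (Hk m) as [k E], (Hk (S m)) as [k' E'].
      pose proof (root_phase_increasing q _ _ Hq (Hinc m)) as I.
      rewrite E, E' in I. apply INR_lt in I. apply le_INR in I. rewrite S_INR in I.
      rewrite S_INR. lra. }
  revert n. apply (well_founded_induction lt_wf). intros n IH.
  destruct (root_phase_onto q (S n) Hq ltac:(lia)) as [y [Hy E]].
  assert (Hr : koshliakov_root q y) by (apply koshliakov_root_phase; eauto).
  apply Hall in Hr. destruct Hr as [m Hm]. subst y.
  rewrite S_INR in E.
  destruct (Nat.lt_ge_cases m n) as [L|L].
  - specialize (IH m L). rewrite IH in E. apply lt_INR in L. lra.
  - specialize (Hmono n m L). specialize (Hlow n). lra.
Qed.

(** The arctangent lies strictly between 0 and $\pi/2$. With indices from 0 this is the classical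
    $n-\frac12<\mu_n<n$; it makes the lines Im z = M + 1/2 free of poles. *)
Lemma root_seq_bounds q mu n : 0 < q -> koshliakov_root_seq q mu ->
  INR n + 1 / 2 < mu n < INR n + 1.
Proof.
  intros Hq H. destruct (root_seq_phase q mu n Hq H) as [Hp E]. unfold root_phase in E.
  pose proof PI_RGT_0.
  assert (0 < mu n / q) by (apply Rdiv_lt_0_compat; lra).
  pose proof (atan_increasing _ _ H1) as A. rewrite atan_0 in A.
  pose proof (atan_bound (mu n / q)) as B.
  assert (0 < atan (mu n / q) / PI) by (apply Rdiv_lt_0_compat; lra).
  assert (atan (mu n / q) / PI < 1 / 2).
  { apply (Rmult_lt_reg_r PI); auto. unfold Rdiv. rewrite Rmult_assoc, Rinv_l by lra. lra. }
  lra.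
Qed.

(** The weight equals $1-\frac{q/\pi}{q(q+1/\pi)+y^2}$. The second bound, a deviation from 1 of
    order $y^{-2}$, is what makes the weighted sums comparable with $\sum n^{-s}$. *)
Lemma weight_bounds q y : 0 < q ->
  0 < koshliakov_weight q y <= 1 /\ (1 - koshliakov_weight q y) * y ^ 2 <= q / PI.
Proof.
  intros Hq. pose proof PI_RGT_0 as HP. pose proof (pow2_ge_0 y) as Hy.
  assert (HqP : 0 < q / PI) by (apply Rdiv_lt_0_compat; lra).
  assert (Hd : 0 < q * (q + 1 / PI) + y ^ 2).
  { replace (q * (q + 1 / PI)) with (q * q + q / PI) by (field; lra). nra. }
  assert (E : koshliakov_weight q y = 1 - (q / PI) / (q * (q + 1 / PI) + y ^ 2)).
  { unfold koshliakov_weight. set (d := q * (q + 1 / PI) + y ^ 2) in *.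
    replace (q ^ 2 + y ^ 2) with (d - q / PI) by (unfold d; field; lra). field; lra. }
  assert (Hp : 0 < (q / PI) / (q * (q + 1 / PI) + y ^ 2)) by (apply Rdiv_lt_0_compat; auto).
  split; [split|].
  - unfold koshliakov_weight. apply Rdiv_lt_0_compat; auto.
    assert (0 < q ^ 2) by (apply pow_lt; auto). lra.
  - lra.
  - rewrite E. set (d := q * (q + 1 / PI) + y ^ 2) in *.
    replace (1 - (1 - q / PI / d)) with (q / PI / d) by ring.
    unfold Rdiv at 1. rewrite Rmult_assoc. rewrite <- (Rmult_1_r (q / PI)) at 2.
    apply Rmult_le_compat_l; [lra|]. apply (Rmult_le_reg_l d); auto.
    rewrite <- Rmult_assoc, Rinv_r by lra. unfold d.
    replace (q * (q + 1 / PI)) with (q * q + q / PI) by (field; lra). nra.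
Qed.

(** * Partial fractions *)

Lemma simple_pole_quotient (g D : C -> C) (z0 l : C) :
  Ccts g z0 -> Cderiv D z0 l -> D z0 = 0 -> l <> 0 ->
  simple_pole (fun z => g z / D z)%C z0 (g z0 / l)%C.
Proof.
  intros Hg HD H0 Hl eps He.
  pose proof (proj1 (Cmod_gt_0 _) Hl) as HL. set (L := Cmod l) in *.
  pose proof (Cmod_ge_0 (g z0)) as HG.
  (* The final denominator [Q * l] has modulus at least [L ^ 2 / 2], so each of the two error terms
     may take up [eps * L ^ 2 / 4]. *)
  set (e1 := eps * L / 4). assert (He1 : 0 < e1) by (unfold e1; nra).
  set (e2 := Rmin (L / 2) (eps * L * L / (4 * (Cmod (g z0) + 1)))).
  assert (Hb : 0 < eps * L * L / (4 * (Cmod (g z0) + 1))).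
  { apply Rdiv_lt_0_compat; [|lra]. repeat apply Rmult_lt_0_compat; lra. }
  assert (He2 : 0 < e2) by (apply Rmin_pos; lra).
  assert (Ha2 : e2 <= L / 2) by apply Rmin_l.
  assert (Hb2 : e2 * (4 * (Cmod (g z0) + 1)) <= eps * L * L).
  { apply Rle_div_r; [lra|]. apply Rmin_r. }
  clearbody e2.
  destruct (Hg e1 He1) as [d1 [Hd1 K1]]. destruct (HD e2 He2) as [d2 [Hd2 K2]].
  exists (Rmin d1 d2); split; [apply Rmin_pos; auto|]. intros u Hu Hd.
  specialize (K1 u (Rlt_le_trans _ _ _ Hd (Rmin_l _ _))).
  specialize (K2 _ (Rlt_le_trans _ _ _ Hd (Rmin_r _ _))).
  replace (z0 + (u - z0))%C with u in K2 by ring.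
  set (h := (u - z0)%C) in *.
  assert (Hh : h <> 0) by (intros E; apply Hu; apply Ceq_minus; exact E).
  pose proof (proj1 (Cmod_gt_0 _) Hh) as Hh0.
  set (Q := (D u / h)%C).
  assert (EQ : D u = (Q * h)%C) by (unfold Q; field; auto).
  assert (KQ : Cmod (Q - l)%C <= e2).
  { apply (Rmult_le_reg_r (Cmod h)); auto. rewrite <- Cmod_mult.
    replace ((Q - l) * h)%C with (D u - D z0 - l * h)%C by (rewrite H0, EQ; ring). auto. }
  assert (LQ : L / 2 <= Cmod Q).
  { pose proof (Cmod_minus_triangle Q (Q - l)%C) as T.
    replace (Q - (Q - l))%C with l in T by ring. fold L in T. lra. }
  assert (HQ : Q <> 0) by (apply Cmod_gt_0; lra).
  rewrite EQ.
  replace (h * (g u / (Q * h)) - g z0 / l)%C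
    with (((g u - g z0) * l - g z0 * (Q - l)) / (Q * l))%C by (field; auto).
  rewrite Cmod_div by (apply Cmult_neq_0; auto). rewrite Cmod_mult. fold L.
  apply Rle_div_l; [apply Rmult_lt_0_compat; lra|].
  eapply Rle_trans; [apply Cmod_minus_triangle|]. rewrite !Cmod_mult. fold L.
  assert (Cmod (g u - g z0)%C * L <= e1 * L) by (apply Rmult_le_compat_r; lra).
  assert (Cmod (g z0) * Cmod (Q - l)%C <= Cmod (g z0) * e2) by (apply Rmult_le_compat_l; lra).
  assert (eps * (L / 2 * L) <= eps * (Cmod Q * L)).
  { apply Rmult_le_compat_l; [lra|]. apply Rmult_le_compat_r; lra. }
  unfold e1 in *. nra.
Qed.

Lemma simple_pole_ext f g z0 r : (forall z, f z = g z) -> simple_pole f z0 r -> simple_pole g z0 r.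
Proof.
  intros E H eps He. destruct (H eps He) as [d [Hd K]]. exists d; split; auto.
  intros u Hu Hd'. rewrite <- E. auto.
Qed.

(* [kD] and [kN] are twice $q\sinh\pi z+z\cosh\pi z$ and $q\cosh\pi z+z\sinh\pi z$. *)
Definition kD (q : R) (z : C) : C :=
  ((RtoC q + z) * Cexp (RtoC PI * z) - (RtoC q - z) * Cexp (- (RtoC PI * z)))%C.
Definition kN (q : R) (z : C) : C :=
  ((RtoC q + z) * Cexp (RtoC PI * z) + (RtoC q - z) * Cexp (- (RtoC PI * z)))%C.

Lemma kD_opp q z : kD q (- z)%C = (- kD q z)%C.
Proof.
  unfold kD. replace (RtoC PI * - z)%C with (- (RtoC PI * z))%C by ring.
  replace (- - (RtoC PI * z))%C with (RtoC PI * z)%C by ring. ring.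
Qed.

Lemma kN_opp q z : kN q (- z)%C = kN q z.
Proof.
  unfold kN. replace (RtoC PI * - z)%C with (- (RtoC PI * z))%C by ring.
  replace (- - (RtoC PI * z))%C with (RtoC PI * z)%C by ring. ring.
Qed.

Lemma Cexp_im (y : R) : Cexp (RtoC PI * (0, y)) = (cos (PI * y), sin (PI * y)).
Proof.
  unfold Cexp; simpl. replace (PI * 0 - 0 * y) with 0 by ring.
  replace (PI * y + 0 * 0) with (PI * y) by ring. rewrite exp_0.
  apply injective_projections; simpl; ring.
Qed.

Lemma Cexp_im_opp (y : R) : Cexp (- (RtoC PI * (0, y))) = (cos (PI * y), - sin (PI * y)).
Proof.
  replace (- (RtoC PI * (0, y)))%C with (RtoC PI * (0%R, (- y)%R))%C
    by (apply injective_projections; simpl; ring).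
  rewrite Cexp_im. replace (PI * - y) with (- (PI * y)) by ring. rewrite cos_neg, sin_neg. auto.
Qed.

Lemma kD_im q y : kD q (0, y) = (0, 2 * (q * sin (PI * y) + y * cos (PI * y))).
Proof.
  unfold kD. rewrite Cexp_im, Cexp_im_opp. apply injective_projections; simpl; ring.
Qed.

Lemma kN_im q y : kN q (0, y) = RtoC (2 * (q * cos (PI * y) - y * sin (PI * y))).
Proof.
  unfold kN. rewrite Cexp_im, Cexp_im_opp. apply injective_projections; simpl; ring.
Qed.

Lemma Cderiv_kD q z :
  Cderiv (kD q) z (Cexp (RtoC PI * z) + Cexp (- (RtoC PI * z)) + RtoC PI * kN q z)%C.
Proof.
  assert (H1 : Cderiv (fun u => RtoC PI * u)%C z (RtoC PI)).
  { pose proof (Cderiv_mult (fun _ => RtoC PI) (fun u => u) z 0 1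
      (Cderiv_const _ _) (Cderiv_id _)) as H. cbv beta in H.
    replace (0 * z + RtoC PI * 1)%C with (RtoC PI) in H by ring. exact H. }
  assert (Hm : forall f l, Cderiv f z l -> Cderiv (fun u => - f u)%C z (- l)%C).
  { intros f l H eps He. destruct (H eps He) as [d [Hd K]]. exists d; split; auto.
    intros h Hh. replace (- f (z + h) - - f z - - l * h)%C with (- (f (z + h) - f z - l * h))%C by ring.
    rewrite Cmod_opp. auto. }
  pose proof (Cderiv_comp _ Cexp z _ _ H1 (Cderiv_Cexp _)) as E1.
  pose proof (Cderiv_comp _ Cexp z _ _ (Hm _ _ H1) (Cderiv_Cexp _)) as E2. cbv beta in E1, E2.
  pose proof (Cderiv_plus _ _ z _ _ (Cderiv_const (RtoC q) z) (Cderiv_id z)) as P1.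
  pose proof (Cderiv_plus _ _ z _ _ (Cderiv_const (RtoC q) z) (Hm _ _ (Cderiv_id z))) as P2.
  pose proof (Cderiv_plus _ _ z _ _ (Cderiv_mult _ _ z _ _ P1 E1) (Hm _ _ (Cderiv_mult _ _ z _ _ P2 E2))) as F.
  cbv beta in F. unfold kD, kN.
  match goal with |- Cderiv _ _ ?l => match type of F with Cderiv _ _ ?m => replace l with m by ring end end.
  exact F.
Qed.

Lemma holo_kD q z : holo (kD q) z.
Proof. eexists; apply Cderiv_kD. Qed.

Lemma holo_kN q z : holo (kN q) z.
Proof.
  unfold kN. apply holo_plus; apply holo_mult.
  - apply holo_plus; [apply holo_const|apply holo_id].
  - apply holo_Cexp. apply holo_mult; [apply holo_const|apply holo_id].
  - apply holo_minus; [apply holo_const|apply holo_id].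
  - apply holo_Cexp. apply holo_opp. apply holo_mult; [apply holo_const|apply holo_id].
Qed.

Lemma Cmod_le_of_sqr u v : Cmod u ^ 2 <= Cmod v ^ 2 -> Cmod u <= Cmod v.
Proof.
  intros H. apply Rsqr_incr_0_var; [|apply Cmod_ge_0]. unfold Rsqr. nra.
Qed.

(** In the right half-plane [z] is at least as close to [q] as to [- q]. Therefore the growing
    exponential dominates in both [kN] and [kD]. *)
Lemma k_reflection q z : 0 < q -> 0 <= Re z -> Cmod (RtoC q - z)%C <= Cmod (RtoC q + z)%C.
Proof.
  intros Hq Hx. apply Cmod_le_of_sqr. rewrite !Cmod2_alt. destruct z as [x y]; simpl in *. nra.
Qed.

Lemma Re_PI_mult z : Re (RtoC PI * z)%C = PI * Re z.
Proof. apply re_scal_l. Qed.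

Lemma kN_upper q z : 0 < q -> 0 <= Re z ->
  Cmod (kN q z) <= Cmod (RtoC q + z)%C * (exp (PI * Re z) + exp (- (PI * Re z))).
Proof.
  intros Hq Hx. unfold kN. eapply Rle_trans; [apply Cmod_triangle|].
  rewrite !Cmod_mult, !Cmod_Cexp, re_opp, Re_PI_mult.
  pose proof (k_reflection q z Hq Hx). pose proof (exp_pos (- (PI * Re z))). nra.
Qed.

Lemma kD_lower q z : 0 < q -> 0 <= Re z ->
  Cmod (RtoC q + z)%C * (exp (PI * Re z) - exp (- (PI * Re z))) <= Cmod (kD q z).
Proof.
  intros Hq Hx. unfold kD.
  pose proof (Cmod_reverse_triangle ((RtoC q + z) * Cexp (RtoC PI * z))%C
    (- ((RtoC q - z) * Cexp (- (RtoC PI * z))))%C) as T.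
  rewrite Cmod_opp, !Cmod_mult, !Cmod_Cexp, re_opp, Re_PI_mult in T. unfold Cminus.
  pose proof (k_reflection q z Hq Hx). pose proof (exp_pos (- (PI * Re z))).
  unfold Cminus in *. nra.
Qed.

Lemma kq_pos q z : 0 < q -> 0 <= Re z -> 0 < Cmod (RtoC q + z)%C.
Proof.
  intros Hq Hx. pose proof (re_le_Cmod (RtoC q + z)%C) as H. rewrite re_plus, re_RtoC in H.
  rewrite Rabs_pos_eq in H; lra.
Qed.

Lemma exp_opp_lt x : 0 < x -> exp (- x) < exp x.
Proof. intros; apply exp_increasing; lra. Qed.

Lemma kD_nz_right q z : 0 < q -> 0 < Re z -> kD q z <> 0.
Proof.
  intros Hq Hx. apply Cmod_gt_0. eapply Rlt_le_trans; [|apply kD_lower; lra].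
  pose proof PI_RGT_0. apply Rmult_lt_0_compat; [apply kq_pos; lra|].
  pose proof (exp_opp_lt (PI * Re z) ltac:(nra)). lra.
Qed.

(** The dominance of the growing exponential is strict for Re z > 0, and [kD] is odd; all its zeros
    are thus on the imaginary axis, where [kD_im] identifies them. *)
Lemma kD_nz_off q z : 0 < q -> Re z <> 0 -> kD q z <> 0.
Proof.
  intros Hq Hx. destruct (Rlt_le_dec 0 (Re z)) as [H|H]; [apply kD_nz_right; auto|].
  intros E. apply (kD_nz_right q (- z)%C Hq); [rewrite re_opp; lra|]. rewrite kD_opp, E. ring.
Qed.

(** The bound depends on the distance from the imaginary axis only. This dictates the contour: a
    narrow column around the axis, treated by hand, and a half-plane where the quotient is uniformly
    bounded. *)
Lemma k_ratio_bound q dl z : 0 < q -> 0 < dl -> dl <= Re z ->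
  Cmod (kN q z / kD q z)%C <= (1 + exp (- (2 * PI * dl))) / (1 - exp (- (2 * PI * dl))).
Proof.
  intros Hq Hd Hx. pose proof PI_RGT_0 as HP.
  rewrite Cmod_div by (apply kD_nz_right; lra).
  pose proof (kN_upper q z Hq ltac:(lra)) as U. pose proof (kD_lower q z Hq ltac:(lra)) as L.
  pose proof (kq_pos q z Hq ltac:(lra)) as K.
  set (x := Re z) in *. set (m := Cmod (RtoC q + z)%C) in *.
  pose proof (exp_opp_lt (PI * x) ltac:(nra)) as E. pose proof (exp_pos (PI * x)) as Ep.
  set (r := exp (- (2 * PI * dl))).
  assert (Hr : 0 < r < 1).
  { split; [apply exp_pos|]. unfold r. rewrite <- exp_0. apply exp_increasing. nra. }
  assert (Hrx : exp (- (PI * x)) <= r * exp (PI * x)).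
  { unfold r. rewrite <- exp_plus. apply exp_le. nra. }
  assert (HD : 0 < Cmod (kD q z)) by nra.
  apply Rle_div_l; auto.
  apply Rle_trans with (m * (exp (PI * x) * (1 + r))); [nra|].
  apply Rle_trans with ((1 + r) / (1 - r) * (m * (exp (PI * x) * (1 - r)))).
  - right. field. lra.
  - apply Rmult_le_compat_l.
    + apply Rlt_le, Rdiv_lt_0_compat; lra.
    + nra.
Qed.

Lemma kD_zero_im q mu y : 0 < q -> koshliakov_root_seq q mu -> kD q (0, y) = 0 ->
  y = 0 \/ exists n, y = mu n \/ y = - mu n.
Proof.
  intros Hq Hmu E. rewrite kD_im in E. injection E. intros E1. clear E.
  assert (E0 : q * sin (PI * y) + y * cos (PI * y) = 0) by lra.
  destruct (Rtotal_order y 0) as [L|[L|L]]; [right|left; auto|right].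
  - assert (R : koshliakov_root q (- y)).
    { apply koshliakov_root_iff; try lra.
      replace (PI * - y) with (- (PI * y)) by ring. rewrite sin_neg, cos_neg. lra. }
    apply Hmu in R. destruct R as [n Hn]. exists n. lra.
  - assert (R : koshliakov_root q y) by (apply koshliakov_root_iff; auto).
    apply Hmu in R. destruct R as [n Hn]. exists n. lra.
Qed.

Lemma kD_zeros q mu x y : 0 < q -> koshliakov_root_seq q mu -> kD q (x, y) = 0 ->
  x = 0 /\ (y = 0 \/ exists n, y = mu n \/ y = - mu n).
Proof.
  intros Hq Hmu E. destruct (Req_dec x 0) as [-> |Hx].
  - split; auto. eapply kD_zero_im; eauto.
  - exfalso. apply (kD_nz_off q (x, y) Hq); auto.
Qed.

(** This is where the weight originates. At a root the sine is [- (y / q)] times the cosine, so the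
    cosine cancels between [kN] and the derivative of [kD], leaving
    $\frac{q^2+y^2}{q+\pi(q^2+y^2)}$. The sign [s] treats both conjugate zeros together. *)
Lemma k_residue q mu n s : 0 < q -> koshliakov_root_seq q mu -> s = 1 \/ s = -1 ->
  let z0 := (0, s * mu n) in
  let l := (Cexp (RtoC PI * z0) + Cexp (- (RtoC PI * z0)) + RtoC PI * kN q z0)%C in
  kD q z0 = 0 /\ l <> 0 /\ (kN q z0 / l)%C = RtoC (koshliakov_weight q (mu n) / PI).
Proof.
  intros Hq Hmu Hs z0 l. pose proof PI_RGT_0 as HP.
  destruct (root_seq_phase q mu n Hq Hmu) as [Hp _].
  assert (R : koshliakov_root q (mu n)) by (apply Hmu; eauto).
  assert (Hc : cos (PI * mu n) <> 0) by apply R.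
  apply koshliakov_root_iff in R; auto.
  set (c := cos (PI * mu n)) in *. set (y := mu n) in *.
  assert (Hsn : sin (PI * y) = - (y * c / q)).
  { apply (Rmult_eq_reg_l q); [|lra]. transitivity (- (y * c)); [lra|field; lra]. }
  assert (Es : sin (PI * (s * y)) = s * sin (PI * y) /\ cos (PI * (s * y)) = c).
  { destruct Hs as [-> | ->].
    - rewrite Rmult_1_l; split; [ring|reflexivity].
    - replace (PI * (-1 * y)) with (- (PI * y)) by ring. rewrite sin_neg, cos_neg. split; [ring|reflexivity]. }
  destruct Es as [Es Ec].
  assert (Hss : s * s = 1) by (destruct Hs as [-> | ->]; ring).
  assert (EN : kN q z0 = RtoC (2 * (c * (q ^ 2 + y ^ 2) / q))).
  { unfold z0. rewrite kN_im, Es, Ec, Hsn. f_equal.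
    replace (s * y * (s * - (y * c / q))) with (- (s * s) * (y * y * c / q)) by (field; lra).
    rewrite Hss. field; lra. }
  assert (El : l = RtoC (2 * c * (q + PI * (q ^ 2 + y ^ 2)) / q)).
  { unfold l. rewrite EN. unfold z0. rewrite Cexp_im, Cexp_im_opp, Ec.
    apply injective_projections; simpl; field; lra. }
  assert (Hq2 : 0 < q + PI * (q ^ 2 + y ^ 2)).
  { pose proof (pow2_ge_0 q). pose proof (pow2_ge_0 y). nra. }
  assert (Hlr : 2 * c * (q + PI * (q ^ 2 + y ^ 2)) / q <> 0).
  { unfold Rdiv. repeat apply Rmult_integral_contrapositive_currified; try lra.
    apply Rinv_neq_0_compat; lra. }
  split; [|split].
  - unfold z0. rewrite kD_im, Es, Ec.
    replace (q * (s * sin (PI * y)) + s * y * c) with (s * (q * sin (PI * y) + y * c)) by ring.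
    rewrite R. apply injective_projections; simpl; ring.
  - rewrite El. intros E. apply RtoC_inj in E. auto.
  - rewrite El, EN, <- RtoC_div by auto. f_equal. unfold koshliakov_weight.
    assert (q * (q + 1 / PI) + y ^ 2 <> 0).
    { replace (q * (q + 1 / PI) + y ^ 2) with ((q + PI * (q ^ 2 + y ^ 2)) / PI) by (field; lra).
      apply Rgt_not_eq, Rdiv_lt_0_compat; lra. }
    field. repeat split; lra.
Qed.

(** The divisor [z * z - w * w] preserves oddness, adds poles at [w] and [- w] whose residues carry
    the wanted value, and supplies the decay $|z|^{-2}$ that makes the outer sides of the contour
    negligible. *)
Definition kf (q : R) (w z : C) : C := (kN q z / kD q z / (z * z - w * w))%C.

(** The common residue of [kf] at $i\mu_n$ and $-i\mu_n$. *)
Definition kres (q : R) (mu : nat -> R) (w : C) (n : nat) : C :=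
  (RtoC (koshliakov_weight q (mu n) / PI) / (- RtoC (mu n ^ 2) - w * w))%C.

Lemma sqr_diff_nz (z w : C) : z <> w -> z <> (- w)%C -> (z * z - w * w)%C <> 0.
Proof.
  intros H1 H2. replace (z * z - w * w)%C with ((z - w) * (z - - w))%C by ring.
  apply Cmult_neq_0; apply Cminus_eq_contra; auto.
Qed.

Lemma holo_sqr_diff w z : holo (fun u => u * u - w * w)%C z.
Proof. apply holo_minus; [apply holo_mult; apply holo_id|apply holo_const]. Qed.

Lemma holo_kf q w z : kD q z <> 0 -> z <> w -> z <> (- w)%C -> holo (kf q w) z.
Proof.
  intros HD H1 H2. unfold kf. apply holo_div; [apply sqr_diff_nz; auto| |apply holo_sqr_diff].
  apply holo_div; [auto|apply holo_kN|apply holo_kD].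
Qed.

Lemma kf_opp q w z : kD q z <> 0 -> (z * z - w * w)%C <> 0 -> kf q w (- z)%C = (- kf q w z)%C.
Proof.
  intros HD Hw. unfold kf. rewrite kD_opp, kN_opp.
  replace (- z * - z - w * w)%C with (z * z - w * w)%C by ring. field; auto.
Qed.

Lemma im_ne_w (y : R) (w : C) : 0 < Re w -> (0, y) <> w /\ (0, y) <> (- w)%C.
Proof.
  intros Hw. split; intros E.
  - rewrite <- E in Hw. simpl in Hw. lra.
  - assert (E2 : Re (- w)%C = 0) by (rewrite <- E; reflexivity). rewrite re_opp in E2. lra.
Qed.

Lemma kf_pole_im q w y : 0 < q -> 0 < Re w ->
  let z0 := (0, y) in
  let l := (Cexp (RtoC PI * z0) + Cexp (- (RtoC PI * z0)) + RtoC PI * kN q z0)%C in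
  kD q z0 = 0 -> l <> 0 ->
  simple_pole (kf q w) z0 (kN q z0 / l / (- RtoC (y ^ 2) - w * w))%C.
Proof.
  intros Hq Hw z0 l HD Hl. destruct (im_ne_w y w Hw) as [N1 N2].
  pose proof (sqr_diff_nz z0 w N1 N2) as Hz.
  assert (Ez : (z0 * z0)%C = (- RtoC (y ^ 2))%C)
    by (unfold z0; apply injective_projections; simpl; ring).
  apply simple_pole_ext with (fun z => (kN q z / (z * z - w * w)) / kD q z)%C.
  { intros z. unfold kf, Cdiv. ring. }
  replace (kN q z0 / l / (- RtoC (y ^ 2) - w * w))%C
    with ((kN q z0 / (z0 * z0 - w * w)) / l)%C by (rewrite <- Ez; field; auto).
  apply (simple_pole_quotient (fun z => kN q z / (z * z - w * w))%C (kD q) z0 l); auto.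
  - apply holo_cts. apply holo_div; [auto|apply holo_kN|apply holo_sqr_diff].
  - apply Cderiv_kD.
Qed.

Lemma kf_pole_root q mu w n s : 0 < q -> koshliakov_root_seq q mu -> 0 < Re w -> s = 1 \/ s = -1 ->
  simple_pole (kf q w) (0, s * mu n) (kres q mu w n).
Proof.
  intros Hq Hmu Hw Hs. destruct (k_residue q mu n s Hq Hmu Hs) as (E1 & E2 & E3).
  pose proof (kf_pole_im q w (s * mu n) Hq Hw E1 E2) as P. cbv zeta in P.
  rewrite E3 in P. unfold kres.
  replace ((s * mu n) ^ 2) with (mu n ^ 2) in P; auto.
  destruct Hs as [-> | ->]; ring.
Qed.

(** At 0 the numerator is [2 * q] and the derivative of [kD] is [2 + 2 * PI * q]; their quotient is
    $c_q/\pi$, the source of the constant $c_q$. *)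
Lemma kf_pole_0 q w : 0 < q -> 0 < Re w ->
  simple_pole (kf q w) (0, 0) (RtoC (q / (1 + PI * q)) / - (w * w))%C.
Proof.
  intros Hq Hw. pose proof PI_RGT_0 as HP.
  assert (EN : kN q (0, 0) = RtoC (2 * q)).
  { rewrite kN_im, !Rmult_0_r, cos_0, sin_0. f_equal. ring. }
  assert (El : (Cexp (RtoC PI * (0, 0)) + Cexp (- (RtoC PI * (0, 0))) + RtoC PI * kN q (0, 0))%C
     = RtoC (2 + 2 * PI * q)).
  { rewrite EN, Cexp_im, Cexp_im_opp, !Rmult_0_r, cos_0, sin_0.
    apply injective_projections; simpl; ring. }
  pose proof (kf_pole_im q w 0 Hq Hw) as P. cbv zeta in P.
  assert (Hl : 2 + 2 * PI * q <> 0) by nra.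
  rewrite El, EN, <- RtoC_div in P by auto.
  replace (2 * q / (2 + 2 * PI * q)) with (q / (1 + PI * q)) in P by (field; nra).
  replace (- RtoC (0 ^ 2) - w * w)%C with (- (w * w))%C in P
    by (replace (0 ^ 2) with 0 by ring; ring).
  apply P.
  - rewrite kD_im, !Rmult_0_r, cos_0, sin_0. apply injective_projections; simpl; ring.
  - intros E. apply RtoC_inj in E. auto.
Qed.

Lemma C_nz_Re (w : C) : 0 < Re w -> w <> 0.
Proof. intros H E. rewrite E in H. simpl in H. lra. Qed.

Lemma Cdouble_nz (w : C) : w <> 0 -> (w + w)%C <> 0.
Proof.
  intros H E. apply H. replace w with (/ RtoC 2 * (w + w))%C.
  - rewrite E; ring.
  - replace (w + w)%C with (RtoC 2 * w)%C by (apply injective_projections; simpl; ring).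
    field.
Qed.

Lemma kf_pole_w q w : 0 < q -> 0 < Re w ->
  simple_pole (kf q w) w (kN q w / kD q w / (w + w))%C.
Proof.
  intros Hq Hw.
  apply (simple_pole_quotient (fun z => kN q z / kD q z)%C (fun z => z * z - w * w)%C w).
  - apply holo_cts, holo_div; [apply kD_nz_right; auto|apply holo_kN|apply holo_kD].
  - pose proof (Cderiv_plus _ _ w _ _ (Cderiv_mult _ _ w _ _ (Cderiv_id w) (Cderiv_id w))
      (Cderiv_const (- (w * w))%C w)) as D. cbv beta in D.
    replace (1 * w + w * 1 + 0)%C with (w + w)%C in D by ring. exact D.
  - ring.
  - apply Cdouble_nz, C_nz_Re; auto.
Qed.

(** * Summation of the residues over growing rectangles *)

Fixpoint csum (f : nat -> C) (n : nat) : C :=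
  match n with O => 0%C | S n => (csum f n + f n)%C end.

Lemma root_index q mu n M : 0 < q -> koshliakov_root_seq q mu ->
  INR M + 1 / 2 <= mu n <= INR M + 1 + 1 / 2 -> n = M.
Proof.
  intros Hq Hmu H. pose proof (root_seq_bounds q mu n Hq Hmu) as B.
  destruct (Nat.lt_trichotomy n M) as [L|[L|L]]; auto; exfalso;
    apply le_INR in L; rewrite S_INR in L; lra.
Qed.

Lemma root_ne_half q mu n M : 0 < q -> koshliakov_root_seq q mu -> mu n <> INR M + 1 / 2.
Proof.
  intros Hq Hmu E. pose proof (root_seq_bounds q mu n Hq Hmu) as B.
  rewrite (root_index q mu n M Hq Hmu) in B by lra.
  rewrite (root_index q mu n M Hq Hmu) in E by lra. lra.
Qed.

(** Since [dl < Re w], the column contains only poles on the imaginary axis. Passing from [M] to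
    [M + 1] adds one strip above and one below, each with exactly one pole in its interior and none
    on its boundary. *)
Lemma rint_kf_column q mu w dl M : 0 < q -> koshliakov_root_seq q mu -> 0 < dl < Re w ->
  rint (kf q w) (- dl) dl (- (INR M + 1 / 2)) (INR M + 1 / 2)
  = (RtoC (2 * PI) * Ci * (RtoC (q / (1 + PI * q)) / - (w * w)
       + csum (fun n => kres q mu w n + kres q mu w n) M))%C.
Proof.
  intros Hq Hmu Hd.
  assert (Hol : forall x y, - dl <= x <= dl ->
    (x = 0 -> y <> 0 /\ forall n, y <> mu n /\ y <> - mu n) -> holo (kf q w) (x, y)).
  { intros x y Hx Hy. apply holo_kf.
    - intros E. destruct (kD_zeros q mu x y Hq Hmu E) as [E1 E2].
      destruct (Hy E1) as [Y1 Y2]. destruct E2 as [E2|[n [E2|E2]]]; [auto|destruct (Y2 n); auto|destruct (Y2 n); auto].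
    - intros E. rewrite <- E in Hd. simpl in Hd. lra.
    - intros E. assert (E2 : Re (- w)%C = x) by (rewrite <- E; reflexivity).
      rewrite re_opp in E2. lra. }
  induction M as [|M IH].
  - simpl csum. simpl INR.
    replace (RtoC (q / (1 + PI * q)) / - (w * w) + 0)%C with (RtoC (q / (1 + PI * q)) / - (w * w))%C by ring.
    apply (rint_residue _ 0 0); try lra.
    + intros x y Hx Hy Hn. apply Hol; auto. intros ->. split.
      * intros ->. auto.
      * intros n. pose proof (root_seq_bounds q mu n Hq Hmu). pose proof (pos_INR n). lra.
    + apply kf_pole_0; lra.
  - simpl csum. rewrite S_INR.
    set (Y := INR M + 1 / 2) in *. assert (HY : 0 < Y) by (unfold Y; pose proof (pos_INR M); lra).
    replace (INR M + 1 + 1 / 2) with (Y + 1) by (unfold Y; ring).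
    assert (Hm : forall n, Y <= mu n <= Y + 1 -> n = M).
    { intros n Hn. apply (root_index q mu n M Hq Hmu). unfold Y in Hn. lra. }
    assert (Hne : forall n, mu n <> Y /\ mu n <> Y + 1 /\ 0 < mu n).
    { intros n. split; [apply (root_ne_half q mu n M Hq Hmu)|].
      pose proof (root_ne_half q mu n (S M) Hq Hmu) as E. rewrite S_INR in E.
      pose proof (root_seq_bounds q mu n Hq Hmu). pose proof (pos_INR n).
      unfold Y. split; [|lra]. intros E'. apply E. rewrite E'. ring. }
    pose proof (root_seq_bounds q mu M Hq Hmu) as HB.
    assert (Bd : forall y y', (y = Y \/ y = Y + 1 \/ y = - Y \/ y = - (Y + 1)) ->
      (y' = Y \/ y' = Y + 1 \/ y' = - Y \/ y' = - (Y + 1)) -> cts_boundary (kf q w) (- dl) dl y y').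
    { intros y y' Hy Hy'. split.
      - intros x Hx. split; apply holo_cts, Hol; auto; intros _; (split; [lra|]);
          intros n; destruct (Hne n) as (A1 & A2 & A3); split; lra.
      - intros y0 _. split; apply holo_cts, Hol; try lra. }
    rewrite (rint_split_y _ _ _ (- (Y + 1)) Y (Y + 1)); [|lra|lra|apply Bd; auto|apply Bd; auto].
    rewrite (rint_split_y _ _ _ (- (Y + 1)) (- Y) Y); [|lra|lra|apply Bd; auto|apply Bd; auto].
    rewrite IH.
    rewrite (rint_residue (kf q w) 0 (mu M) (kres q mu w M) (- dl) dl Y (Y + 1)); try (unfold Y; lra).
    2:{ intros x y Hx Hy Hn. apply Hol; auto. intros ->. split; [lra|]. intros n.
        destruct (Hne n) as (A1 & A2 & A3). split; [|lra]. intros E.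
        rewrite E in Hy. specialize (Hm n Hy). subst n. apply Hn. congruence. }
    2:{ pose proof (kf_pole_root q mu w M 1 Hq Hmu ltac:(lra) ltac:(auto)) as P.
        rewrite Rmult_1_l in P. exact P. }
    rewrite (rint_residue (kf q w) 0 (- mu M) (kres q mu w M) (- dl) dl (- (Y + 1)) (- Y)); try (unfold Y; lra).
    2:{ intros x y Hx Hy Hn. apply Hol; auto. intros ->. split; [lra|]. intros n.
        destruct (Hne n) as (A1 & A2 & A3). split; [lra|]. intros E.
        assert (Hy2 : Y <= mu n <= Y + 1) by lra. specialize (Hm n Hy2). subst n. apply Hn. congruence. }
    2:{ pose proof (kf_pole_root q mu w M (-1) Hq Hmu ltac:(lra) ltac:(auto)) as P.
        replace (-1 * mu M) with (- mu M) in P by ring. exact P. }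
    ring.
Qed.

Lemma half_plane_denominator (w z : C) (Y : R) : Y <= Cmod z -> 2 * Cmod w + 1 <= Y ->
  Y ^ 2 / 2 <= Cmod (z * z - w * w)%C.
Proof.
  intros Hz HY. pose proof (Cmod_ge_0 w) as Hw.
  pose proof (Cmod_reverse_triangle (z * z)%C (- (w * w))%C) as T.
  rewrite Cmod_opp, !Cmod_mult in T. unfold Cminus. nra.
Qed.

(* Top and bottom of the middle column: on [Im z = M + 1/2] the exponentials are
   imaginary, which keeps the denominator away from 0. *)
Lemma kD_half_line q x M s : 0 < q -> s = 1 \/ s = -1 ->
  2 * q <= Cmod (kD q (x, s * (INR M + 1 / 2))).
Proof.
  intros Hq Hs. set (y := s * (INR M + 1 / 2)). pose proof PI_RGT_0 as HP.
  assert (Hc : cos (PI * y) = 0).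
  { unfold y. assert (H0 : cos (PI * (INR M + 1 / 2)) = 0).
    { apply cos_eq_0_1. exists (Z.of_nat M). rewrite <- INR_IZR_INZ. field. }
    destruct Hs as [-> | ->]; [rewrite Rmult_1_l; auto|].
    replace (PI * (-1 * (INR M + 1 / 2))) with (- (PI * (INR M + 1 / 2))) by ring.
    rewrite cos_neg; auto. }
  assert (Hs2 : sin (PI * y) ^ 2 = 1).
  { pose proof (sin2_cos2 (PI * y)) as S. rewrite Hc in S. unfold Rsqr in S. nra. }
  assert (E : kD q (x, y) = ((0, sin (PI * y)) *
     ((RtoC q + (x, y)) * RtoC (exp (PI * x)) + (RtoC q - (x, y)) * RtoC (exp (- (PI * x)))))%C).
  { unfold kD.
    assert (E1 : Cexp (RtoC PI * (x, y)) = (0, exp (PI * x) * sin (PI * y))).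
    { unfold Cexp; simpl. replace (PI * x - 0 * y) with (PI * x) by ring.
      replace (PI * y + 0 * x) with (PI * y) by ring. rewrite Hc.
      apply injective_projections; simpl; ring. }
    assert (E2 : Cexp (- (RtoC PI * (x, y))) = (0, - (exp (- (PI * x)) * sin (PI * y)))).
    { unfold Cexp; simpl. replace (PI * x - 0 * y) with (PI * x) by ring.
      replace (PI * y + 0 * x) with (PI * y) by ring. rewrite cos_neg, sin_neg, Hc.
      apply injective_projections; simpl; ring. }
    rewrite E1, E2. apply injective_projections; simpl; ring. }
  rewrite E, Cmod_mult.
  assert (H1 : Cmod (0, sin (PI * y)) = 1).
  { unfold Cmod; simpl. replace (0 * (0 * 1) + sin (PI * y) * (sin (PI * y) * 1)) with (sin (PI * y) ^ 2) by ring.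
    rewrite Hs2. apply sqrt_1. }
  rewrite H1, Rmult_1_l.
  eapply Rle_trans; [|apply re_le_Cmod]. eapply Rle_trans; [|apply Rle_abs]. simpl.
  set (u := exp (PI * x)). set (v := exp (- (PI * x))).
  assert (Huv : u * v = 1).
  { unfold u, v. rewrite <- exp_plus. replace (PI * x + - (PI * x)) with 0 by ring. apply exp_0. }
  assert (Hu : 0 < u) by apply exp_pos. assert (Hv : 0 < v) by apply exp_pos.
  assert (Hsum : 2 <= u + v) by (pose proof (pow2_ge_0 (u - v)); nra).
  assert (Hx : 0 <= x * (u - v)).
  { destruct (Rle_lt_dec 0 x) as [L|L].
    - apply Rmult_le_pos; auto. assert (v <= u); [|lra]. apply exp_le. nra.
    - assert (u <= v) by (apply exp_le; nra). nra. }
  nra.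
Qed.

Lemma RInt_reflect (f : R -> R) Y : ex_RInt f (- Y) Y ->
  RInt (fun y => f (- y)) (- Y) Y = RInt f (- Y) Y.
Proof.
  intros H. apply (is_RInt_unique (V := R_CompleteNormedModule)).
  pose proof (RInt_correct (V := R_CompleteNormedModule) f (- Y) Y H) as I.
  apply (is_RInt_swap (V := R_NormedModule)) in I.
  replace Y with (- - Y) in I at 1 by ring.
  apply (is_RInt_comp_opp (V := R_NormedModule) f (- Y) Y) in I.
  apply (is_RInt_opp (V := R_NormedModule)) in I. rewrite opp_opp in I.
  eapply (is_RInt_ext (V := R_NormedModule)); [|exact I].
  intros y _. unfold opp; simpl; ring.
Qed.

Lemma Cint_reflect f Y : ex_Cint f (- Y) Y -> Cint (fun y => f (- y)) (- Y) Y = Cint f (- Y) Y.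
Proof.
  intros [F1 F2]. unfold Cint.
  rewrite (RInt_reflect (fun t => fst (f t)) Y F1), (RInt_reflect (fun t => snd (f t)) Y F2). auto.
Qed.

Lemma re_le (z : C) : Re z <= Cmod z.
Proof. eapply Rle_trans; [apply Rle_abs|apply re_le_Cmod]. Qed.

Lemma kf_right_bound q w dl z Y : 0 < q -> 0 < dl <= Re z -> Y <= Cmod z -> 2 * Cmod w + 1 <= Y ->
  Cmod (kf q w z) <= 2 * ((1 + exp (- (2 * PI * dl))) / (1 - exp (- (2 * PI * dl)))) / Y ^ 2.
Proof.
  intros Hq Hd Hz HY. pose proof (half_plane_denominator w z Y Hz HY) as L.
  pose proof (k_ratio_bound q dl z Hq (proj1 Hd) (proj2 Hd)) as B.
  pose proof (Cmod_ge_0 w).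
  assert (0 < Y ^ 2) by (apply pow_lt; lra).
  unfold kf. rewrite Cmod_div by (apply Cmod_gt_0; lra).
  apply Rle_div_l; [lra|]. eapply Rle_trans; [exact B|].
  set (k := (1 + exp (- (2 * PI * dl))) / (1 - exp (- (2 * PI * dl)))) in *.
  assert (0 <= k) by (eapply Rle_trans; [apply Cmod_ge_0|exact B]).
  apply Rle_trans with (2 * k / Y ^ 2 * (Y ^ 2 / 2)); [right; field; lra|].
  apply Rmult_le_compat_l; auto. apply Rmult_le_pos; [lra|]. left; apply Rinv_0_lt_compat; auto.
Qed.

(** On these segments [kN] may grow linearly in [Y] while [kD] is only known to be at least [2 * q];
    the divisor of order [Y ^ 2] still leaves a bound of order [1 / Y]. *)
Lemma kf_column_bound q w dl x M s Y : 0 < q -> s = 1 \/ s = -1 -> - dl <= x <= dl ->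
  Y = INR M + 1 / 2 -> 2 * Cmod w + 1 <= Y ->
  Cmod (kf q w (x, s * Y)) <= 2 * (q + dl + 1) * exp (PI * dl) / q / Y.
Proof.
  intros Hq Hs Hx HYe HY. pose proof (Cmod_ge_0 w) as Hw. pose proof PI_RGT_0 as HP.
  set (z := (x, s * Y) : C).
  assert (As : Rabs (s * Y) = Y).
  { destruct Hs as [-> | ->]; [rewrite Rmult_1_l, Rabs_pos_eq; lra|].
    replace (-1 * Y) with (- Y) by ring. rewrite Rabs_Ropp, Rabs_pos_eq; lra. }
  assert (Ax : Rabs x <= dl) by (apply Rabs_le; lra).
  assert (Zl : Y <= Cmod z).
  { rewrite <- As. apply (im_le_Cmod z). }
  assert (Zu : Cmod z <= dl + Y).
  { eapply Rle_trans; [apply Cmod_pair|]. lra. }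
  pose proof (half_plane_denominator w z Y Zl HY) as L.
  assert (DL : 2 * q <= Cmod (kD q z)) by (unfold z; rewrite HYe; apply kD_half_line; auto).
  assert (NU : Cmod (kN q z) <= 2 * (q + (dl + Y)) * exp (PI * dl)).
  { unfold kN. eapply Rle_trans; [apply Cmod_triangle|].
    rewrite !Cmod_mult, !Cmod_Cexp, re_opp, Re_PI_mult. simpl (Re z).
    assert (A1 : Cmod (RtoC q + z)%C <= q + (dl + Y)).
    { eapply Rle_trans; [apply Cmod_triangle|]. rewrite Cmod_R, Rabs_pos_eq; lra. }
    assert (A2 : Cmod (RtoC q - z)%C <= q + (dl + Y)).
    { eapply Rle_trans; [apply Cmod_minus_triangle|]. rewrite Cmod_R, Rabs_pos_eq; lra. }
    assert (A3 : exp (PI * x) <= exp (PI * dl)) by (apply exp_le; nra).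
    assert (A4 : exp (- (PI * x)) <= exp (PI * dl)) by (apply exp_le; nra).
    replace (2 * (q + (dl + Y)) * exp (PI * dl))
      with ((q + (dl + Y)) * exp (PI * dl) + (q + (dl + Y)) * exp (PI * dl)) by ring.
    apply Rplus_le_compat; apply Rmult_le_compat; auto; try apply Cmod_ge_0; left; apply exp_pos. }
  assert (HY2 : 0 < Y ^ 2) by (apply pow_lt; lra).
  unfold kf. rewrite !Cmod_div by (apply Cmod_gt_0; lra).
  assert (Hdl : 0 <= dl) by lra.
  assert (NU2 : Cmod (kN q z) <= 2 * (q + dl + 1) * Y * exp (PI * dl)).
  { eapply Rle_trans; [exact NU|]. apply Rmult_le_compat_r; [left; apply exp_pos|]. nra. }
  apply Rle_trans with (2 * (q + dl + 1) * Y * exp (PI * dl) / (2 * q) / (Y ^ 2 / 2)).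
  - assert (I1 : 0 <= / Cmod (kD q z) <= / (2 * q)).
    { split; [left; apply Rinv_0_lt_compat; lra|apply Rinv_le_contravar; lra]. }
    assert (I2 : 0 <= / Cmod (z * z - w * w)%C <= / (Y ^ 2 / 2)).
    { split; [left; apply Rinv_0_lt_compat; lra|apply Rinv_le_contravar; lra]. }
    unfold Rdiv at 1 2. unfold Rdiv at 1. unfold Rdiv at 1.
    apply Rmult_le_compat; try apply I2; [|apply Rmult_le_compat; try apply I1; auto; apply Cmod_ge_0].
    apply Rmult_le_pos; [apply Cmod_ge_0|apply I1].
  - right. field. split; lra.
Qed.

(** The closed form $\frac{\pi}{w}(K_q(2\pi w)+\frac12)-\frac{c_q}{2w^2}$ in a complex variable,
    with [kN / (2 * kD)] for $K_q+\frac12$. *)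
Definition koshliakov_trace (q : R) (w : C) : C :=
  (RtoC (PI / 2) * (kN q w / kD q w / w) - RtoC (PI / 2 * (q / (1 + PI * q))) / (w * w))%C.

(** The bounded quantity is the sum of all residues in the square of half-side [M + 1/2]. By oddness
    [- w] has the same residue as [w], hence the factor 2, and the left part of the square is
    replaced by a second copy of the right part. *)
Lemma kf_residue_sum q mu w : 0 < q -> koshliakov_root_seq q mu -> 0 < Re w ->
  exists k, forall M, 2 * Cmod w + 1 <= INR M + 1 / 2 ->
    Cmod (RtoC (q / (1 + PI * q)) / - (w * w)
       + csum (fun n => kres q mu w n + kres q mu w n) M
       + RtoC 2 * (kN q w / kD q w / (w + w)))%C <= k / (INR M + 1 / 2).
Proof.
  intros Hq Hmu Hw. pose proof PI_RGT_0 as HP.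
  set (dl := Re w / 2). assert (Hd : 0 < dl < Re w) by (unfold dl; lra).
  set (c1 := 2 * ((1 + exp (- (2 * PI * dl))) / (1 - exp (- (2 * PI * dl))))).
  set (c2 := 2 * (q + dl + 1) * exp (PI * dl) / q).
  exists ((8 * dl * c2 + 16 * c1) / (2 * PI)). intros M HM.
  set (Y := INR M + 1 / 2) in *.
  pose proof (Cmod_ge_0 w) as Hw0. pose proof (re_le w) as Hrw.
  pose proof (im_le_Cmod w) as Hiw. apply Rabs_le_between in Hiw.
  assert (Hol : forall x y, dl <= x -> (x, y) <> w -> holo (kf q w) (x, y)).
  { intros x y Hx Hn. apply holo_kf; auto.
    - apply kD_nz_right; auto. simpl. lra.
    - intros E. assert (E2 : Re (- w)%C = x) by (rewrite <- E; reflexivity). rewrite re_opp in E2. lra. }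
  assert (Hbr : forall x y, dl <= x -> Y <= Cmod (x, y) -> Cmod (kf q w (x, y)) <= c1 / Y ^ 2).
  { intros x y Hx Hy. apply kf_right_bound; auto. simpl; lra. }
  assert (HnY : forall x y, (x = Y \/ y = Y \/ y = - Y \/ x = dl) -> (x, y) <> w).
  { intros x y Hxy E. rewrite <- E in *. simpl in *. lra. }
  assert (HcY : forall x y, (x = Y \/ y = Y \/ y = - Y) -> Y <= Cmod (x, y)).
  { intros x y Hxy. destruct Hxy as [-> |[-> | ->]].
    - eapply Rle_trans; [|apply (re_le_Cmod (Y, y))]. simpl. rewrite Rabs_pos_eq; lra.
    - eapply Rle_trans; [|apply (im_le_Cmod (x, Y))]. simpl. rewrite Rabs_pos_eq; lra.
    - eapply Rle_trans; [|apply (im_le_Cmod (x, - Y))]. simpl. rewrite Rabs_Ropp, Rabs_pos_eq; lra. }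
  assert (HexH : forall y, (y = Y \/ y = - Y) -> ex_Cint (fun x => kf q w (x, y)) dl Y).
  { intros y Hy. apply ex_Cint_h; [lra|]. intros x Hx. apply holo_cts, Hol; [lra|]. apply HnY; lra. }
  assert (HexV : forall x, (x = Y \/ x = dl) -> ex_Cint (fun y => kf q w (x, y)) (- Y) Y).
  { intros x Hx. apply ex_Cint_v; [lra|]. intros y Hy. apply holo_cts, Hol; [lra|]. apply HnY; lra. }
  (* [J] is the integral along Re z = dl. It enters the right rectangle once with a minus sign and,
     by oddness, the column twice with a plus sign; column plus twice the right rectangle eliminates
     it. *)
  set (J := Cint (fun y => kf q w (dl, y)) (- Y) Y).
  assert (A1 := rint_residue (kf q w) (Re w) (Im w) (kN q w / kD q w / (w + w))%C dl Y (- Y) Y).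
  assert (Ew : (Re w, Im w) = w) by (destruct w; reflexivity). rewrite Ew in A1.
  specialize (A1 ltac:(lra) ltac:(lra)).
  assert (A1' : rint (kf q w) dl Y (- Y) Y = (RtoC (2 * PI) * Ci * (kN q w / kD q w / (w + w)))%C).
  { apply A1; [|apply kf_pole_w; auto]. intros; apply Hol; auto; lra. }
  clear A1. unfold rint in A1'.
  rewrite (Cint_minus (fun y => kf q w (Y, y)) (fun y => kf q w (dl, y))) in A1' by auto.
  fold J in A1'.
  set (Eb := Cint (fun x => kf q w (x, (- Y)%R) - kf q w (x, Y))%C dl Y) in *.
  set (Er := Cint (fun y => kf q w (Y, y)) (- Y) Y) in *.
  assert (HY2 : 0 < Y ^ 2) by (apply pow_lt; lra).
  assert (BEb : Cmod Eb <= 4 * c1 / Y).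
  { eapply Rle_trans; [apply (Cint_bound _ dl Y (2 * (c1 / Y ^ 2)))|].
    - lra. - apply ex_Cint_minus; auto.
    - intros x Hx. eapply Rle_trans; [apply Cmod_minus_triangle|].
      pose proof (Hbr x Y ltac:(lra) ltac:(auto)). pose proof (Hbr x (- Y) ltac:(lra) ltac:(auto)). lra.
    - assert (0 <= c1 / Y ^ 2).
      { eapply Rle_trans; [apply Cmod_ge_0|]. apply (Hbr Y Y); [lra|auto]. }
      apply Rle_trans with (2 * (2 * (c1 / Y ^ 2)) * Y); [nra|]. right; field; lra. }
  assert (BEr : Cmod Er <= 4 * c1 / Y).
  { eapply Rle_trans; [apply (Cint_bound _ (- Y) Y (c1 / Y ^ 2))|].
    - lra. - apply HexV; auto. - intros y Hy. apply Hbr; [lra|auto].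
    - right; field; lra. }
  pose proof (rint_kf_column q mu w dl M Hq Hmu Hd) as A2. fold Y in A2. unfold rint in A2.
  assert (Em : forall y, kf q w (- dl, y) = (- kf q w (dl, (- y)%R))%C).
  { intros y. replace ((- dl, y) : C) with (- (dl, (- y)%R))%C
      by (apply injective_projections; simpl; ring).
    apply kf_opp; [apply kD_nz_right; simpl; lra|]. apply sqr_diff_nz.
    - intros E. rewrite <- E in Hd. simpl in Hd. lra.
    - intros E. assert (E2 : Re (- w)%C = dl) by (rewrite <- E; reflexivity). rewrite re_opp in E2. lra. }
  assert (EJ : Cint (fun y => kf q w (dl, y) - kf q w ((- dl)%R, y))%C (- Y) Y = (J + J)%C).
  { rewrite (Cint_ext _ (fun y => kf q w (dl, y) + kf q w (dl, (- y)%R))%C)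
      by (intros y _; rewrite Em; ring).
    rewrite (Cint_plus (fun y => kf q w (dl, y)) (fun y => kf q w (dl, (- y)%R))).
    - rewrite (Cint_reflect (fun y => kf q w (dl, y)) Y) by (apply HexV; auto). reflexivity.
    - apply HexV; auto.
    - destruct (ex_Cint_v (kf q w) (- dl) (- Y) Y) as [V1 V2]; [lra| |].
      + intros y Hy. apply holo_cts, holo_kf.
        * apply kD_nz_off; auto. simpl; lra.
        * intros E. rewrite <- E in Hw. simpl in Hw. lra.
        * intros E. assert (E2 : Re (- w)%C = - dl) by (rewrite <- E; reflexivity). rewrite re_opp in E2. lra.
      + split.
        * apply ex_RInt_ext with (fun y => opp (fst (kf q w (- dl, y)))).
          { intros y _. rewrite Em. unfold opp; simpl. ring. }
          apply (ex_RInt_opp (V := R_NormedModule)); auto.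
        * apply ex_RInt_ext with (fun y => opp (snd (kf q w (- dl, y)))).
          { intros y _. rewrite Em. unfold opp; simpl. ring. }
          apply (ex_RInt_opp (V := R_NormedModule)); auto. }
  rewrite EJ in A2.
  set (Et := Cint (fun x => kf q w (x, (- Y)%R) - kf q w (x, Y))%C (- dl) dl) in *.
  assert (BEt : Cmod Et <= 8 * dl * c2 / Y).
  { assert (Hcol : forall x, - dl <= x <= dl -> Cmod (kf q w (x, - Y)) <= c2 / Y /\ Cmod (kf q w (x, Y)) <= c2 / Y).
    { intros x Hx.
      pose proof (kf_column_bound q w dl x M (-1) Y Hq ltac:(auto) Hx eq_refl HM) as B1.
      pose proof (kf_column_bound q w dl x M 1 Y Hq ltac:(auto) Hx eq_refl HM) as B2.
      replace (-1 * Y) with (- Y) in B1 by ring. rewrite Rmult_1_l in B2. split; auto. }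
    assert (Hex : forall y, (y = Y \/ y = - Y) -> ex_Cint (fun x => kf q w (x, y)) (- dl) dl).
    { intros y Hy. apply ex_Cint_h; [lra|]. intros x Hx. apply holo_cts, holo_kf.
      - apply Cmod_gt_0. apply Rlt_le_trans with (2 * q); [lra|].
        destruct Hy as [-> | ->].
        + replace Y with (1 * (INR M + 1 / 2)) by (unfold Y; ring). apply kD_half_line; auto.
        + replace (- Y) with (-1 * (INR M + 1 / 2)) by (unfold Y; ring). apply kD_half_line; auto.
      - intros E. rewrite <- E in Hd. simpl in Hd. lra.
      - intros E. assert (E2 : Re (- w)%C = x) by (rewrite <- E; reflexivity). rewrite re_opp in E2. lra. }
    eapply Rle_trans; [apply (Cint_bound _ (- dl) dl (2 * (c2 / Y)))|].
    - lra. - apply ex_Cint_minus; auto.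
    - intros x Hx. eapply Rle_trans; [apply Cmod_minus_triangle|]. destruct (Hcol x Hx). lra.
    - right; field; lra. }
  set (X := (RtoC (q / (1 + PI * q)) / - (w * w)
       + csum (fun n => kres q mu w n + kres q mu w n) M)%C) in *.
  set (rw := (kN q w / kD q w / (w + w))%C) in *.
  assert (EE : (RtoC (2 * PI) * Ci * (X + RtoC 2 * rw))%C = (Et + (Eb + Eb) + Ci * (Er + Er))%C).
  { replace (RtoC (2 * PI) * Ci * (X + RtoC 2 * rw))%C
      with (RtoC (2 * PI) * Ci * X + (RtoC (2 * PI) * Ci * rw + RtoC (2 * PI) * Ci * rw))%C
      by (apply injective_projections; simpl; ring).
    rewrite <- A1', <- A2. ring. }
  assert (BB : Cmod (RtoC (2 * PI) * Ci * (X + RtoC 2 * rw))%C <= (8 * dl * c2 + 16 * c1) / Y).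
  { rewrite EE.
    pose proof (Cmod_triangle (Et + (Eb + Eb))%C (Ci * (Er + Er))%C) as T1.
    pose proof (Cmod_triangle Et (Eb + Eb)%C) as T2. pose proof (Cmod_triangle Eb Eb) as T3.
    pose proof (Cmod_triangle Er Er) as T4. rewrite Cmod_mult, Cmod_Ci, Rmult_1_l in T1.
    replace ((8 * dl * c2 + 16 * c1) / Y) with (8 * dl * c2 / Y + 4 * (4 * c1 / Y)) by (field; lra). lra. }
  rewrite !Cmod_mult, Cmod_Ci, Cmod_R, Rmult_1_r, Rabs_pos_eq in BB by lra.
  apply (Rmult_le_reg_l (2 * PI)); [lra|]. eapply Rle_trans; [exact BB|]. right; field; lra.
Qed.

Lemma Re_csum (f : nat -> C) n : Re (csum f (S n)) = sum_n (fun k => Re (f k)) n.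
Proof.
  induction n as [|n IH].
  - rewrite sum_O. change (csum f 1) with (0 + f 0%nat)%C. rewrite re_plus. simpl. ring.
  - rewrite sum_Sn, <- IH. change (csum f (S (S n))) with (csum f (S n) + f (S n))%C.
    rewrite re_plus. reflexivity.
Qed.

Lemma sum_n_scal_R (c : R) (f : nat -> R) n : sum_n (fun k => c * f k) n = c * sum_n f n.
Proof.
  induction n as [|n IH]; [rewrite !sum_O; auto|].
  rewrite !sum_Sn, IH. unfold plus; simpl. ring.
Qed.

(** Real parts are enough for both applications: at real [w] all terms are real, and for $w^2=ia$
    the real part of $1/(\mu^2+ia)$ is $\mu^2/(\mu^4+a^2)$. *)
Theorem koshliakov_trace_series q mu w : 0 < q -> koshliakov_root_seq q mu -> 0 < Re w ->
  is_series (fun n => koshliakov_weight q (mu n) * Re (/ (RtoC (mu n ^ 2) + w * w))%C)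
    (Re (koshliakov_trace q w)).
Proof.
  intros Hq Hmu Hw. pose proof PI_RGT_0 as HP.
  destruct (kf_residue_sum q mu w Hq Hmu Hw) as [k Hk].
  pose proof (C_nz_Re w Hw) as Hw0. pose proof (Cdouble_nz w Hw0) as Hww.
  pose proof (kD_nz_right q w Hq Hw) as HD.
  assert (Hden : forall n, (RtoC (mu n ^ 2) + w * w)%C <> 0).
  { intros n E. destruct (im_ne_w (mu n) w Hw) as [N1 N2].
    apply (sqr_diff_nz _ _ N1 N2).
    replace ((0, mu n) * (0, mu n) - w * w)%C with (- (RtoC (mu n ^ 2) + w * w))%C
      by (apply injective_projections; simpl; ring). rewrite E; ring. }
  set (a := fun n => koshliakov_weight q (mu n) * Re (/ (RtoC (mu n ^ 2) + w * w))%C).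
  assert (E : forall n, Re (kres q mu w n + kres q mu w n)%C = - (2 / PI) * a n).
  { intros n. unfold a, kres.
    replace (RtoC (koshliakov_weight q (mu n) / PI) / (- RtoC (mu n ^ 2) - w * w))%C
      with (RtoC (- (koshliakov_weight q (mu n) / PI)) * / (RtoC (mu n ^ 2) + w * w))%C.
    - rewrite re_plus, !re_scal_l. field; lra.
    - rewrite RtoC_opp. field. split; [|auto].
      intros E. apply (Hden n). rewrite <- (Copp_0). rewrite <- E. ring. }
  assert (Hsum : forall n, Rabs (sum_n a n - Re (koshliakov_trace q w))
      = PI / 2 * Rabs (Re (RtoC (q / (1 + PI * q)) / - (w * w)
       + csum (fun n => kres q mu w n + kres q mu w n) (S n)
       + RtoC 2 * (kN q w / kD q w / (w + w)))%C)).
  { intros n. rewrite <- (Rabs_pos_eq (PI / 2)) at 1 by lra. rewrite <- Rabs_mult, <- Rabs_Ropp. f_equal.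
    rewrite !re_plus, Re_csum.
    rewrite (sum_n_ext (fun k => Re (kres q mu w k + kres q mu w k)%C) (fun k => - (2 / PI) * a k)) by (intros m; apply E).
    rewrite sum_n_scal_R.
    replace (koshliakov_trace q w) with (RtoC (PI / 2) * (RtoC 2 * (kN q w / kD q w / (w + w))
       + RtoC (q / (1 + PI * q)) / - (w * w)))%C.
    - rewrite re_scal_l, re_plus. field. lra.
    - unfold koshliakov_trace. rewrite (RtoC_mult (PI / 2) (q / _)).
      assert (E2 : (w + w)%C = (RtoC 2 * w)%C) by (apply injective_projections; simpl; ring).
      rewrite E2 in *.
      field. auto. }
  apply is_lim_seq_Reals. intros eps He.
  destruct (nfloor_ex (Rmax (2 * Cmod w + 1) (PI / 2 * Rabs k / eps + 1))) as [N HN].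
  { pose proof (Cmod_ge_0 w). eapply Rle_trans; [|apply Rmax_l]. lra. }
  exists N. intros n Hn. unfold R_dist. rewrite Hsum.
  pose proof (Rmax_l (2 * Cmod w + 1) (PI / 2 * Rabs k / eps + 1)) as M1.
  pose proof (Rmax_r (2 * Cmod w + 1) (PI / 2 * Rabs k / eps + 1)) as M2.
  apply le_INR in Hn.
  specialize (Hk (S n)). rewrite S_INR in Hk. specialize (Hk ltac:(lra)).
  set (Y := INR n + 1 + 1 / 2) in *.
  assert (HY : PI / 2 * Rabs k / eps < Y) by (unfold Y; lra).
  assert (HY0 : 0 < Y) by (unfold Y; pose proof (pos_INR n); lra).
  apply Rle_lt_trans with (PI / 2 * (Rabs k / Y)).
  - apply Rmult_le_compat_l; [lra|]. eapply Rle_trans; [apply re_le_Cmod|].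
    eapply Rle_trans; [exact Hk|]. apply Rmult_le_compat_r; [left; apply Rinv_0_lt_compat; auto|apply Rle_abs].
  - apply (Rmult_lt_reg_r Y); auto. replace (PI / 2 * (Rabs k / Y) * Y) with (PI / 2 * Rabs k) by (field; lra).
    apply (Rmult_lt_compat_r eps) in HY; auto. unfold Rdiv in HY at 1.
    rewrite Rmult_assoc, Rinv_l, Rmult_1_r in HY by lra. lra.
Qed.

(** * The value at 1/2 of the continued zeta function *)

Lemma holo_of_ex_derive (f : C -> C) (z : C) :
  ex_derive (K := C_AbsRing) (V := C_NormedModule) f z -> holo f z.
Proof.
  intros [l Hl]. exists l. destruct Hl as [_ Hl]. intros eps He.
  specialize (Hl z (fun P HP => HP) (mkposreal eps He)).
  destruct Hl as [d Hd]. exists d. split; [apply cond_pos|]. intros h Hh.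
  specialize (Hd (z + h)%C).
  assert (Hb : @ball (AbsRing_UniformSpace C_AbsRing) z d (z + h)%C).
  { unfold ball; simpl. unfold AbsRing_ball, abs, minus, plus, opp; simpl.
    replace (z + h + - z)%C with h by ring. exact Hh. }
  specialize (Hd Hb).
  change (Cmod ((f (z + h) + - f z) + - ((z + h + - z) * l))%C <= eps * Cmod (z + h + - z)%C) in Hd.
  replace (z + h + - z)%C with h in Hd by ring.
  replace (f (z + h) - f z - l * h)%C with (f (z + h) + - f z + - (h * l))%C by ring. exact Hd.
Qed.

Lemma locally'_C_eps (f : C -> C) (z r : C) :
  filterlim f (locally' z) (locally r) ->
  forall eps, 0 < eps -> exists d, 0 < d /\ forall u, u <> z -> Cmod (u - z)%C < d ->
    Cmod (f u - r)%C < eps.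
Proof.
  intros H eps He.
  (* Balls of the product uniform structure are squares, so each coordinate is allowed [eps / 2]. *)
  assert (He2 : 0 < eps / 2) by lra.
  destruct (H (ball r (mkposreal _ He2))) as [d Hd].
  { exists (mkposreal _ He2). auto. }
  exists d. split; [apply cond_pos|]. intros u Hu Hc.
  assert (B : ball z d u).
  { split; eapply Rle_lt_trans; [|exact Hc| |exact Hc].
    - apply (re_le_Cmod (u - z)%C).
    - apply (im_le_Cmod (u - z)%C). }
  specialize (Hd u B Hu). destruct Hd as [B1 B2]. simpl in B1, B2.
  destruct (f u) as [a b], r as [c e]. simpl in *.
  unfold ball in B1, B2; simpl in B1, B2. unfold AbsRing_ball, abs, minus, plus, opp in B1, B2; simpl in B1, B2.
  eapply Rle_lt_trans; [apply (Cmod_pair (a + - c) (b + - e))|]. lra.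
Qed.

(** One factor [s - 1] gives a function with limit [r] at 1 but value 0, whatever [Z 1] is. The
    second factor turns that limit into a derivative, which makes the product differentiable at 1 as
    well. *)
Lemma holo_zeta_cleared (Z : C -> C) (r : C) :
  (forall s, s <> RtoC 1 -> ex_derive (K := C_AbsRing) (V := C_NormedModule) Z s) ->
  filterlim (fun s => ((s - RtoC 1) * Z s)%C) (locally' (RtoC 1)) (locally r) ->
  forall s, holo (fun s => (s - RtoC 1) * ((s - RtoC 1) * Z s))%C s.
Proof.
  intros HZ Hr s. destruct (Ceq_dec s (RtoC 1)) as [-> |Hs].
  - exists r. intros eps He. destruct (locally'_C_eps _ _ _ Hr eps He) as [d [Hd K]].
    exists d; split; auto. intros h Hh.
    destruct (Ceq_dec h 0) as [-> |Hn].
    + replace ((RtoC 1 + 0 - RtoC 1) * ((RtoC 1 + 0 - RtoC 1) * Z (RtoC 1 + 0)) -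
        (RtoC 1 - RtoC 1) * ((RtoC 1 - RtoC 1) * Z (RtoC 1)) - r * 0)%C with (RtoC 0) by ring.
      rewrite Cmod_0. lra.
    + specialize (K (RtoC 1 + h)%C).
      replace (RtoC 1 + h - RtoC 1)%C with h in * by ring.
      replace (h * (h * Z (RtoC 1 + h)) - (RtoC 1 - RtoC 1) * ((RtoC 1 - RtoC 1) * Z (RtoC 1)) - r * h)%C
        with ((h * Z (RtoC 1 + h) - r) * h)%C by ring.
      rewrite Cmod_mult. apply Rmult_le_compat_r; [apply Cmod_ge_0|].
      left. apply K; auto. intros E. apply Hn.
      replace h with (RtoC 1 + h - RtoC 1)%C by ring. rewrite E; ring.
  - apply holo_mult; [|apply holo_mult].
    + apply holo_minus; [apply holo_id|apply holo_const].
    + apply holo_minus; [apply holo_id|apply holo_const].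
    + apply holo_of_ex_derive; auto.
Qed.

(** The radius attached to each point is chosen below $1/(|f|+1)$, so the uniform lower bound on
    radii delivered by compactness is at the same time an upper bound for [f]. *)
Lemma Ccts_bounded (f : C -> C) (a b c d : R) : (forall z, Ccts f z) ->
  exists A, forall x y, a <= x <= b -> c <= y <= d -> Cmod (f (x, y)) <= A.
Proof.
  intros Hf.
  assert (Hex : forall x y, exists dl : posreal, dl <= / (Cmod (f (x, y)) + 1) /\
    forall u v, Rabs (u - x) < dl -> Rabs (v - y) < dl -> Cmod (f (u, v) - f (x, y))%C < 1).
  { intros x y. destruct (Hf (x, y) 1 Rlt_0_1) as [e [He K]].
    pose proof (Cmod_ge_0 (f (x, y))) as H0.
    assert (Hp : 0 < Rmin (e / 2) (/ (Cmod (f (x, y)) + 1))).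
    { apply Rmin_pos; [lra|apply Rinv_0_lt_compat; lra]. }
    exists (mkposreal _ Hp). simpl. split; [apply Rmin_r|]. intros u v Hu Hv. apply K.
    eapply Rle_lt_trans; [apply Cminus_pair|].
    pose proof (Rmin_l (e / 2) (/ (Cmod (f (x, y)) + 1))). lra. }
  set (delta := fun x y => proj1_sig (constructive_indefinite_description _ (Hex x y))).
  destruct (compactness_value_2d a b c d delta) as [e He].
  exists (/ e + 1). intros x y Hx Hy.
  apply NNPP. intros Hn. apply (He x y Hx Hy). intros (u & v & Hu & Hv & H1 & H2 & H3).
  apply Hn. unfold delta in *.
  destruct (constructive_indefinite_description _ (Hex u v)) as [dl [D1 D2]]. simpl in *.
  specialize (D2 x y H1 H2).
  pose proof (cond_pos e) as Hep. pose proof (Cmod_ge_0 (f (u, v))) as H0.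
  assert (B : Cmod (f (u, v)) + 1 <= / e).
  { rewrite <- (Rinv_inv (Cmod (f (u, v)) + 1)). apply Rinv_le_contravar; lra. }
  pose proof (Cmod_triangle (f (x, y) - f (u, v))%C (f (u, v))) as T.
  replace (f (x, y) - f (u, v) + f (u, v))%C with (f (x, y)) in T by ring. lra.
Qed.

(* A two-constants inequality: the weight [exp (t (u + u^2/2))], [u = (z - w)/R],
   is 1 at the centre and exponentially small on the part [Re u <= 1/4] of the
   boundary of the square. *)
Lemma two_constants (F : C -> C) (w : C) (R0 A eps t : R) : 0 < R0 -> 0 <= A -> 0 <= eps -> 0 <= t ->
  (forall x y, Re w - R0 <= x <= Re w + R0 -> Im w - R0 <= y <= Im w + R0 -> holo F (x, y)) ->
  (forall x y, Re w - R0 <= x <= Re w + R0 -> Im w - R0 <= y <= Im w + R0 -> Cmod (F (x, y)) <= A) ->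
  (forall x y, Re w + R0 / 4 <= x <= Re w + R0 -> Im w - R0 <= y <= Im w + R0 -> Cmod (F (x, y)) <= eps) ->
  Cmod (F w) <= 3 * (A * exp (- (t / 5)) + eps * exp (2 * t)).
Proof.
  intros HR HA He Ht Hol HB Hsm. pose proof PI_RGT_0 as HP.
  assert (HRC : RtoC R0 <> 0) by (intros E; apply RtoC_inj in E; lra).
  set (x0 := Re w) in *. set (y0 := Im w) in *.
  assert (Ew : w = (x0, y0)) by (unfold x0, y0; destruct w; reflexivity).
  set (u := fun z => ((z - w) / RtoC R0)%C).
  set (W := fun z => Cexp (RtoC t * (u z + u z * u z / RtoC 2))%C).
  assert (Hu : forall z, holo u z).
  { intros z. unfold u. apply holo_div; auto; [|apply holo_const].
    apply holo_minus; [apply holo_id|apply holo_const]. }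
  assert (H2C : RtoC 2 <> 0) by (intros E; apply RtoC_inj in E; lra).
  assert (HW : forall z, holo W z).
  { intros z. apply holo_Cexp. apply holo_mult; [apply holo_const|]. apply holo_plus; auto.
    apply holo_div; auto; [|apply holo_const]. apply holo_mult; auto. }
  set (m := A * exp (- (t / 5)) + eps * exp (2 * t)).
  assert (Hm0 : 0 <= A * exp (- (t / 5))) by (apply Rmult_le_pos; auto; left; apply exp_pos).
  assert (Hm1 : 0 <= eps * exp (2 * t)) by (apply Rmult_le_pos; auto; left; apply exp_pos).
  assert (Hz : forall x y, (x, y) <> w -> ((x, y) - w)%C <> 0).
  { intros x y Hn E. apply Hn. apply Ceq_minus. exact E. }
  set (g := fun z => ((F z * W z) / (z - w))%C).
  assert (Hg : forall x y, x0 - R0 <= x <= x0 + R0 -> y0 - R0 <= y <= y0 + R0 -> (x, y) <> w -> holo g (x, y)).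
  { intros x y Hx Hy Hn. unfold g. apply holo_div; auto.
    - apply holo_mult; auto.
    - apply holo_minus; [apply holo_id|apply holo_const]. }
  assert (Hpole : simple_pole g w (F w)).
  { pose proof (simple_pole_quotient (fun z => F z * W z)%C (fun z => z - w)%C w 1) as P.
    cbv beta in P.
    replace (F w * W w / 1)%C with (F w) in P.
    2:{ unfold W, u. replace (RtoC t * ((w - w) / RtoC R0 + (w - w) / RtoC R0 * ((w - w) / RtoC R0) / RtoC 2))%C
          with (RtoC 0) by (field; auto). rewrite Cexp_0. field. }
    apply P.
    - apply holo_cts, holo_mult; auto. rewrite Ew. apply Hol; lra.
    - pose proof (Cderiv_plus _ _ w _ _ (Cderiv_id w) (Cderiv_const (- w)%C w)) as D. cbv beta in D.
      replace (1 + 0)%C with (RtoC 1) in D by ring. exact D.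
    - ring.
    - apply C1_nz. }
  assert (E := rint_residue g x0 y0 (F w) (x0 - R0) (x0 + R0) (y0 - R0) (y0 + R0)).
  rewrite <- Ew in E. specialize (E ltac:(lra) ltac:(lra) Hg Hpole).
  assert (Hne : forall x y, (x = x0 - R0 \/ x = x0 + R0 \/ y = y0 - R0 \/ y = y0 + R0) -> (x, y) <> w).
  { intros x y Hxy E2. rewrite Ew in E2. injection E2; lra. }
  assert (Hb : forall x y, (x = x0 - R0 \/ x = x0 + R0 \/ y = y0 - R0 \/ y = y0 + R0) ->
    x0 - R0 <= x <= x0 + R0 -> y0 - R0 <= y <= y0 + R0 -> Cmod (g (x, y)) <= m / R0).
  { intros x y Hxy Hx Hy. pose proof (Hne x y Hxy) as Hn.
    unfold g. rewrite Cmod_div, Cmod_mult by auto.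
    assert (L : R0 <= Cmod ((x, y) - w)%C).
    { rewrite Ew. apply square_boundary_dist; auto. lra. }
    assert (Hnum : Cmod (F (x, y)) * Cmod (W (x, y)) <= m).
    { set (a := (x - x0) / R0). set (b := (y - y0) / R0).
      assert (Eu : u (x, y) = (a, b)).
      { unfold u. rewrite Ew. unfold a, b. unfold Cdiv. rewrite <- RtoC_inv by lra.
        apply injective_projections; simpl; field; lra. }
      assert (EW : Cmod (W (x, y)) = exp (t * (a + (a * a - b * b) / 2))).
      { unfold W. rewrite Cmod_Cexp, Eu. f_equal. rewrite re_scal_l. f_equal.
        unfold Cdiv. rewrite <- RtoC_inv by lra. simpl. field. }
      assert (Ha : -1 <= a <= 1).
      { unfold a. split; [apply Rle_div_r|apply Rle_div_l]; lra. }
      assert (Hbb : -1 <= b <= 1).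
      { unfold b. split; [apply Rle_div_r|apply Rle_div_l]; lra. }
      rewrite EW. destruct (Rle_lt_dec (x0 + R0 / 4) x) as [Lx|Lx].
      - apply Rle_trans with (eps * exp (2 * t)); [|unfold m; lra].
        apply Rmult_le_compat; [apply Cmod_ge_0|left; apply exp_pos|apply Hsm; lra|].
        apply exp_le. assert (a + (a * a - b * b) / 2 <= 2) by nra. nra.
      - apply Rle_trans with (A * exp (- (t / 5))); [|unfold m; lra].
        apply Rmult_le_compat; [apply Cmod_ge_0|left; apply exp_pos|apply HB; lra|].
        apply exp_le.
        assert (Ha4 : a < 1 / 4).
        { unfold a. apply Rlt_div_l; lra. }
        (* On the left edge [a = -1] gives at most -1/2. On the horizontal edges [b * b = 1] and
           [a < 1 / 4] give at most 1/4 + 1/32 - 1/2 = -7/32, which is below -1/5; the right edge is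
           excluded. *)
        assert (K : a + (a * a - b * b) / 2 <= - (1 / 5)).
        { destruct Hxy as [Q | [Q | Q]].
          - assert (a = -1) by (unfold a; rewrite Q; field; lra). rewrite H. nra.
          - lra.
          - assert (b * b = 1).
            { unfold b. destruct Q as [-> | ->]; field; lra. }
            rewrite H. nra. }
        nra. }
    apply Rmult_le_compat; auto.
    - apply Rmult_le_pos; apply Cmod_ge_0.
    - left; apply Rinv_0_lt_compat; lra.
    - apply Rinv_le_contravar; lra. }
  assert (Hct : cts_boundary g (x0 - R0) (x0 + R0) (y0 - R0) (y0 + R0)).
  { split; intros s Hs; split; apply holo_cts, Hg; try lra; apply Hne; auto. }
  assert (B := rint_bound g (x0 - R0) (x0 + R0) (y0 - R0) (y0 + R0) (m / R0) ltac:(lra) ltac:(lra) Hct).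
  rewrite E in B. rewrite !Cmod_mult, Cmod_Ci, Cmod_R, Rabs_pos_eq in B by lra.
  assert (B' : 2 * PI * 1 * Cmod (F w) <= 4 * (m / R0) * (x0 + R0 - (x0 - R0) + (y0 + R0 - (y0 - R0)))).
  { apply B; intros s Hs; split; apply Hb; auto; lra. }
  replace (4 * (m / R0) * (x0 + R0 - (x0 - R0) + (y0 + R0 - (y0 - R0)))) with (16 * m) in B' by (field; lra).
  (* The residue theorem leaves [2 * PI * Cmod (F w) <= 16 * m], and 16 / 6 is below the announced
     3. *)
  assert (P3 : 3 <= PI) by (pose proof PI2_3_2; lra).
  pose proof (Cmod_ge_0 (F w)). fold m. nra.
Qed.

(** * Complex powers and corrected partial sums of the Dirichlet series *)

Lemma Cmod_Rcpow y s : Cmod (Rcpow y s) = exp (Re s * ln y).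
Proof. unfold Rcpow. rewrite Cmod_Cexp, re_scal_r. reflexivity. Qed.

Lemma Rcpow_succ y s : 0 < y -> Rcpow y (1 + s) = (RtoC y * Rcpow y s)%C.
Proof.
  intros Hy. unfold Rcpow. rewrite Cmult_plus_distr_r, Cexp_plus. f_equal.
  unfold Cexp; simpl.
  replace (1 * ln y - 0 * 0) with (ln y) by ring. replace (1 * 0 + 0 * ln y) with 0 by ring.
  rewrite exp_ln, cos_0, sin_0 by auto. apply injective_projections; simpl; ring.
Qed.

Lemma Rcpow_1 s : Rcpow 1 s = RtoC 1.
Proof.
  unfold Rcpow. rewrite ln_1. replace (s * RtoC 0)%C with (RtoC 0) by ring. apply Cexp_0.
Qed.

Lemma holo_Rcpow y f z : holo f z -> holo (fun s => Rcpow y (f s)) z.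
Proof. intros H. apply holo_Cexp. apply holo_mult; [auto|apply holo_const]. Qed.

Lemma holo_csum (f : nat -> C -> C) n z : (forall k, holo (f k) z) -> holo (fun s => csum (fun k => f k s) n) z.
Proof.
  intros H. induction n as [|n IH]; simpl; [apply holo_const|apply holo_plus; auto].
Qed.

Lemma is_derive_Rcpow u s : 0 < u ->
  is_derive (fun v => fst (Rcpow v s)) u (fst (s * Rcpow u s * RtoC (/ u))%C) /\
  is_derive (fun v => snd (Rcpow v s)) u (snd (s * Rcpow u s * RtoC (/ u))%C).
Proof.
  intros Hu. destruct s as [a b].
  assert (E : forall v, Rcpow v (a, b) = (exp (a * ln v) * cos (b * ln v), exp (a * ln v) * sin (b * ln v))).
  { intros v. unfold Rcpow, Cexp; simpl. replace (a * ln v - b * 0) with (a * ln v) by ring.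
    replace (a * 0 + b * ln v) with (b * ln v) by ring. reflexivity. }
  rewrite E. split; eapply is_derive_ext.
  - intros v. symmetry. rewrite E. reflexivity.
  - simpl. auto_derive; auto. field. lra.
  - intros v. symmetry. rewrite E. reflexivity.
  - simpl. auto_derive; auto. field. lra.
Qed.

(** The mean value theorem applies to each component with its own intermediate point, hence the
    factor 2. *)
Lemma C_mean_value (f f' : R -> C) a b B : a <= b ->
  (forall u, a <= u <= b -> is_derive (fun v => fst (f v)) u (fst (f' u)) /\
     is_derive (fun v => snd (f v)) u (snd (f' u)) /\ Cmod (f' u) <= B) ->
  Cmod (f b - f a)%C <= 2 * B * (b - a).
Proof.
  intros Hab H.
  assert (E : (f b - f a)%C = (fst (f b) - fst (f a), snd (f b) - snd (f a)))
    by (apply injective_projections; simpl; ring).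
  rewrite E. eapply Rle_trans; [apply Cmod_pair|].
  assert (Q1 : Rabs (fst (f b) - fst (f a)) <= B * (b - a)).
  { destruct (MVT_gen (fun v => fst (f v)) a b (fun u => fst (f' u))) as [c [Hc Ec]].
    - intros u Hu. rewrite Rmin_left, Rmax_right in Hu by auto. apply H; lra.
    - intros u Hu. rewrite Rmin_left, Rmax_right in Hu by auto.
      apply continuity_pt_filterlim. apply (ex_derive_continuous (V := R_NormedModule)). exists (fst (f' u)); apply H; lra.
    - rewrite Rmin_left, Rmax_right in Hc by auto. rewrite Ec, Rabs_mult, (Rabs_pos_eq (b - a)) by lra.
      apply Rmult_le_compat_r; [lra|]. eapply Rle_trans; [apply re_le_Cmod|apply H; auto]. }
  assert (Q2 : Rabs (snd (f b) - snd (f a)) <= B * (b - a)).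
  { destruct (MVT_gen (fun v => snd (f v)) a b (fun u => snd (f' u))) as [c [Hc Ec]].
    - intros u Hu. rewrite Rmin_left, Rmax_right in Hu by auto. apply H; lra.
    - intros u Hu. rewrite Rmin_left, Rmax_right in Hu by auto.
      apply continuity_pt_filterlim. apply (ex_derive_continuous (V := R_NormedModule)). exists (snd (f' u)); apply H; lra.
    - rewrite Rmin_left, Rmax_right in Hc by auto. rewrite Ec, Rabs_mult, (Rabs_pos_eq (b - a)) by lra.
      apply Rmult_le_compat_r; [lra|]. eapply Rle_trans; [apply im_le_Cmod|apply H; auto]. }
  lra.
Qed.

(* $(2u)^{-1/4}$, the decay of the terms on the line Re s = 1/4. *)
Definition quarter (u : R) : R := exp (- (1 / 4) * ln (2 * u)).

Lemma quarter_decr u v : 0 < u <= v -> quarter v <= quarter u.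
Proof.
  intros H. unfold quarter. apply exp_le. assert (ln (2 * u) <= ln (2 * v)) by (apply ln_le; lra). lra.
Qed.

(** Write $u^{-s}=2^s(2u)^{-s}$. As [2 * u >= 1], the exponent may be lowered to 1/4 in the second
    factor. The 2 inside [quarter] is there because the roots are only known to exceed 1/2. *)
Lemma Rcpow_quarter u s K : 1 / 2 <= u -> 1 / 4 <= Re s -> Cmod s <= K ->
  Cmod (Rcpow u (- s)) <= exp (K * ln 2) * quarter u.
Proof.
  intros Hu Hs HK. rewrite Cmod_Rcpow, re_opp. unfold quarter. rewrite <- exp_plus. apply exp_le.
  rewrite ln_mult by lra.
  assert (H2 : 0 < ln 2) by (rewrite <- ln_1; apply ln_increasing; lra).
  assert (H3 : 0 <= ln 2 + ln u) by (rewrite <- ln_mult by lra; rewrite <- ln_1; apply ln_le; lra).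
  pose proof (re_le s). nra.
Qed.

(** A term of size $u^{-5/4}$ is bounded by a telescoping difference of $u^{-1/4}$, so sums over [M]
    are bounded without appeal to convergence tests. The constant 24 is generous:
    [2 / n <= 24 / (2 * n + 5)] for [n >= 1]. *)
Lemma quarter_telescope (M : nat) :
  quarter (INR M + 1 / 2) / (INR M + 1 / 2)
    <= 24 * (quarter (INR M + 1 / 2) - quarter (INR (S M) + 1 / 2)).
Proof.
  rewrite S_INR. unfold quarter. pose proof (pos_INR M) as HM.
  set (n := 2 * (INR M + 1 / 2)). assert (Hn : 1 <= n) by (unfold n; lra).
  replace (2 * (INR M + 1 + 1 / 2)) with (n + 2) by (unfold n; ring).
  replace (INR M + 1 / 2) with (n / 2) by (unfold n; lra).
  set (x := 1 / 4 * (ln (n + 2) - ln n)).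
  assert (E : exp (- (1 / 4) * ln (n + 2)) = exp (- (1 / 4) * ln n) * exp (- x)).
  { rewrite <- exp_plus. f_equal. unfold x. ring. }
  rewrite E. set (P := exp (- (1 / 4) * ln n)). assert (HP : 0 < P) by apply exp_pos.
  assert (Hx : 1 / (2 * (n + 2)) <= x).
  { assert (L : ln (n / (n + 2)) <= n / (n + 2) - 1).
    { pose proof (exp_ineq1_le (ln (n / (n + 2)))) as I. rewrite exp_ln in I; [lra|].
      apply Rdiv_lt_0_compat; lra. }
    rewrite ln_div in L by lra. unfold x.
    replace (n / (n + 2) - 1) with (- (2 / (n + 2))) in L by (field; lra).
    replace (1 / (2 * (n + 2))) with (1 / 4 * (2 / (n + 2))) by (field; lra). lra. }
  assert (Hx0 : 0 < 1 / (2 * (n + 2))) by (apply Rdiv_lt_0_compat; lra).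
  assert (He : exp (- x) <= / (1 + x)).
  { rewrite exp_Ropp. apply Rinv_le_contravar; [lra|]. apply exp_ineq1_le. }
  assert (Hy : 1 / (2 * n + 5) <= 1 - / (1 + x)).
  { apply Rle_trans with (1 - / (1 + 1 / (2 * (n + 2)))).
    - right. field. repeat split; lra.
    - assert (/ (1 + x) <= / (1 + 1 / (2 * (n + 2)))) by (apply Rinv_le_contravar; lra). lra. }
  assert (Hz : 2 / n <= 24 * (1 / (2 * n + 5))).
  { apply Rle_div_l; [lra|]. replace (24 * (1 / (2 * n + 5)) * n) with (24 * n / (2 * n + 5)) by (field; lra).
    apply Rle_div_r; lra. }
  replace (P / (n / 2)) with (P * (2 / n)) by (field; lra).
  replace (24 * (P - P * exp (- x))) with (P * (24 * (1 - exp (- x)))) by ring.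
  apply Rmult_le_compat_l; lra.
Qed.

(** The truncated series completed by the tail $\int_{M+1}^\infty u^{-s}\,du=(M+1)^{1-s}/(s-1)$,
    multiplied by [s - 1] so that no pole is left. *)
Definition zB (q : R) (mu : nat -> R) (M : nat) (s : C) : C :=
  ((s - RtoC 1) * csum (fun m => RtoC (koshliakov_weight q (mu m)) * Rcpow (mu m) (- s)) M
   + Rcpow (INR M + 1) (1 + - s))%C.

(** Two errors make up the increment: the weight differs from 1 by $O(y^{-2})$, and $y^{-s}$ stands
    for the integral of $u^{-s}$ over $[M+1,M+2]$, with error $O(|s|\,y^{-\mathrm{Re}\,s-1})$. On Re
    s >= 1/4 both are $O(y^{-5/4})$. *)
Lemma zB_step q mu M s K : 0 < q -> koshliakov_root_seq q mu -> 1 / 4 <= Re s -> Cmod s <= K ->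
  Cmod (zB q mu (S M) s - zB q mu M s)%C
    <= exp (K * ln 2) * (K + 1) * (2 * (q / PI) + 6 * K)
       * (24 * (quarter (INR M + 1 / 2) - quarter (INR (S M) + 1 / 2))).
Proof.
  intros Hq Hmu Hs HK. pose proof PI_RGT_0 as HP.
  pose proof (root_seq_bounds q mu M Hq Hmu) as HB. pose proof (pos_INR M) as HM.
  destruct (weight_bounds q (mu M) Hq) as [W1 W2].
  set (y := mu M) in *. set (v := koshliakov_weight q y) in *.
  set (E := exp (K * ln 2)). assert (HE : 0 < E) by apply exp_pos.
  assert (HqP : 0 < q / PI) by (apply Rdiv_lt_0_compat; lra).
  pose proof (Cmod_ge_0 s) as Hs0.
  assert (Hs1 : Cmod (s - RtoC 1)%C <= K + 1).
  { eapply Rle_trans; [apply Cmod_minus_triangle|]. rewrite Cmod_1. lra. }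
  assert (Hpw : forall u, y <= u -> Cmod (Rcpow u (- s)) <= E * quarter y).
  { intros u Hu. eapply Rle_trans; [apply (Rcpow_quarter u s K); lra|].
    apply Rmult_le_compat_l; [lra|]. apply quarter_decr; lra. }
  assert (Hqy : 0 < quarter y) by apply exp_pos.
  (* The width 3/2 suffices to reach [INR M + 2] from [y], which exceeds [INR M + 1 / 2]; the factor
     3 is that width times the 2 of [C_mean_value]. *)
  assert (D1 : forall u, y <= u <= y + 3 / 2 -> Cmod (Rcpow u (- s) - Rcpow y (- s))%C <= 3 * (K * (E * quarter y) / y)).
  { intros u Hu.
    eapply Rle_trans; [apply (C_mean_value (fun u => Rcpow u (- s)) (fun u => - s * Rcpow u (- s) * RtoC (/ u))%C y u
      (K * (E * quarter y) / y))|].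
    - lra.
    - intros t Ht. destruct (is_derive_Rcpow t (- s)%C) as [I1 I2]; [lra|].
      split; [exact I1|split; [exact I2|]].
      rewrite !Cmod_mult, Cmod_opp, Cmod_R. rewrite Rabs_pos_eq by (left; apply Rinv_0_lt_compat; lra).
      apply Rmult_le_compat; [apply Rmult_le_pos; apply Cmod_ge_0|left; apply Rinv_0_lt_compat; lra| |].
      + apply Rmult_le_compat; try apply Cmod_ge_0; auto. apply Hpw; lra.
      + apply Rinv_le_contravar; lra.
    - assert (0 <= K * (E * quarter y) / y).
      { apply Rmult_le_pos; [apply Rmult_le_pos; [lra|nra]|left; apply Rinv_0_lt_compat; lra]. }
      nra. }
  assert (D2 : Cmod (Rcpow (INR M + 2) (1 + - s) - Rcpow (INR M + 1) (1 + - s) - (1 + - s) * Rcpow y (- s))%C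
     <= 2 * ((K + 1) * (3 * (K * (E * quarter y) / y)))).
  { set (h := fun u => (Rcpow u (1 + - s) - (1 + - s) * Rcpow y (- s) * RtoC u)%C).
    replace (Rcpow (INR M + 2) (1 + - s) - Rcpow (INR M + 1) (1 + - s) - (1 + - s) * Rcpow y (- s))%C
      with (h (INR M + 2)%R - h (INR M + 1)%R)%C.
    2:{ unfold h. replace (RtoC (INR M + 2)) with (RtoC (INR M + 1) + 1)%C.
        2:{ rewrite !RtoC_plus. apply injective_projections; simpl; ring. } ring. }
    eapply Rle_trans; [apply (C_mean_value h (fun u => (1 + - s) * (Rcpow u (- s) - Rcpow y (- s)))%C (INR M + 1) (INR M + 2)
      ((K + 1) * (3 * (K * (E * quarter y) / y))))|].
    - lra.
    - intros u Hu. destruct (is_derive_Rcpow u (1 + - s)%C) as [I1 I2]; [lra|].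
      assert (Ed : ((1 + - s) * Rcpow u (1 + - s) * RtoC (/ u))%C = ((1 + - s) * Rcpow u (- s))%C).
      { rewrite Rcpow_succ by lra. rewrite RtoC_inv by lra. field. intros EE; apply RtoC_inj in EE; lra. }
      rewrite Ed in I1, I2.
      assert (El : forall k : C, is_derive (fun v => fst (k * RtoC v)%C) u (fst k) /\ is_derive (fun v => snd (k * RtoC v)%C) u (snd k)).
      { intros [k1 k2]; simpl; split; auto_derive; auto; ring. }
      destruct (El ((1 + - s) * Rcpow y (- s))%C) as [L1 L2].
      split; [|split].
      + replace (fst ((1 + - s) * (Rcpow u (- s) - Rcpow y (- s)))%C)
          with (fst ((1 + - s) * Rcpow u (- s))%C - fst ((1 + - s) * Rcpow y (- s))%C) by (simpl; ring).
        apply (is_derive_minus (V := R_NormedModule) (fun v => fst (Rcpow v (1 + - s))) _ u _ _ I1 L1).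
      + replace (snd ((1 + - s) * (Rcpow u (- s) - Rcpow y (- s)))%C)
          with (snd ((1 + - s) * Rcpow u (- s))%C - snd ((1 + - s) * Rcpow y (- s))%C) by (simpl; ring).
        apply (is_derive_minus (V := R_NormedModule) (fun v => snd (Rcpow v (1 + - s))) _ u _ _ I2 L2).
      + rewrite Cmod_mult. apply Rmult_le_compat; try apply Cmod_ge_0.
        * rewrite <- Cmod_opp. replace (- (1 + - s))%C with (s - RtoC 1)%C by ring. auto.
        * apply D1. lra.
    - right. ring. }
  (* [1 - v] is at most [q / PI / y ^ 2], weakened to [2 * (q / PI) / y] since [y > 1 / 2]. *)
  assert (D3 : Cmod ((s - RtoC 1) * (RtoC (v - 1) * Rcpow y (- s)))%C <= (K + 1) * (2 * (q / PI) * (E * quarter y) / y)).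
  { rewrite !Cmod_mult, Cmod_R. apply Rmult_le_compat; auto; try apply Cmod_ge_0.
    { apply Rmult_le_pos; [apply Rabs_pos|apply Cmod_ge_0]. }
    rewrite Rabs_left1 by lra.
    replace (2 * (q / PI) * (E * quarter y) / y) with (2 * (q / PI) / y * (E * quarter y)) by (field; lra).
    apply Rmult_le_compat; try apply Cmod_ge_0; [lra| |apply Hpw; lra].
    apply Rle_div_r; [lra|]. nra. }
  assert (EB : (zB q mu (S M) s - zB q mu M s)%C
    = ((s - RtoC 1) * (RtoC (v - 1) * Rcpow y (- s))
       + (Rcpow (INR M + 2) (1 + - s) - Rcpow (INR M + 1) (1 + - s) - (1 + - s) * Rcpow y (- s)))%C).
  { unfold zB. simpl csum. rewrite S_INR. replace (INR M + 1 + 1) with (INR M + 2) by ring.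
    fold y v. rewrite RtoC_minus. ring. }
  rewrite EB. eapply Rle_trans; [apply Cmod_triangle|].
  pose proof (quarter_telescope M) as T.
  assert (Q : quarter y / y <= quarter (INR M + 1 / 2) / (INR M + 1 / 2)).
  { apply Rmult_le_compat; [lra|left; apply Rinv_0_lt_compat; lra|apply quarter_decr; lra|apply Rinv_le_contravar; lra]. }
  apply Rle_trans with (E * (K + 1) * (2 * (q / PI) + 6 * K) * (quarter y / y)).
  - replace (E * (K + 1) * (2 * (q / PI) + 6 * K) * (quarter y / y))
      with ((K + 1) * (2 * (q / PI) * (E * quarter y) / y) + 2 * ((K + 1) * (3 * (K * (E * quarter y) / y))))
      by (field; lra). lra.
  - apply Rmult_le_compat_l; [|lra].
    apply Rmult_le_pos; [apply Rmult_le_pos; lra|lra].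
Qed.

Lemma quarter_half : quarter (INR 0 + 1 / 2) = 1.
Proof.
  unfold quarter. simpl. replace (2 * (0 + 1 / 2)) with 1 by field. rewrite ln_1, Rmult_0_r. apply exp_0.
Qed.

(** The increments telescope from [zB] at [M = 0], which is 1. Uniformity in [M] far to the left of
    the region of convergence of the series provides the large constant of the two-constants
    inequality. *)
Lemma zB_bound q mu K : 0 < q -> koshliakov_root_seq q mu ->
  exists A, forall M s, 1 / 4 <= Re s -> Cmod s <= K -> Cmod (zB q mu M s) <= A.
Proof.
  intros Hq Hmu. set (c := exp (K * ln 2) * (K + 1) * (2 * (q / PI) + 6 * K)).
  exists (1 + Rabs c * 24). intros M s Hs HK.
  assert (G : Cmod (zB q mu M s) <= 1 + Rabs c * (24 * (1 - quarter (INR M + 1 / 2)))).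
  { induction M as [|M IH].
    - rewrite quarter_half. unfold zB; simpl. rewrite Rplus_0_l, Rcpow_1.
      replace ((s - RtoC 1) * 0 + RtoC 1)%C with (RtoC 1) by ring. rewrite Cmod_1. lra.
    - pose proof (zB_step q mu M s K Hq Hmu Hs HK) as St. fold c in St.
      pose proof (Cmod_triangle (zB q mu (S M) s - zB q mu M s)%C (zB q mu M s)) as T.
      replace (zB q mu (S M) s - zB q mu M s + zB q mu M s)%C with (zB q mu (S M) s) in T by ring.
      assert (N : quarter (INR (S M) + 1 / 2) <= quarter (INR M + 1 / 2)).
      { apply quarter_decr. rewrite S_INR. pose proof (pos_INR M). lra. }
      pose proof (Rle_abs c). nra. }
  eapply Rle_trans; [exact G|].
  assert (0 < quarter (INR M + 1 / 2)) by apply exp_pos. pose proof (Rabs_pos c). nra.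
Qed.

(* [(s - 1)^2] times the difference of [Z] and its approximation
   $\sum_{m<M}v_m\mu_m^{-s}+(M+1)^{1-s}/(s-1)$: an entire function of [s]. *)
Definition zH (q : R) (mu : nat -> R) (Z : C -> C) (M : nat) (s : C) : C :=
  ((s - RtoC 1) * ((s - RtoC 1) * Z s) - (s - RtoC 1) * zB q mu M s)%C.

Lemma holo_zH q mu Z M : is_koshliakov_zeta q mu Z -> forall s, holo (zH q mu Z M) s.
Proof.
  intros (_ & HZ & r & _ & Hr) s. unfold zH, zB.
  assert (H1 : forall s, holo (fun s => s - RtoC 1)%C s)
    by (intros; apply holo_minus; [apply holo_id|apply holo_const]).
  assert (H2 : forall s, holo (fun s => - s)%C s) by (intros; apply holo_opp, holo_id).
  apply holo_minus; [eapply holo_zeta_cleared; eauto|].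
  apply holo_mult; auto. apply holo_plus.
  - apply holo_mult; auto.
    apply (holo_csum (fun m s => RtoC (koshliakov_weight q (mu m)) * Rcpow (mu m) (- s))%C).
    intros k. apply holo_mult; [apply holo_const|apply holo_Rcpow; auto].
  - apply holo_Rcpow. apply holo_plus; [apply holo_const|auto].
Qed.

Lemma zH_bound q mu Z K : 0 < q -> koshliakov_root_seq q mu -> is_koshliakov_zeta q mu Z ->
  exists A, 0 <= A /\ forall M s, 1 / 4 <= Re s -> Cmod s <= K -> Cmod (zH q mu Z M s) <= A.
Proof.
  intros Hq Hmu HZ. destruct (zB_bound q mu K Hq Hmu) as [A1 HA1].
  assert (Hh : forall s, holo (fun s => (s - RtoC 1) * ((s - RtoC 1) * Z s))%C s).
  { destruct HZ as (_ & HZ & r & _ & Hr). eapply holo_zeta_cleared; eauto. }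
  destruct (Ccts_bounded _ (- K) K (- K) K (fun z => holo_cts _ z (Hh z))) as [A2 HA2].
  exists (Rabs A2 + (Rabs K + 1) * Rabs A1). split.
  { pose proof (Rabs_pos A2). pose proof (Rabs_pos A1). pose proof (Rabs_pos K). nra. }
  intros M s Hs HK. specialize (HA1 M s Hs HK).
  pose proof (re_le_Cmod s) as R1. pose proof (im_le_Cmod s) as R2.
  apply Rabs_le_between in R1. apply Rabs_le_between in R2.
  specialize (HA2 (Re s) (Im s) ltac:(lra) ltac:(lra)).
  replace (Re s, Im s) with s in HA2 by (destruct s; reflexivity).
  unfold zH. eapply Rle_trans; [apply Cmod_minus_triangle|].
  apply Rplus_le_compat; [pose proof (Rle_abs A2); lra|]. rewrite Cmod_mult.
  apply Rmult_le_compat; try apply Cmod_ge_0.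
  - eapply Rle_trans; [apply Cmod_minus_triangle|]. rewrite Cmod_1. pose proof (Rle_abs K); lra.
  - pose proof (Rle_abs A1); lra.
Qed.

Lemma sum_n_csum (a : nat -> C) n :
  sum_n (G := C_AbelianMonoid) a n = csum a (S n).
Proof.
  induction n as [|n IH].
  - rewrite sum_O. simpl. ring.
  - rewrite sum_Sn, IH. reflexivity.
Qed.

Lemma is_series_C_eps (a : nat -> C) (l : C) :
  is_series (K := C_AbsRing) (V := C_NormedModule) a l ->
  forall eps, 0 < eps -> exists N, forall n, (N <= n)%nat -> Cmod (csum a (S n) - l)%C < eps.
Proof.
  intros H eps He. assert (He2 : 0 < eps / 2) by lra.
  destruct (H (ball l (mkposreal _ He2))) as [N HN].
  { exists (mkposreal _ He2). auto. }
  exists N. intros n Hn. specialize (HN n Hn).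
  assert (HN' : ball (M := C_UniformSpace) l (eps / 2) (csum a (S n)))
    by (rewrite <- sum_n_csum; exact HN).
  destruct HN' as [B1 B2].
  destruct (csum a (S n)) as [x y], l as [x' y']. simpl in *.
  unfold ball in B1, B2; simpl in B1, B2. unfold AbsRing_ball, abs, minus, plus, opp in B1, B2; simpl in B1, B2.
  eapply Rle_lt_trans; [apply (Cmod_pair (x + - x') (y + - y'))|]. lra.
Qed.

Lemma Cmod_csum_diff (a : nat -> C) (M j : nat) : (1 <= M)%nat ->
  (forall m, (1 <= m)%nat -> Cmod (a m) <= / (INR m + 1 / 2) ^ 2) ->
  Cmod (csum a (M + j) - csum a M)%C <= / INR M - / INR (M + j).
Proof.
  intros HM Ha. apply le_INR in HM as HM'. simpl in HM'. induction j as [|j IH].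
  - rewrite Nat.add_0_r. replace (csum a M - csum a M)%C with (RtoC 0) by ring. rewrite Cmod_0. lra.
  - replace (M + S j)%nat with (S (M + j)) by lia. simpl csum. rewrite S_INR.
    replace (csum a (M + j) + a (M + j)%nat - csum a M)%C
      with ((csum a (M + j) - csum a M) + a (M + j)%nat)%C by ring.
    eapply Rle_trans; [apply Cmod_triangle|].
    specialize (Ha (M + j)%nat ltac:(lia)).
    assert (HX : 1 <= INR (M + j)) by (apply (le_INR 1); lia).
    set (X := INR (M + j)) in *.
    (* Because $X(X+1)\le(X+\frac12)^2$, each term is dominated by a telescoping one. *)
    assert (/ (X + 1 / 2) ^ 2 <= / X - / (X + 1)).
    { replace (/ X - / (X + 1)) with (/ (X * (X + 1))) by (field; lra).
      apply Rinv_le_contravar; nra. }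
    lra.
Qed.

(** On Re s >= 2 the series itself is available: its tail and $(M+1)^{1-s}$ are both at most
    [/ INR M], and the factors [s - 1] are bounded for [Cmod s <= K]. *)
Lemma zH_far q mu Z K eps : 0 < q -> koshliakov_root_seq q mu -> is_koshliakov_zeta q mu Z -> 0 < eps ->
  exists M0, forall M s, (M0 <= M)%nat -> 2 <= Re s -> Cmod s <= K -> Cmod (zH q mu Z M s) <= eps.
Proof.
  intros Hq Hmu HZ He.
  set (k := (Rabs K + 1) * (Rabs K + 1) + (Rabs K + 1)).
  assert (Hk : 0 < k) by (unfold k; pose proof (Rabs_pos K); nra).
  destruct (nfloor_ex (k / eps)) as [N HN]; [apply Rlt_le, Rdiv_lt_0_compat; auto|].
  exists (S N). intros M s HM Hs HK.
  assert (HM1 : INR N + 1 <= INR M) by (rewrite <- S_INR; apply le_INR; auto).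
  pose proof (pos_INR N) as HN0.
  set (a := fun m => (RtoC (koshliakov_weight q (mu m)) * Rcpow (mu m) (- s))%C).
  assert (Ha : forall m, (1 <= m)%nat -> Cmod (a m) <= / (INR m + 1 / 2) ^ 2).
  { intros m Hm. apply le_INR in Hm. simpl in Hm. unfold a. rewrite Cmod_mult, Cmod_R, Cmod_Rcpow, re_opp.
    pose proof (root_seq_bounds q mu m Hq Hmu) as B. destruct (weight_bounds q (mu m) Hq) as [W _].
    rewrite Rabs_pos_eq by lra.
    assert (Hl : 0 <= ln (mu m)) by (rewrite <- ln_1; apply ln_le; lra).
    apply Rle_trans with (1 * / (mu m) ^ 2).
    - apply Rmult_le_compat; [lra|left; apply exp_pos|lra|].
      rewrite <- (exp_ln (mu m)) at 2 by lra.
      replace (exp (ln (mu m)) ^ 2) with (exp (2 * ln (mu m)))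
        by (replace (2 * ln (mu m)) with (ln (mu m) + ln (mu m)) by ring; rewrite exp_plus; ring).
      rewrite <- exp_Ropp. apply exp_le. nra.
    - rewrite Rmult_1_l. apply Rinv_le_contravar; [|nra]. apply pow_lt; lra. }
  assert (Hs1 : Cmod (s - RtoC 1)%C <= Rabs K + 1).
  { eapply Rle_trans; [apply Cmod_minus_triangle|]. rewrite Cmod_1. pose proof (Rle_abs K). lra. }
  assert (HT : Cmod (Z s - csum a M)%C <= / INR M).
  { apply le_epsilon. intros e' He'.
    destruct HZ as [HZ _]. specialize (HZ s ltac:(lra)).
    destruct (is_series_C_eps _ _ HZ e' He') as [N' HN'].
    specialize (HN' (M + N')%nat ltac:(lia)). fold a in HN'.
    pose proof (Cmod_csum_diff a M (S N') ltac:(lia) Ha) as D.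
    replace (M + S N')%nat with (S (M + N')) in D by lia.
    pose proof (Cmod_minus_triangle (csum a (S (M + N')) - csum a M)%C (csum a (S (M + N')) - Z s)%C) as T.
    replace (csum a (S (M + N')) - csum a M - (csum a (S (M + N')) - Z s))%C with (Z s - csum a M)%C in T by ring.
    assert (0 < / INR (S (M + N'))) by (apply Rinv_0_lt_compat, lt_0_INR; lia). lra. }
  assert (HR : Cmod (Rcpow (INR M + 1) (1 + - s)) <= / INR M).
  { rewrite Cmod_Rcpow, re_plus, re_opp. simpl.
    assert (Hl : 0 <= ln (INR M + 1)) by (rewrite <- ln_1; apply ln_le; lra).
    apply Rle_trans with (exp (- ln (INR M + 1))).
    - apply exp_le. nra.
    - rewrite exp_Ropp, exp_ln by lra. apply Rinv_le_contravar; lra. }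
  assert (E : zH q mu Z M s = ((s - RtoC 1) * (s - RtoC 1) * (Z s - csum a M)
     - (s - RtoC 1) * Rcpow (INR M + 1) (1 + - s))%C).
  { unfold zH, zB. fold a. ring. }
  rewrite E. eapply Rle_trans; [apply Cmod_minus_triangle|]. rewrite !Cmod_mult.
  assert (HM0 : 0 < / INR M) by (apply Rinv_0_lt_compat; lra).
  apply Rle_trans with (k * / INR M).
  - unfold k. rewrite Rmult_plus_distr_r. pose proof (Cmod_ge_0 (s - RtoC 1)%C).
    apply Rplus_le_compat; apply Rmult_le_compat; auto; try apply Cmod_ge_0.
    + apply Rmult_le_pos; auto.
    + apply Rmult_le_compat; auto.
  - apply Rle_div_l; [lra|].
    assert (k / eps < INR M) by lra. apply Rlt_div_l in H; auto. lra.
Qed.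

(** Uniformity on a truncated half-plane, stronger than pointwise convergence: the next application
    of [two_constants] asks for smallness on part of a square. *)
Definition zH_vanishes q mu Z (b : R) : Prop :=
  forall K eps, 0 < eps -> exists M0, forall M s, (M0 <= M)%nat -> b <= Re s -> Cmod s <= K ->
    Cmod (zH q mu Z M s) <= eps.

(** With half-side [R0 = 4/5 * b] a square centred at Re s >= 1/4 + R0 stays in Re >= 1/4, where
    [zH] is bounded, and its part beyond [Re s + R0 / 4] lies in Re >= 1/4 + 5/4 * R0 = 1/4 + b,
    where [zH] is already small. *)
Lemma zH_vanishes_step q mu Z b : 0 < q -> koshliakov_root_seq q mu -> is_koshliakov_zeta q mu Z ->
  0 < b -> zH_vanishes q mu Z (1 / 4 + b) -> zH_vanishes q mu Z (1 / 4 + 4 / 5 * b).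
Proof.
  intros Hq Hmu HZ Hb HV K eps He.
  set (R0 := 4 / 5 * b). assert (HR : 0 < R0) by (unfold R0; lra).
  destruct (zH_bound q mu Z (K + 2 * R0) Hq Hmu HZ) as [A [HA0 HA]].
  (* Since [exp (t / 5) >= 1 + 6 * A / eps], the term with [A] is at most [eps / 2]; only then is
     [e'] chosen, so that the growth [exp (2 * t)] is absorbed. *)
  set (t := 30 * A / eps).
  assert (Ht : 0 <= t) by (unfold t; apply Rmult_le_pos; [lra|left; apply Rinv_0_lt_compat; auto]).
  set (e' := eps / (6 * exp (2 * t))).
  assert (He' : 0 < e') by (unfold e'; apply Rdiv_lt_0_compat; auto; pose proof (exp_pos (2 * t)); lra).
  destruct (HV (K + 2 * R0) e' He') as [M0 HM0].
  exists M0. intros M s HM Hs HK.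
  assert (Hc : forall x y, Re s - R0 <= x <= Re s + R0 -> Im s - R0 <= y <= Im s + R0 ->
    Cmod (x, y) <= K + 2 * R0).
  { intros x y Hx Hy. pose proof (Cmod_triangle ((x, y) - s)%C s) as T.
    replace ((x, y) - s + s)%C with ((x, y) : C) in T by (apply injective_projections; simpl; ring).
    assert (D : Cmod ((x, y) - s)%C <= 2 * R0).
    { replace s with ((Re s, Im s) : C) by (destruct s; reflexivity).
      eapply Rle_trans; [apply Cminus_pair|].
      assert (Rabs (x - Re s) <= R0) by (apply Rabs_le; lra).
      assert (Rabs (y - Im s) <= R0) by (apply Rabs_le; lra). simpl in *. lra. }
    lra. }
  eapply Rle_trans; [apply (two_constants (zH q mu Z M) s R0 A e' t); auto; try lra|].
  - intros; apply holo_zH; auto.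
  - intros x y Hx Hy. apply HA; auto. simpl. unfold R0 in *. lra.
  - intros x y Hx Hy. apply HM0; auto; [|apply Hc; lra]. simpl. unfold R0 in *. lra.
  - assert (E1 : 3 * (e' * exp (2 * t)) = eps / 2).
    { unfold e'. field. apply Rgt_not_eq, exp_pos. }
    assert (E2 : 3 * (A * exp (- (t / 5))) <= eps / 2).
    { rewrite exp_Ropp. pose proof (exp_ineq1_le (t / 5)) as I.
      assert (I2 : 0 < 1 + t / 5) by lra.
      apply Rle_trans with (3 * A / (1 + t / 5)).
      - unfold Rdiv at 1. rewrite <- Rmult_assoc. apply Rmult_le_compat_l; [lra|]. apply Rinv_le_contravar; lra.
      - apply Rle_div_l; auto. unfold t.
        replace (eps / 2 * (1 + 30 * A / eps / 5)) with (eps / 2 + 3 * A) by (field; lra). lra. }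
    lra.
Qed.

Lemma zH_vanishes_half q mu Z : 0 < q -> koshliakov_root_seq q mu -> is_koshliakov_zeta q mu Z ->
  zH_vanishes q mu Z (1 / 2).
Proof.
  intros Hq Hmu HZ.
  assert (G : forall n, zH_vanishes q mu Z (1 / 4 + 7 / 4 * (4 / 5) ^ n)).
  { induction n as [|n IH].
    - simpl. replace (1 / 4 + 7 / 4 * 1) with 2 by field. intros K eps He. apply zH_far; auto.
    - replace (7 / 4 * (4 / 5) ^ S n) with (4 / 5 * (7 / 4 * (4 / 5) ^ n)) by (simpl; ring).
      apply zH_vanishes_step; auto. assert (0 < (4 / 5) ^ n) by (apply pow_lt; lra). lra. }
  (* Nine steps suffice: 7/4 * (4/5)^9 is about 0.235, below 1/4. *)
  intros K eps He. destruct (G 9%nat K eps He) as [M0 H]. exists M0. intros M s HM Hs HK.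
  apply H; auto. eapply Rle_trans; [|exact Hs]. simpl. lra.
Qed.

Lemma ex_series_bounded (a : nat -> R) B : (forall n, 0 <= a n) -> (forall n, sum_n a n <= B) -> ex_series a.
Proof.
  intros Ha HB. destruct (ex_finite_lim_seq_incr (sum_n a) B) as [l Hl]; auto.
  - intros n. rewrite sum_Sn. unfold plus; simpl. specialize (Ha (S n)). lra.
  - exists l. exact Hl.
Qed.

Lemma Rcpow_half y : 0 < y -> Rcpow y (RtoC (1 / 2)) = RtoC (sqrt y).
Proof.
  intros Hy. rewrite <- Rpower_sqrt by auto. unfold Rcpow, Cexp, Rpower; simpl.
  replace (1 / 2 * 0 + 0 * ln y) with 0 by ring. rewrite cos_0, sin_0.
  replace (1 / 2 * ln y - 0 * 0) with (/ 2 * ln y) by field.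
  apply injective_projections; simpl; ring.
Qed.

Lemma Rcpow_opp_half y : 0 < y -> Rcpow y (- RtoC (1 / 2)) = RtoC (1 / sqrt y).
Proof.
  intros Hy.
  replace (Rcpow y (- RtoC (1 / 2))) with (/ Rcpow y (RtoC (1 / 2)))%C.
  - rewrite Rcpow_half by auto. rewrite <- RtoC_inv by (apply Rgt_not_eq, sqrt_lt_R0; auto).
    f_equal. field. apply Rgt_not_eq, sqrt_lt_R0; auto.
  - unfold Rcpow. rewrite <- Cexp_opp. f_equal. ring.
Qed.

(* Terms of the regularised series for $\zeta_q(1/2)$. *)
Definition half_term (q : R) (mu : nat -> R) (m : nat) : R :=
  koshliakov_weight q (mu m) * (1 / sqrt (mu m)) - 2 * (sqrt (INR m + 2) - sqrt (INR m + 1)).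

Lemma zB_half q mu M : 0 < q -> koshliakov_root_seq q mu ->
  zB q mu (S M) (RtoC (1 / 2)) = RtoC (1 - 1 / 2 * sum_n (half_term q mu) M).
Proof.
  intros Hq Hmu.
  assert (G : forall M, zB q mu (S M) (RtoC (1 / 2))
    = (zB q mu M (RtoC (1 / 2)) - RtoC (1 / 2 * half_term q mu M))%C).
  { intros m. unfold zB. simpl csum. rewrite S_INR.
    pose proof (root_seq_bounds q mu m Hq Hmu). pose proof (pos_INR m).
    rewrite Rcpow_opp_half by lra.
    replace (1 + - RtoC (1 / 2))%C with (RtoC (1 / 2)) by (apply injective_projections; simpl; field).
    rewrite !Rcpow_half by lra. unfold half_term. replace (INR m + 1 + 1) with (INR m + 2) by ring.
    apply injective_projections; simpl; field; apply Rgt_not_eq, sqrt_lt_R0; lra. }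
  induction M as [|M IH].
  - rewrite G, sum_O. unfold zB. simpl. rewrite Rplus_0_l, Rcpow_1.
    apply injective_projections; simpl; ring.
  - rewrite G, IH, sum_Sn. unfold plus; simpl. apply injective_projections; simpl; ring.
Qed.

(** The square roots subtracted in [half_term] telescope to [2 * sqrt (M + 2) - 2], which accounts
    for the [+ 2]. The value is real as a limit of real sums. Absolute convergence is recorded
    because it dominates the same series multiplied by the cut-off. *)
Theorem zeta_half q mu Z : 0 < q -> koshliakov_root_seq q mu -> is_koshliakov_zeta q mu Z ->
  ex_series (fun m => Rabs (half_term q mu m)) /\
  exists z, Z (RtoC (1 / 2)) = RtoC z /\ is_series (half_term q mu) (z + 2).
Proof.
  intros Hq Hmu HZ. split.
  - set (c := exp (1 * ln 2) * (1 + 1) * (2 * (q / PI) + 6 * 1)).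
    set (g := fun m : nat => quarter (INR m + 1 / 2)).
    assert (Hs : forall m, Rabs (half_term q mu m) <= 2 * (Rabs c * (24 * (g m - g (S m))))).
    { intros m.
      assert (St : Cmod (zB q mu (S m) (RtoC (1 / 2)) - zB q mu m (RtoC (1 / 2)))%C <= c * (24 * (g m - g (S m)))).
      { apply zB_step; auto; simpl; [lra|]. rewrite Cmod_R, Rabs_pos_eq; lra. }
      assert (E : (zB q mu (S m) (RtoC (1 / 2)) - zB q mu m (RtoC (1 / 2)))%C = RtoC (- (1 / 2) * half_term q mu m)).
      { rewrite zB_half by auto. destruct m as [|m].
        - rewrite sum_O. unfold zB at 1. simpl. rewrite Rplus_0_l, Rcpow_1.
          apply injective_projections; simpl; ring.
        - rewrite zB_half, sum_Sn by auto. unfold plus; simpl. apply injective_projections; simpl; ring. }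
      rewrite E, Cmod_R, Rabs_mult in St. rewrite Rabs_left in St by lra.
      assert (N : g (S m) <= g m).
      { apply quarter_decr. rewrite S_INR. pose proof (pos_INR m). lra. }
      pose proof (Rle_abs c). nra. }
    apply (ex_series_bounded _ (2 * (Rabs c * 24))); [intros; apply Rabs_pos|].
    assert (G : forall n, sum_n (fun m => Rabs (half_term q mu m)) n <= 2 * (Rabs c * (24 * (1 - g (S n))))).
    { assert (g0 : g 0%nat = 1) by apply quarter_half.
      induction n as [|n IH].
      - rewrite sum_O. specialize (Hs 0%nat). rewrite g0 in Hs. lra.
      - rewrite sum_Sn. unfold plus; simpl. specialize (Hs (S n)). lra. }
    intros n. eapply Rle_trans; [apply G|].
    assert (0 < g (S n)) by apply exp_pos. pose proof (Rabs_pos c). nra.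
  - set (Zh := Z (RtoC (1 / 2))).
    assert (HV := zH_vanishes_half q mu Z Hq Hmu HZ 1).
    assert (HL : forall eps, 0 < eps -> exists N, forall n, (N <= n)%nat ->
       Cmod (RtoC (sum_n (half_term q mu) n) - (Zh + RtoC 2))%C < eps).
    { intros eps He. destruct (HV (eps / 5) ltac:(lra)) as [N HN]. exists N. intros n Hn.
      specialize (HN (S n) (RtoC (1 / 2)) ltac:(lia)). simpl Re in HN.
      specialize (HN ltac:(lra)). rewrite Cmod_R, Rabs_pos_eq in HN by lra. specialize (HN ltac:(lra)).
      unfold zH in HN. rewrite zB_half in HN by auto. fold Zh in HN.
      (* At s = 1/2 the factor [(s - 1) ^ 2] is 1/4, so the error in the partial sum is -4 times
         [zH]; this is why [eps / 5] was requested. *)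
      replace (RtoC (sum_n (half_term q mu) n) - (Zh + RtoC 2))%C
        with (RtoC (-4) * ((RtoC (1 / 2) - RtoC 1) * ((RtoC (1 / 2) - RtoC 1) * Zh)
         - (RtoC (1 / 2) - RtoC 1) * RtoC (1 - 1 / 2 * sum_n (half_term q mu) n)))%C
        by (destruct Zh; apply injective_projections; simpl; field).
      rewrite Cmod_mult, Cmod_R, Rabs_left by lra. lra. }
    exists (Re Zh). split.
    + apply injective_projections; [reflexivity|]. simpl.
      change (Im Zh = 0). apply Rabs_eq_0. apply Rle_antisym; [|apply Rabs_pos].
      apply le_epsilon. intros eps He. destruct (HL eps He) as [N HN]. specialize (HN N ltac:(lia)).
      pose proof (im_le_Cmod (RtoC (sum_n (half_term q mu) N) - (Zh + RtoC 2))%C) as I.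
      assert (E : Im (RtoC (sum_n (half_term q mu) N) - (Zh + RtoC 2))%C = - Im Zh) by (destruct Zh; simpl; ring).
      rewrite E, Rabs_Ropp in I. lra.
    + apply is_lim_seq_Reals. intros eps He. destruct (HL eps He) as [N HN]. exists N. intros n Hn.
      specialize (HN n Hn). unfold R_dist.
      pose proof (re_le_Cmod (RtoC (sum_n (half_term q mu) n) - (Zh + RtoC 2))%C) as I.
      assert (E : Re (RtoC (sum_n (half_term q mu) n) - (Zh + RtoC 2))%C = sum_n (half_term q mu) n - (Re Zh + 2))
        by (destruct Zh; simpl; ring).
      rewrite E in I. eapply Rle_lt_trans; [exact I|exact HN].
Qed.

(** * Traces in closed form *)

Lemma Series_tail_small (g : nat -> R) eps : ex_series g -> 0 < eps ->
  exists N, Rabs (Series (fun k => g (S N + k)%nat)) < eps.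
Proof.
  intros Hg He. pose proof (Series_correct g Hg) as L.
  assert (L' : is_lim_seq (sum_n g) (Series g)) by exact L.
  apply is_lim_seq_Reals in L'. destruct (L' eps He) as [N HN]. exists N.
  specialize (HN N ltac:(lia)). unfold R_dist in HN.
  rewrite (Series_incr_n g (S N)) in HN by (auto; lia). simpl pred in HN.
  rewrite <- sum_n_Reals in HN.
  match type of HN with Rabs (?a - (?a + ?b)) < _ => replace (a - (a + b)) with (- b) in HN by ring end.
  rewrite Rabs_Ropp in HN. exact HN.
Qed.

(** Dominated convergence for series. It serves to let [t] tend to 0, to remove the cut-off, and,
    applied to partial sums, to exchange two summations. *)
Lemma tannery (a : nat -> nat -> R) (l g : nat -> R) : ex_series g ->
  (forall j n, Rabs (a j n) <= g n) -> (forall n, is_lim_seq (fun j => a j n) (l n)) ->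
  ex_series l /\ is_lim_seq (fun j => Series (a j)) (Series l).
Proof.
  intros Hg Ha Hl.
  assert (Hlg : forall n, Rabs (l n) <= g n).
  { intros n. apply (is_lim_seq_le (fun j => Rabs (a j n)) (fun _ => g n) (Rabs (l n)) (g n)); auto.
    - apply (is_lim_seq_abs (fun j => a j n) (l n)); auto.
    - apply is_lim_seq_const. }
  assert (El : ex_series l) by (apply (ex_series_le (V := R_CompleteNormedModule) l g); auto).
  assert (Ea : forall j, ex_series (a j)) by (intros j; apply (ex_series_le (V := R_CompleteNormedModule) (a j) g); auto).
  split; auto.
  apply is_lim_seq_Reals. intros eps He.
  destruct (Series_tail_small g (eps / 4) Hg) as [N HN]; [lra|].
  assert (Hfin : is_lim_seq (fun j => sum_n (fun n => a j n - l n) N) 0).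
  { assert (G : forall M, is_lim_seq (fun j => sum_n (fun n => a j n - l n) M) 0).
    { induction M as [|M IH].
      - apply is_lim_seq_ext with (fun j => a j 0%nat - l 0%nat); [intros; rewrite sum_O; auto|].
        replace 0 with (l 0%nat - l 0%nat) by ring.
        apply is_lim_seq_minus'; auto. apply is_lim_seq_const.
      - apply is_lim_seq_ext with (fun j => sum_n (fun n => a j n - l n) M + (a j (S M) - l (S M))).
        { intros; rewrite sum_Sn; auto. }
        replace 0 with (0 + (l (S M) - l (S M))) by ring.
        apply is_lim_seq_plus'; auto. apply is_lim_seq_minus'; auto. apply is_lim_seq_const. }
    apply G. }
  apply is_lim_seq_Reals in Hfin. destruct (Hfin (eps / 4)) as [J HJ]; [lra|].
  exists J. intros j Hj. specialize (HJ j Hj). unfold R_dist in *. rewrite Rminus_0_r in HJ.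
  rewrite <- Series_minus by auto.
  assert (Ed : ex_series (fun n => a j n - l n)) by (apply (ex_series_minus (V := R_NormedModule) (a j) l); auto).
  rewrite (Series_incr_n _ (S N)) by (auto; lia). simpl pred. rewrite <- sum_n_Reals.
  eapply Rle_lt_trans; [apply Rabs_triang|].
  assert (Etail : forall f : nat -> R, ex_series f -> ex_series (fun k => f (S N + k)%nat)).
  { intros f Hf. apply (proj1 (ex_series_incr_n f (S N))). auto. }
  assert (T : Rabs (Series (fun k => a j (S N + k)%nat - l (S N + k)%nat)) <= 2 * (eps / 4)).
  { assert (Edb : ex_series (fun k => 2 * g (S N + k)%nat)).
    { apply (ex_series_scal (V := R_NormedModule) 2 (fun k => g (S N + k)%nat)). apply Etail; auto. }
    assert (Hb : forall k, 0 <= Rabs (a j (S N + k)%nat - l (S N + k)%nat) <= 2 * g (S N + k)%nat).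
    { intros k. split; [apply Rabs_pos|]. unfold Rminus. eapply Rle_trans; [apply Rabs_triang|].
      rewrite Rabs_Ropp. pose proof (Ha j (S N + k)%nat). pose proof (Hlg (S N + k)%nat). lra. }
    assert (Eab : ex_series (fun k => Rabs (a j (S N + k)%nat - l (S N + k)%nat))).
    { apply (ex_series_le (V := R_CompleteNormedModule) _ (fun k => 2 * g (S N + k)%nat)); auto.
      intros k. unfold norm; simpl. unfold abs; simpl. rewrite Rabs_Rabsolu. apply Hb. }
    eapply Rle_trans; [apply Series_Rabs; auto|].
    eapply Rle_trans; [apply (Series_le _ (fun k => 2 * g (S N + k)%nat)); auto|].
    rewrite Series_scal_l. pose proof (Rle_abs (Series (fun k => g (S N + k)%nat))). lra. }
  lra.
Qed.

(* The kernel at [2 * PI * t], without the removable singularity at [t = q]. *)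
Definition kk (q t : R) : R := (q - t) / ((q + t) * exp (2 * PI * t) - (q - t)).

(* $c_q=1/(1+\frac1{\pi q})$, the residue of the kernel at 0. *)
Definition kc (q : R) : R := PI * q / (1 + PI * q).

Lemma exp_2PI_bounds t : 0 < t -> t <= exp (2 * PI * t) - 1 /\ t ^ 2 <= exp (2 * PI * t) - 1.
Proof.
  intros Ht. pose proof PI2_3_2 as HP.
  assert (E : exp (2 * PI * t) = exp (PI * t) * exp (PI * t)) by (rewrite <- exp_plus; f_equal; ring).
  pose proof (exp_ineq1_le (PI * t)) as I. assert (t <= PI * t) by nra.
  split; rewrite E; nra.
Qed.

Lemma kk_den_pos q t : 0 < q -> 0 < t ->
  (q + t) * (exp (2 * PI * t) - 1) <= (q + t) * exp (2 * PI * t) - (q - t)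
  /\ 0 < (q + t) * (exp (2 * PI * t) - 1).
Proof.
  intros Hq Ht. destruct (exp_2PI_bounds t Ht). split; nra.
Qed.

Lemma kk_bound q t m : 0 < q -> 0 < t -> 0 < m -> m <= exp (2 * PI * t) - 1 -> Rabs (kk q t) <= / m.
Proof.
  intros Hq Ht Hm H. destruct (kk_den_pos q t Hq Ht) as [D1 D2]. unfold kk.
  set (D := (q + t) * exp (2 * PI * t) - (q - t)) in *.
  unfold Rdiv. rewrite Rabs_mult, (Rabs_pos_eq (/ D)) by (left; apply Rinv_0_lt_compat; lra).
  assert (Hn : Rabs (q - t) <= q + t) by (apply Rabs_le; lra).
  apply Rle_div_l; [lra|]. apply Rle_trans with (q + t); auto.
  apply (Rmult_le_reg_l m); auto. rewrite <- Rmult_assoc, Rinv_r, Rmult_1_l by lra. nra.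
Qed.

Lemma kk_le_inv q t : 0 < q -> 0 < t -> Rabs (kk q t) <= / t.
Proof. intros Hq Ht. destruct (exp_2PI_bounds t Ht). apply kk_bound; auto. Qed.

Lemma kk_le_inv_sq q t : 0 < q -> 0 < t -> Rabs (kk q t) <= / t ^ 2.
Proof. intros Hq Ht. destruct (exp_2PI_bounds t Ht). apply kk_bound; auto. apply pow_lt; auto. Qed.

Lemma kernel_kk q t : 0 < q -> 0 < t -> koshliakov_kernel q (2 * PI * t) = kk q t.
Proof.
  intros Hq Ht. pose proof PI_RGT_0 as HP. unfold koshliakov_kernel, koshliakov_sigma.
  replace (2 * PI * t / (2 * PI)) with t by (field; lra).
  destruct (kk_den_pos q t Hq Ht) as [D1 D2]. unfold kk.
  destruct (Req_EM_T t q) as [-> |Hn].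
  - unfold Rdiv. rewrite Rminus_diag, Rmult_0_l. auto.
  - field. repeat split; lra.
Qed.

Lemma trace_real q mu t : 0 < q -> koshliakov_root_seq q mu -> 0 < t ->
  is_series (fun n => koshliakov_weight q (mu n) * / (mu n ^ 2 + t ^ 2))
    (PI / t * (kk q t + 1 / 2) - kc q / (2 * t ^ 2)).
Proof.
  intros Hq Hmu Ht. pose proof PI_RGT_0 as HP.
  pose proof (koshliakov_trace_series q mu (RtoC t) Hq Hmu Ht) as S.
  destruct (kk_den_pos q t Hq Ht) as [D1 D2].
  assert (HqP : 0 < 1 + PI * q) by nra.
  replace (Re (koshliakov_trace q (RtoC t))) with (PI / t * (kk q t + 1 / 2) - kc q / (2 * t ^ 2)) in S.
  - eapply is_series_ext; [|exact S]. intros n. cbv beta. f_equal.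
    assert (H : 0 < mu n ^ 2 + t ^ 2) by (pose proof (pow2_ge_0 (mu n)); nra).
    replace (RtoC (mu n ^ 2) + RtoC t * RtoC t)%C with (RtoC (mu n ^ 2 + t ^ 2))
      by (apply injective_projections; simpl; ring).
    rewrite <- RtoC_inv by lra. rewrite re_RtoC. reflexivity.
  - set (e := exp (PI * t)).
    assert (He : 0 < e) by apply exp_pos.
    assert (E2 : exp (2 * PI * t) = e * e) by (unfold e; rewrite <- exp_plus; f_equal; ring).
    assert (Ei : exp (- (PI * t)) = / e) by (unfold e; apply exp_Ropp).
    assert (Ep : Cexp (RtoC PI * RtoC t) = RtoC e).
    { unfold Cexp; simpl. replace (PI * 0 + 0 * t) with 0 by ring. replace (PI * t - 0 * 0) with (PI * t) by ring.
      rewrite cos_0, sin_0. apply injective_projections; simpl; fold e; ring. }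
    assert (Em : Cexp (- (RtoC PI * RtoC t)) = RtoC (/ e)).
    { rewrite Cexp_opp, Ep, RtoC_inv by lra. auto. }
    unfold koshliakov_trace, kN, kD. rewrite Ep, Em. rewrite E2 in *.
    assert (Hd : (q + t) * e - (q - t) * / e <> 0).
    { replace ((q + t) * e - (q - t) * / e) with (((q + t) * (e * e) - (q - t)) / e) by (field; lra).
      apply Rgt_not_eq, Rdiv_lt_0_compat; lra. }
    assert (Ed : ((RtoC q + RtoC t) * RtoC e - (RtoC q - RtoC t) * RtoC (/ e))%C = RtoC ((q + t) * e - (q - t) * / e))
      by (apply injective_projections; simpl; ring).
    assert (En : ((RtoC q + RtoC t) * RtoC e + (RtoC q - RtoC t) * RtoC (/ e))%C = RtoC ((q + t) * e + (q - t) * / e))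
      by (apply injective_projections; simpl; ring).
    rewrite Ed, En. rewrite <- RtoC_div by auto. rewrite <- RtoC_div by lra.
    rewrite <- !RtoC_mult. rewrite <- RtoC_div by nra. rewrite <- RtoC_minus, re_RtoC.
    unfold kk, kc. rewrite E2. field. repeat split; try lra; try nra.
Qed.

(** Take $w=(1+i)\sqrt{a/2}$, so that $w^2=ia$. The term with $c_q/w^2$ is purely imaginary and
    drops out of the real part; [b = sqrt (2 * a)] is twice the real part of [w]. *)
Lemma trace_diag q mu a : 0 < q -> koshliakov_root_seq q mu -> 0 < a ->
  is_series (fun n => koshliakov_weight q (mu n) * (mu n ^ 2 / (mu n ^ 4 + a ^ 2)))
    (PI / (2 * sqrt (2 * a)) * (1 + koshliakov_G q a)).
Proof.
  intros Hq Hmu Ha. pose proof PI_RGT_0 as HP.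
  set (b := sqrt (2 * a)). assert (Hb : 0 < b) by (apply sqrt_lt_R0; lra).
  assert (Hb2 : b * b = 2 * a) by (apply sqrt_sqrt; lra).
  assert (Ea : a = b * b / 2) by lra.
  set (w := (b / 2, b / 2) : C).
  assert (Hw : 0 < Re w) by (simpl; lra).
  pose proof (koshliakov_trace_series q mu w Hq Hmu Hw) as S.
  assert (Eww : (w * w)%C = (0, a)) by (unfold w; apply injective_projections; simpl; lra).
  rewrite Eww in S.
  replace (Re (koshliakov_trace q w)) with (PI / (2 * b) * (1 + koshliakov_G q a)) in S.
  - eapply is_series_ext; [|exact S]. intros n. cbv beta. f_equal.
    set (u := mu n ^ 2). replace (mu n ^ 4) with (u ^ 2) by (unfold u; ring).
    unfold Re, Cinv, Cplus; simpl. f_equal; ring.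
  - pose proof (kD_nz_right q w Hq Hw) as HD. pose proof (C_nz_Re w Hw) as Hw0.
    set (E := exp (PI * b)). set (c := cos (PI * b)). set (s := sin (PI * b)).
    assert (HE : 0 < E) by apply exp_pos.
    (* Multiplying [kD] by [Cexp (PI * w)] leaves only the exponential of [2 * PI * w], of modulus
       [exp (PI * b)] and argument [PI * b]. *)
    set (Den := ((RtoC q + w) * ((E * c)%R, (E * s)%R) - (RtoC q - w))%C).
    assert (Ep : (Cexp (RtoC PI * w) * Cexp (RtoC PI * w))%C = (E * c, E * s)).
    { rewrite <- Cexp_plus. replace (RtoC PI * w + RtoC PI * w)%C with ((PI * b, PI * b) : C)
        by (unfold w; apply injective_projections; simpl; field). reflexivity. }
    pose proof (Cexp_nz (RtoC PI * w)%C) as HX.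
    assert (EDen : (kD q w * Cexp (RtoC PI * w))%C = Den).
    { unfold Den. rewrite <- Ep. unfold kD. rewrite Cexp_opp. field. auto. }
    assert (HDen : Den <> 0) by (rewrite <- EDen; apply Cmult_neq_0; auto).
    assert (ER : (kN q w / kD q w)%C = (RtoC 1 + RtoC 2 * ((RtoC q - w) / Den))%C).
    { rewrite <- EDen. unfold kN. unfold kD in HD |- *. rewrite Cexp_opp in *.
      replace (RtoC 2) with (RtoC 1 + RtoC 1)%C by (rewrite <- RtoC_plus; f_equal; ring).
      set (Y := Cexp (RtoC PI * w)) in *. field. split; auto.
      intros E0. apply HD.
      replace ((RtoC q + w) * Y - (RtoC q - w) * / Y)%C with (((RtoC q + w) * Y * Y - (RtoC q - w)) / Y)%C by (field; auto).
      replace ((RtoC q + w) * Y * Y - (RtoC q - w))%C with (RtoC 0) by (rewrite <- E0; ring).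
      field; auto. }
    unfold koshliakov_trace. rewrite ER, Eww.
    assert (Eiw : (/ w)%C = (/ b, - / b)).
    { unfold w, Cinv; simpl. apply injective_projections; simpl; field; nra. }
    set (X := (q + b / 2) * (E * c) - b / 2 * (E * s) - (q - b / 2)).
    set (Y := (q + b / 2) * (E * s) + b / 2 * (E * c) + b / 2).
    assert (EXY : Den = (X, Y)) by (unfold Den, w, X, Y; apply injective_projections; simpl; ring).
    assert (HXY : X * X + Y * Y <> 0).
    { intros E0. apply HDen. rewrite EXY. assert (X = 0) by nra. assert (Y = 0) by nra.
      rewrite H, H0. auto. }
    assert (ERe : Re (RtoC (PI / 2) * ((RtoC 1 + RtoC 2 * ((RtoC q - w) / Den)) / w)
        - RtoC (PI / 2 * (q / (1 + PI * q))) / (0, a))%C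
      = PI / (2 * b) * (1 + 2 * (((q - b / 2) * X - b / 2 * Y - b / 2 * X - (q - b / 2) * Y) / (X * X + Y * Y)))).
    { unfold Cdiv. rewrite Eiw, EXY. clearbody X Y. unfold Cinv, w; simpl.
      field. repeat split; try nra.
      all: try (intros E0; apply HXY; rewrite <- E0; ring). }
    rewrite ERe. f_equal. f_equal.
    assert (Hcs : c * c + s * s = 1) by (unfold c, s; pose proof (sin2_cos2 (PI * b)) as Q; unfold Rsqr in Q; lra).
    unfold koshliakov_G. cbv zeta. fold b. fold c s.
    set (Ng := (q ^ 2 - a) * (c - s) - exp (- (PI * b)) * (q ^ 2 - b * q + a) - b * q * (c + s)).
    set (Dg := q ^ 2 * (cosh (PI * b) - c) + b * q * (sinh (PI * b) + s) + a * (cosh (PI * b) + c)).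
    assert (Ei : exp (- (PI * b)) = / E) by (unfold E; apply exp_Ropp).
    (* The squared modulus of [Den] is the denominator of [koshliakov_G] up to the factor [2 * E];
       the numerator matches up to [E]. *)
    assert (EDg : X * X + Y * Y = 2 * E * Dg).
    { transitivity (((q + b / 2) * (q + b / 2) + b / 2 * (b / 2)) * (E * E) * (c * c + s * s)
        + ((q - b / 2) * (q - b / 2) + b / 2 * (b / 2))
        - 2 * E * ((q * q - b * b / 2) * c - q * b * s)); [unfold X, Y; field|].
      rewrite Hcs. unfold Dg, cosh, sinh. fold E. rewrite Ei, Ea. field. lra. }
    assert (ENg : (q - b / 2) * X - b / 2 * Y - b / 2 * X - (q - b / 2) * Y = E * Ng).
    { unfold X, Y, Ng. rewrite Ei, Ea. field. lra. }
    rewrite ENg, EDg. rewrite EDg in HXY.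
    assert (Dg <> 0) by (intros E0; apply HXY; rewrite E0; ring).
    field. split; lra.
Qed.

Lemma ex_series_inv_sq : ex_series (fun n => / (INR n + 1 / 2) ^ 2).
Proof.
  apply (ex_series_bounded _ 5).
  - intros n. left. apply Rinv_0_lt_compat, pow_lt. pose proof (pos_INR n). lra.
  - assert (G : forall n, sum_n (fun n => / (INR n + 1 / 2) ^ 2) n <= 5 - / (INR n + 1)).
    { induction n as [|n IH].
      - rewrite sum_O. simpl. lra.
      - rewrite sum_Sn, S_INR. unfold plus; simpl. pose proof (pos_INR n) as Hn.
        assert (/ ((INR n + 1 + 1 / 2) * ((INR n + 1 + 1 / 2) * 1)) <= / (INR n + 1) - / (INR n + 1 + 1)).
        { replace (/ (INR n + 1) - / (INR n + 1 + 1)) with (/ ((INR n + 1) * (INR n + 1 + 1))) by (field; lra).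
          apply Rinv_le_contravar; nra. }
        simpl in IH. lra. }
    intros n. eapply Rle_trans; [apply G|].
    assert (0 < / (INR n + 1)) by (apply Rinv_0_lt_compat; pose proof (pos_INR n); lra). lra.
Qed.

Lemma ex_series_root_sq q mu : 0 < q -> koshliakov_root_seq q mu -> ex_series (fun n => / mu n ^ 2).
Proof.
  intros Hq Hmu. apply (ex_series_le (V := R_CompleteNormedModule) _ (fun n => / (INR n + 1 / 2) ^ 2)).
  - intros n. pose proof (root_seq_bounds q mu n Hq Hmu) as B. pose proof (pos_INR n).
    unfold norm; simpl; unfold abs; simpl.
    assert (0 < mu n * (mu n * 1)) by nra.
    rewrite Rabs_pos_eq by (left; apply Rinv_0_lt_compat; auto).
    apply Rinv_le_contravar; nra.
  - apply ex_series_inv_sq.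
Qed.

(** * Taylor bounds for the hyperbolic functions *)

Lemma nonneg_from_derivative (f f' : R -> R) x : f 0 = 0 -> 0 <= x ->
  (forall t, is_derive f t (f' t)) -> (forall t, 0 <= t -> 0 <= f' t) -> 0 <= f x.
Proof.
  intros H0 Hx Hd Hp. destruct (MVT_gen f 0 x f') as [c [Hc E]].
  - intros; apply Hd.
  - intros t _. apply continuity_pt_filterlim. apply (ex_derive_continuous (V := R_NormedModule)). eexists; apply Hd.
  - rewrite Rmin_left, Rmax_right in Hc by auto. rewrite H0 in E.
    specialize (Hp c (proj1 Hc)). nra.
Qed.

Lemma is_derive_cosh t : is_derive cosh t (sinh t).
Proof. apply is_derive_Reals, derivable_pt_lim_cosh. Qed.
Lemma is_derive_sinh t : is_derive sinh t (cosh t).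
Proof. apply is_derive_Reals, derivable_pt_lim_sinh. Qed.

Lemma cosh_ge_1 t : 1 <= cosh t.
Proof.
  unfold cosh. rewrite exp_Ropp. pose proof (exp_pos t) as He.
  assert (Hi : exp t * / exp t = 1) by (apply Rinv_r; lra).
  assert (0 < / exp t) by (apply Rinv_0_lt_compat; auto).
  pose proof (pow2_ge_0 (exp t - / exp t)). nra.
Qed.

Lemma cosh_zero : cosh 0 = 1.
Proof. unfold cosh. rewrite Ropp_0, exp_0. field. Qed.
Lemma sinh_zero : sinh 0 = 0.
Proof. unfold sinh. rewrite Ropp_0, exp_0. field. Qed.

Lemma sinh_lower x : 0 <= x -> x <= sinh x.
Proof.
  intros Hx.
  assert (H : 0 <= (fun t => sinh t - t) x); [|simpl in H; lra].
  apply (nonneg_from_derivative (fun t => sinh t - t) (fun t => cosh t - 1)); auto.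
  - cbv beta; rewrite sinh_zero; ring.
  - intros t. apply (is_derive_minus (V := R_NormedModule)); [apply is_derive_sinh|apply (is_derive_id (K := R_AbsRing))].
  - intros t _. pose proof (cosh_ge_1 t); lra.
Qed.

Lemma is_derive_monom c n t : is_derive (fun t => c * t ^ S n) t (c * (INR (S n) * t ^ n)).
Proof.
  apply (is_derive_scal (fun t => t ^ S n) t c).
  replace (INR (S n) * t ^ n) with (INR (S n) * 1 * t ^ pred (S n)) by (simpl pred; ring).
  apply (is_derive_pow (fun t => t)). apply (is_derive_id (K := R_AbsRing)).
Qed.

Lemma cosh_lower x : 0 <= x -> 1 + x ^ 2 / 2 <= cosh x.
Proof.
  intros Hx.
  assert (H : 0 <= (fun t => cosh t - 1 - / 2 * t ^ 2) x); [|simpl in H; simpl; lra].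
  apply (nonneg_from_derivative (fun t => cosh t - 1 - / 2 * t ^ 2) (fun t => sinh t - 0 - / 2 * (INR 2 * t ^ 1))); auto.
  - cbv beta; rewrite cosh_zero; ring.
  - intros t. apply (is_derive_minus (V := R_NormedModule)); [|apply is_derive_monom].
    apply (is_derive_minus (V := R_NormedModule)); [apply is_derive_cosh|apply (is_derive_const (V := R_NormedModule))].
  - intros t Ht. pose proof (sinh_lower t Ht). simpl. lra.
Qed.

Lemma sinh_lower3 x : 0 <= x -> x + x ^ 3 / 6 <= sinh x.
Proof.
  intros Hx.
  assert (H : 0 <= (fun t => sinh t - t - / 6 * t ^ 3) x); [|simpl in H; simpl; lra].
  apply (nonneg_from_derivative (fun t => sinh t - t - / 6 * t ^ 3) (fun t => cosh t - 1 - / 6 * (INR 3 * t ^ 2))); auto.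
  - cbv beta; rewrite sinh_zero; ring.
  - intros t. apply (is_derive_minus (V := R_NormedModule)); [|apply is_derive_monom].
    apply (is_derive_minus (V := R_NormedModule)); [apply is_derive_sinh|apply (is_derive_id (K := R_AbsRing))].
  - intros t Ht. pose proof (cosh_lower t Ht). simpl in *. lra.
Qed.

Lemma is_derive_monom_cosh c n t :
  is_derive (fun t => c * t ^ S n * cosh t) t (c * (INR (S n) * t ^ n) * cosh t + c * t ^ S n * sinh t).
Proof.
  apply (is_derive_mult (K := R_AbsRing) (fun t => c * t ^ S n) cosh);
    [apply is_derive_monom|apply is_derive_cosh|intros; apply Rmult_comm].
Qed.

(** A Lagrange remainder with the intermediate value replaced by [cosh x]. As [cosh x] tends to 1 at
    0, bounds of this shape and the lower bounds above squeeze the Taylor quotients to their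
    limits. *)
Lemma sinh_upper x : 0 <= x -> sinh x <= x * cosh x.
Proof.
  intros Hx.
  assert (H : 0 <= (fun t => 1 * t ^ 1 * cosh t - sinh t) x); [|simpl in H; lra].
  apply (nonneg_from_derivative (fun t => 1 * t ^ 1 * cosh t - sinh t) (fun t => (1 * (INR 1 * t ^ 0) * cosh t + 1 * t ^ 1 * sinh t) - cosh t)); auto.
  - cbv beta; rewrite sinh_zero; ring.
  - intros t. apply (is_derive_minus (V := R_NormedModule)); [apply is_derive_monom_cosh|apply is_derive_sinh].
  - intros t Ht. pose proof (sinh_lower t Ht). simpl. nra.
Qed.

Lemma cosh_upper x : 0 <= x -> cosh x <= 1 + x ^ 2 / 2 * cosh x.
Proof.
  intros Hx.
  assert (H : 0 <= (fun t => / 2 * t ^ 2 * cosh t - (cosh t - 1)) x); [|simpl in H; simpl; lra].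
  apply (nonneg_from_derivative (fun t => / 2 * t ^ 2 * cosh t - (cosh t - 1)) (fun t => (/ 2 * (INR 2 * t ^ 1) * cosh t + / 2 * t ^ 2 * sinh t) - (sinh t - 0))); auto.
  - cbv beta; rewrite cosh_zero; ring.
  - intros t. apply (is_derive_minus (V := R_NormedModule)); [apply is_derive_monom_cosh|].
    apply (is_derive_minus (V := R_NormedModule)); [apply is_derive_cosh|apply (is_derive_const (V := R_NormedModule))].
  - intros t Ht. pose proof (sinh_lower t Ht). pose proof (sinh_upper t Ht).
    assert (0 <= t ^ 2 * sinh t) by (apply Rmult_le_pos; [apply pow2_ge_0|lra]). simpl in *. lra.
Qed.

Lemma sinh_upper3 x : 0 <= x -> sinh x <= x + x ^ 3 / 6 * cosh x.
Proof.
  intros Hx.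
  assert (H : 0 <= (fun t => / 6 * t ^ 3 * cosh t - (sinh t - t)) x); [|simpl in H; simpl; lra].
  apply (nonneg_from_derivative (fun t => / 6 * t ^ 3 * cosh t - (sinh t - t)) (fun t => (/ 6 * (INR 3 * t ^ 2) * cosh t + / 6 * t ^ 3 * sinh t) - (cosh t - 1))); auto.
  - cbv beta; rewrite sinh_zero; ring.
  - intros t. apply (is_derive_minus (V := R_NormedModule)); [apply is_derive_monom_cosh|].
    apply (is_derive_minus (V := R_NormedModule)); [apply is_derive_sinh|apply (is_derive_id (K := R_AbsRing))].
  - intros t Ht. pose proof (sinh_lower t Ht). pose proof (cosh_upper t Ht).
    assert (0 <= t ^ 3 * sinh t) by (apply Rmult_le_pos; [apply pow_le; auto|lra]). simpl in *. lra.
Qed.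

Lemma is_lim_seq_inv_p_infty (u : nat -> R) :
  is_lim_seq u p_infty -> is_lim_seq (fun n => / u n) 0.
Proof.
  intros H. replace (Finite 0) with (Rbar_inv p_infty) by auto.
  apply is_lim_seq_inv; [auto|discriminate].
Qed.

Lemma is_lim_seq_inv_S : is_lim_seq (fun n => / (INR n + 1)) 0.
Proof.
  apply is_lim_seq_ext with (fun n => / INR (S n)); [intros; rewrite S_INR; auto|].
  apply (is_lim_seq_incr_1 (fun n => / INR n)), is_lim_seq_inv_p_infty, is_lim_seq_INR.
Qed.

(** The stated limit must have the same syntactic shape as the sequence, so limits given to this
    tactic keep factors such as [0] unsimplified. *)
Ltac lim_arith :=
  lazymatch goal with
  | |- is_lim_seq (fun n => @?a n - @?b n) (Finite (?l - ?m)) =>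
      apply (is_lim_seq_minus' a b l m); lim_arith
  | |- is_lim_seq (fun n => @?a n + @?b n) (Finite (?l + ?m)) =>
      apply (is_lim_seq_plus' a b l m); lim_arith
  | |- is_lim_seq (fun n => @?a n * @?b n) (Finite (?l * ?m)) =>
      apply (is_lim_seq_mult' a b l m); lim_arith
  | |- is_lim_seq (fun _ => ?c) _ => apply is_lim_seq_const
  | |- _ => assumption
  end.

(** Both terms grow like [kc q / (2 * t ^ 2)], so the limit of the difference depends on [cosh] to
    second and [sinh] to third order. *)
Lemma trace_real_limit q (t : nat -> R) : 0 < q -> (forall n, 0 < t n) -> is_lim_seq t 0 ->
  is_lim_seq (fun n => PI / t n * (kk q (t n) + 1 / 2) - kc q / (2 * t n ^ 2))
    (PI ^ 2 / 6 * (((PI * q) ^ 2 + 3 * (PI * q) + 3) / (PI * q + 1) ^ 2)).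
Proof.
  intros Hq Ht Hl. pose proof PI_RGT_0 as HP. set (P := PI * q). assert (HPq : 0 < P) by (unfold P; nra).
  set (x := fun n => PI * t n).
  assert (Hx : forall n, 0 < x n) by (intros n; specialize (Ht n); unfold x; nra).
  assert (Lx : is_lim_seq x 0).
  { replace (Finite 0) with (Rbar_mult PI 0) by (simpl; f_equal; ring).
    apply is_lim_seq_scal_l; auto. }
  assert (Lc : is_lim_seq (fun n => cosh (x n)) 1).
  { rewrite <- cosh_zero. apply is_lim_seq_continuous; auto.
    apply continuity_pt_filterlim. apply (ex_derive_continuous (V := R_NormedModule)). eexists; apply is_derive_cosh. }
  (* Substituting [cosh x = 1 + x ^ 2 * C] and [sinh x = x + x ^ 3 * S] cancels the double pole
     algebraically: the quotient [num / den] below no longer divides by [x]. *)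
  set (C := fun n => (cosh (x n) - 1) / x n ^ 2). set (S := fun n => (sinh (x n) - x n) / x n ^ 3).
  assert (LC : is_lim_seq C (/ 2)).
  { apply is_lim_seq_le_le with (fun _ => / 2) (fun n => / 2 * cosh (x n)).
    - intros n. specialize (Hx n). pose proof (cosh_lower (x n) ltac:(lra)). pose proof (cosh_upper (x n) ltac:(lra)).
      assert (0 < x n ^ 2) by (apply pow_lt; auto).
      unfold C. split; [apply Rle_div_r; lra|apply Rle_div_l; lra].
    - apply is_lim_seq_const.
    - replace (Finite (/ 2)) with (Rbar_mult (/ 2) 1) by (simpl; f_equal; ring). apply is_lim_seq_scal_l; auto. }
  assert (LS : is_lim_seq S (/ 6)).
  { apply is_lim_seq_le_le with (fun _ => / 6) (fun n => / 6 * cosh (x n)).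
    - intros n. specialize (Hx n). pose proof (sinh_lower3 (x n) ltac:(lra)). pose proof (sinh_upper3 (x n) ltac:(lra)).
      assert (0 < x n ^ 3) by (apply pow_lt; auto).
      unfold S. split; [apply Rle_div_r; lra|apply Rle_div_l; lra].
    - apply is_lim_seq_const.
    - replace (Finite (/ 6)) with (Rbar_mult (/ 6) 1) by (simpl; f_equal; ring). apply is_lim_seq_scal_l; auto. }
  assert (Lx2 : is_lim_seq (fun n => x n * x n) 0).
  { replace 0 with (0 * 0) by ring. apply is_lim_seq_mult'; auto. }
  set (num := fun n => (P + 1) * (P * C n + 1 + x n * x n * S n) - P * (P * S n + C n)).
  set (den := fun n => (P + 1) * (P + 1 + x n * x n * (P * S n + C n))).
  assert (Ln : is_lim_seq num ((P + 1) * (P * / 2 + 1 + 0 * / 6) - P * (P * / 6 + / 2)))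
    by (unfold num; lim_arith).
  assert (Ld : is_lim_seq den ((P + 1) * (P + 1 + 0 * (P * / 6 + / 2))))
    by (unfold den; lim_arith).
  apply is_lim_seq_ext with (fun n => PI ^ 2 / 2 * (num n / den n)).
  - intros n. specialize (Hx n). specialize (Ht n).
    assert (Hxt : x n = PI * t n) by auto.
    assert (Ec : cosh (x n) = 1 + x n ^ 2 * C n) by (unfold C; field; lra).
    assert (Es : sinh (x n) = x n + x n ^ 3 * S n) by (unfold S; field; lra).
    assert (HC : 0 <= C n).
    { unfold C. pose proof (cosh_ge_1 (x n)). apply Rmult_le_pos; [lra|]. left. apply Rinv_0_lt_compat, pow_lt; auto. }
    assert (HS : 0 <= S n).
    { unfold S. pose proof (sinh_lower (x n) ltac:(lra)). apply Rmult_le_pos; [lra|]. left. apply Rinv_0_lt_compat, pow_lt; auto. }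
    assert (HPS : 0 <= P * S n + C n) by nra.
    assert (Hden : 0 < P + 1 + x n * x n * (P * S n + C n)) by nra.
    set (e := exp (x n)). assert (He : 0 < e) by apply exp_pos.
    assert (Eexp : exp (2 * PI * t n) = e * e) by (unfold e; rewrite <- exp_plus; f_equal; rewrite Hxt; ring).
    assert (Ech : cosh (x n) = (e + / e) / 2) by (unfold cosh; rewrite exp_Ropp; auto).
    assert (Esh : sinh (x n) = (e - / e) / 2) by (unfold sinh; rewrite exp_Ropp; auto).
    destruct (kk_den_pos q (t n) Hq Ht) as [D1 D2]. rewrite Eexp in D1, D2.
    assert (HD : 0 < q * sinh (x n) + t n * cosh (x n)).
    { pose proof (sinh_lower (x n) ltac:(lra)). pose proof (cosh_ge_1 (x n)). nra. }
    assert (Ek : kk q (t n) + 1 / 2 = (q * cosh (x n) + t n * sinh (x n)) / (2 * (q * sinh (x n) + t n * cosh (x n)))).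
    { unfold kk. rewrite Eexp. rewrite Ech, Esh. rewrite Ech, Esh in HD.
      field. repeat split; try lra.  }
    rewrite Ek, Ec, Es. unfold num, den, kc. fold P.
    replace q with (P / PI) by (unfold P; field; lra).
    replace (t n) with (x n / PI) by (rewrite Hxt; field; lra).
    set (X := x n) in *. set (c := C n) in *. set (s := S n) in *. clearbody X c s P.
    field. repeat split; try lra; try nra.
  - replace (PI ^ 2 / 6 * ((P ^ 2 + 3 * P + 3) / (P + 1) ^ 2))
      with (PI ^ 2 / 2 * (((P + 1) * (P * / 2 + 1 + 0 * / 6) - P * (P * / 6 + / 2)) / ((P + 1) * (P + 1 + 0 * (P * / 6 + / 2)))))
      by (field; nra).
    apply is_lim_seq_mult'; [apply is_lim_seq_const|]. apply is_lim_seq_div'; auto.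
    rewrite Rmult_0_l. nra.
Qed.

(** The sum is $\zeta_p(2)$, obtained by letting [t] tend to 0 in [trace_real]; it produces the term
    in $1/x$ of the theorem. *)
Lemma zeta_two p lam : 0 < p -> koshliakov_root_seq p lam ->
  is_series (fun n => koshliakov_weight p (lam n) * / lam n ^ 2)
    (PI ^ 2 / 6 * (((PI * p) ^ 2 + 3 * (PI * p) + 3) / (PI * p + 1) ^ 2)).
Proof.
  intros Hp Hlam. pose proof (ex_series_root_sq p lam Hp Hlam) as Ex.
  set (t := fun j : nat => / (INR j + 1)).
  assert (Ht : forall j, 0 < t j) by (intros j; apply Rinv_0_lt_compat; pose proof (pos_INR j); lra).
  assert (Hlp : forall n, 0 < lam n) by (intros n; apply (root_seq_phase p lam n Hp Hlam)).
  destruct (tannery (fun j n => koshliakov_weight p (lam n) * / (lam n ^ 2 + t j ^ 2))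
    (fun n => koshliakov_weight p (lam n) * / lam n ^ 2) (fun n => / lam n ^ 2)) as [E L]; auto.
  - intros j n. destruct (weight_bounds p (lam n) Hp) as [W _].
    specialize (Hlp n). specialize (Ht j).
    assert (0 < lam n ^ 2) by (apply pow_lt; auto). assert (0 < t j ^ 2) by (apply pow_lt; auto).
    assert (0 < / (lam n ^ 2 + t j ^ 2)) by (apply Rinv_0_lt_compat; lra).
    rewrite Rabs_pos_eq by nra.
    apply Rle_trans with (1 * / (lam n ^ 2 + t j ^ 2)); [nra|]. rewrite Rmult_1_l. apply Rinv_le_contravar; lra.
  - intros n. apply is_lim_seq_mult'; [apply is_lim_seq_const|].
    assert (Lt : is_lim_seq t 0) by apply is_lim_seq_inv_S.
    assert (L0 : is_lim_seq (fun j => lam n ^ 2 + t j * (t j * 1)) (lam n ^ 2 + 0 * (0 * 1))).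
    { apply is_lim_seq_plus'; [apply is_lim_seq_const|].
      apply is_lim_seq_mult'; auto. apply is_lim_seq_mult'; auto. apply is_lim_seq_const. }
    specialize (Hlp n). assert (0 < lam n ^ 2) by (apply pow_lt; auto).
    replace (lam n ^ 2 + 0 * (0 * 1)) with (lam n ^ 2) in L0 by ring.
    apply is_lim_seq_inv in L0; [exact L0|]. intros E. injection E; intros; simpl in *; lra.
  - pose proof (trace_real_limit p t Hp Ht is_lim_seq_inv_S) as L2.
    assert (L3 : is_lim_seq (fun j => Series (fun n => koshliakov_weight p (lam n) * / (lam n ^ 2 + t j ^ 2)))
      (PI ^ 2 / 6 * (((PI * p) ^ 2 + 3 * (PI * p) + 3) / (PI * p + 1) ^ 2))).
    { eapply is_lim_seq_ext; [|exact L2]. intros j. symmetry. apply is_series_unique.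
      apply trace_real; auto. }
    apply is_lim_seq_unique in L. apply is_lim_seq_unique in L3. rewrite L in L3. apply Rbar_finite_eq in L3.
    rewrite <- L3. apply Series_correct; auto.
Qed.

(** * Asymptotics of the cut-off sums *)

Lemma cosh_lower4 x : 0 <= x -> 1 + x ^ 4 / 24 <= cosh x.
Proof.
  intros Hx.
  assert (H : 0 <= (fun t => cosh t - 1 - / 24 * t ^ 4) x); [|simpl in H; simpl; lra].
  apply (nonneg_from_derivative (fun t => cosh t - 1 - / 24 * t ^ 4) (fun t => sinh t - 0 - / 24 * (INR 4 * t ^ 3))); auto.
  - cbv beta; rewrite cosh_zero; ring.
  - intros t. apply (is_derive_minus (V := R_NormedModule)); [|apply is_derive_monom].
    apply (is_derive_minus (V := R_NormedModule)); [apply is_derive_cosh|apply (is_derive_const (V := R_NormedModule))].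
  - intros t Ht. pose proof (sinh_lower3 t Ht). simpl in *. lra.
Qed.

(** For $z=\pi\sqrt{2a}$ the quartic term of [cosh z] is $\pi^4a^2/6$, so the denominator exceeds
    $a^3$ while the numerator grows at most linearly in $a$. The true decay is exponential; $a^{-2}$
    is enough for dominated convergence. *)
Lemma koshliakov_G_bound p a0 : 0 < p -> 0 < a0 ->
  exists k, 0 < k /\ forall a, a0 <= a -> Rabs (koshliakov_G p a) <= k * / a ^ 2.
Proof.
  intros Hp Ha0. exists (9 / 2 * p ^ 2 / a0 + 6).
  assert (Hpp : 0 < p ^ 2) by (apply pow_lt; auto).
  assert (Hk0 : 0 < 9 / 2 * p ^ 2 / a0) by (apply Rdiv_lt_0_compat; lra).
  split; [lra|].
  intros a Ha. unfold koshliakov_G. cbv zeta.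
  set (b := sqrt (2 * a)). assert (Hb : 0 < b) by (apply sqrt_lt_R0; lra).
  assert (Hb2 : b * b = 2 * a) by (apply sqrt_sqrt; lra).
  assert (HP : 3 <= PI) by (pose proof PI2_3_2; lra).
  set (z := PI * b). assert (Hz : 0 < z) by (unfold z; nra).
  pose proof (COS_bound z) as Hc. pose proof (SIN_bound z) as Hs.
  set (c := cos z) in *. set (s := sin z) in *.
  assert (He : 0 < exp (- z) <= 1).
  { split; [apply exp_pos|]. rewrite <- exp_0. apply exp_le. lra. }
  set (e := exp (- z)) in *.
  assert (Hch : 1 + a ^ 2 <= cosh z).
  { eapply Rle_trans; [|apply cosh_lower4; lra].
    assert (a ^ 2 <= z ^ 4 / 24); [|lra].
    replace (z ^ 4) with (PI ^ 4 * (b * b) * (b * b)) by (unfold z; ring). rewrite Hb2.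
    assert (9 <= PI * PI) by nra.
    assert (81 <= PI ^ 4) by (replace (PI ^ 4) with ((PI * PI) * (PI * PI)) by ring; nra).
    assert (0 <= a * a) by nra.
    replace (PI ^ 4 * (2 * a) * (2 * a) / 24) with (PI ^ 4 * (a * a) / 6) by field. nra. }
  assert (Hsh : z <= sinh z) by (apply sinh_lower; lra).
  assert (Hss : - z <= s).
  { destruct (Rle_lt_dec 1 z) as [L|L]; [lra|].
    assert (0 <= s); [|lra]. apply sin_ge_0; lra. }
  set (ch := cosh z) in *. set (sh := sinh z) in *.
  assert (Hpos : 0 < a) by lra.
  assert (Ha3 : 0 < a ^ 3) by (apply pow_lt; auto).
  assert (Hden : a ^ 3 <= p ^ 2 * (ch - c) + b * p * (sh + s) + a * (ch + c)).
  { assert (0 <= p ^ 2 * (ch - c)) by (apply Rmult_le_pos; [lra|]; pose proof (pow2_ge_0 a); lra).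
    assert (0 <= b * p * (sh + s)) by (apply Rmult_le_pos; [nra|lra]).
    assert (a * a ^ 2 <= a * (ch + c)) by (apply Rmult_le_compat_l; lra).
    replace (a ^ 3) with (a * a ^ 2) by ring. lra. }
  set (D := p ^ 2 * (ch - c) + b * p * (sh + s) + a * (ch + c)) in *.
  set (N := (p ^ 2 - a) * (c - s) - e * (p ^ 2 - b * p + a) - b * p * (c + s)).
  assert (Hbp : 0 < b * p) by nra.
  assert (Hbp2 : b * p <= p ^ 2 / 2 + a).
  { pose proof (pow2_ge_0 (b - p)). nra. }
  assert (HN : Rabs N <= 9 / 2 * p ^ 2 + 6 * a).
  { unfold N.
    assert (N1 : Rabs ((p ^ 2 - a) * (c - s)) <= (p ^ 2 + a) * 2).
    { rewrite Rabs_mult. apply Rmult_le_compat; try apply Rabs_pos; apply Rabs_le; lra. }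
    assert (N2 : Rabs (e * (p ^ 2 - b * p + a)) <= 1 * (p ^ 2 + b * p + a)).
    { rewrite Rabs_mult. apply Rmult_le_compat; try apply Rabs_pos; apply Rabs_le; lra. }
    assert (N3 : Rabs (b * p * (c + s)) <= (b * p) * 2).
    { rewrite Rabs_mult. apply Rmult_le_compat; try apply Rabs_pos; apply Rabs_le; lra. }
    unfold Rminus at 1 2. eapply Rle_trans; [apply Rabs_triang|]. rewrite Rabs_Ropp.
    eapply Rle_trans; [apply Rplus_le_compat_r, Rabs_triang|]. rewrite Rabs_Ropp.
    fold (p ^ 2 - a) in *. lra. }
  unfold Rdiv. rewrite Rabs_mult, (Rabs_pos_eq (/ D)) by (left; apply Rinv_0_lt_compat; lra).
  apply Rle_trans with ((9 / 2 * p ^ 2 + 6 * a) * / a ^ 3).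
  - apply Rmult_le_compat; auto; [apply Rabs_pos|left; apply Rinv_0_lt_compat; lra|apply Rinv_le_contravar; lra].
  - replace ((9 / 2 * p ^ 2 + 6 * a) * / a ^ 3) with ((9 / 2 * p ^ 2 / a + 6) * / a ^ 2) by (field; lra).
    apply Rmult_le_compat_r; [left; apply Rinv_0_lt_compat, pow_lt; auto|].
    assert (9 / 2 * p ^ 2 / a <= 9 / 2 * p ^ 2 / a0); [|unfold Rdiv in *; lra].
    apply Rmult_le_compat_l; [lra|]. apply Rinv_le_contravar; lra.
Qed.

(** * The cut-off factor and the growth of its sums *)

Definition chi (B u : R) : R := B ^ 2 / (B ^ 2 + u ^ 2).

Lemma chi_bounds B u : 0 < B -> 0 < chi B u <= 1.
Proof.
  intros HB. unfold chi. assert (0 < B ^ 2) by (apply pow_lt; auto). pose proof (pow2_ge_0 u).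
  split; [apply Rdiv_lt_0_compat; lra|]. apply Rle_div_l; lra.
Qed.

Lemma chi_decr B u v : 0 < B -> 0 <= u <= v -> chi B v <= chi B u.
Proof.
  intros HB H. unfold chi. assert (0 < B ^ 2) by (apply pow_lt; auto).
  apply Rmult_le_compat_l; [lra|]. apply Rinv_le_contravar; nra.
Qed.

(** The first bound does not involve [B] and provides a dominating series; the second tends to 0 as
    [B] grows and provides the termwise limit. *)
Lemma chi_gap B u : 0 < B -> 0 <= u ->
  chi B u - chi B (u + 2) <= 4 * (u + 1) / (u + 2) ^ 2 /\ chi B u - chi B (u + 2) <= 4 * (u + 1) / B ^ 2.
Proof.
  intros HB Hu. unfold chi. assert (H2 : 0 < B ^ 2) by (apply pow_lt; auto).
  assert (H3 : 0 < (u + 2) ^ 2) by (apply pow_lt; lra). pose proof (pow2_ge_0 u) as H4.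
  assert (E : B ^ 2 / (B ^ 2 + u ^ 2) - B ^ 2 / (B ^ 2 + (u + 2) ^ 2)
    = 4 * (u + 1) * (B ^ 2 / (B ^ 2 + u ^ 2) * / (B ^ 2 + (u + 2) ^ 2))) by (field; split; lra).
  rewrite E.
  assert (G : B ^ 2 / (B ^ 2 + u ^ 2) * / (B ^ 2 + (u + 2) ^ 2) <= 1 * / (B ^ 2 + (u + 2) ^ 2)).
  { apply Rmult_le_compat_r; [left; apply Rinv_0_lt_compat; lra|]. apply Rle_div_l; lra. }
  split; apply Rmult_le_compat_l; try lra; (eapply Rle_trans; [exact G|]); rewrite Rmult_1_l;
    apply Rinv_le_contravar; lra.
Qed.

Lemma chi_lim (B : nat -> R) u : (forall j, 0 < B j) -> is_lim_seq B p_infty -> is_lim_seq (fun j => chi (B j) u) 1.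
Proof.
  intros HB HL.
  pose proof (is_lim_seq_inv_p_infty B HL) as Li.
  apply is_lim_seq_ext with (fun j => / (1 + u ^ 2 * (/ B j * / B j))).
  { intros j. specialize (HB j). unfold chi. assert (0 < B j ^ 2) by (apply pow_lt; auto).
    pose proof (pow2_ge_0 u). field. split; nra. }
  replace (Finite 1) with (Rbar_inv (1 + u ^ 2 * (0 * 0))) by (simpl; f_equal; field).
  apply is_lim_seq_inv.
  - apply is_lim_seq_plus'; [apply is_lim_seq_const|]. apply is_lim_seq_mult'; [apply is_lim_seq_const|].
    apply is_lim_seq_mult'; auto.
  - intros E. apply Rbar_finite_eq in E. lra.
Qed.

(** The substitution $u=Bs^2$ turns $\int u^{-1/2}\,\frac{B^2}{B^2+u^2}\,du$ into $\sqrt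
    B\int\frac{2}{1+s^4}\,ds$. *)
Definition omega (v : R) : R := RInt (fun s => 2 / (1 + s ^ 4)) 0 v.

Lemma quartic_pos s : 1 <= 1 + s ^ 4.
Proof. replace (s ^ 4) with ((s ^ 2) ^ 2) by ring. pose proof (pow2_ge_0 (s ^ 2)). lra. Qed.

Lemma quartic_continuous s : continuous (fun s => 2 / (1 + s ^ 4)) s.
Proof.
  apply (ex_derive_continuous (V := R_NormedModule)). auto_derive.
  pose proof (quartic_pos s). simpl in *. lra.
Qed.

Lemma is_derive_omega v : is_derive omega v (2 / (1 + v ^ 4)).
Proof.
  apply (is_derive_RInt (V := R_CompleteNormedModule) (fun s => 2 / (1 + s ^ 4)) omega 0 v).
  - apply filter_forall. intros t. apply RInt_correct.
    apply (ex_RInt_continuous (V := R_CompleteNormedModule)). intros; apply quartic_continuous.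
  - apply quartic_continuous.
Qed.

Lemma omega_0 : omega 0 = 0.
Proof. unfold omega. rewrite RInt_point. reflexivity. Qed.

Lemma omega_mvt u v : u <= v -> exists xi, u <= xi <= v /\ omega v - omega u = 2 / (1 + xi ^ 4) * (v - u).
Proof.
  intros H. destruct (MVT_gen omega u v (fun t => 2 / (1 + t ^ 4))) as [c [Hc E]].
  - intros; apply is_derive_omega.
  - intros t _. apply continuity_pt_filterlim, (ex_derive_continuous (V := R_NormedModule)). eexists; apply is_derive_omega.
  - rewrite Rmin_left, Rmax_right in Hc by auto. exists c; auto.
Qed.

Lemma omega_incr u v : u <= v -> omega u <= omega v.
Proof.
  intros H. destruct (omega_mvt u v H) as [xi [_ E]]. pose proof (quartic_pos xi).
  assert (0 < 2 / (1 + xi ^ 4)) by (apply Rdiv_lt_0_compat; lra). nra.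
Qed.

Lemma omega_bounded v : 0 <= v -> omega v <= 2 * PI.
Proof.
  intros Hv.
  assert (H : 0 <= (fun t => 4 * atan t - omega t) v).
  { apply (nonneg_from_derivative (fun t => 4 * atan t - omega t) (fun t => 4 * / (1 + t ^ 2) - 2 / (1 + t ^ 4))); auto.
    - rewrite omega_0, atan_0. ring.
    - intros t. apply (is_derive_minus (V := R_NormedModule)); [|apply is_derive_omega].
      apply (is_derive_scal atan t 4).
      apply is_derive_Reals, derivable_pt_lim_atan.
    - intros t Ht. pose proof (quartic_pos t) as Q. pose proof (pow2_ge_0 t) as Q2.
      assert (2 / (1 + t ^ 4) <= 4 * / (1 + t ^ 2)); [|lra].
      apply Rle_div_l; [lra|]. apply (Rmult_le_reg_r (1 + t ^ 2)); [lra|].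
      replace (4 * / (1 + t ^ 2) * (1 + t ^ 4) * (1 + t ^ 2)) with (4 * (1 + t ^ 4)) by (field; lra).
      replace (t ^ 4) with (t ^ 2 * t ^ 2) by ring. pose proof (pow2_ge_0 (t ^ 2 - 1 / 2)). nra. }
  simpl in H. pose proof (atan_bound v). lra.
Qed.

(** An increasing bounded function has a limit. Only existence is claimed: the coefficient of sqrt B
    is settled at the end by comparing growth. *)
Lemma omega_limit : exists Om : R, forall v : nat -> R, is_lim_seq v p_infty -> is_lim_seq (fun n => omega (v n)) Om.
Proof.
  destruct (completeness (fun y => exists v, 0 <= v /\ y = omega v)) as [Om [U L]].
  - exists (2 * PI). intros y [v [Hv ->]]. apply omega_bounded; auto.
  - exists (omega 0), 0. split; auto; lra.
  - exists Om. intros v Hv. apply is_lim_seq_Reals. intros eps He.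
    assert (Hex : exists v0, 0 <= v0 /\ Om - eps < omega v0).
    { apply NNPP. intros Hn. assert (Om <= Om - eps); [|lra]. apply L. intros y [w [Hw ->]].
      apply Rnot_lt_le. intros Hlt. apply Hn. eauto. }
    destruct Hex as [v0 [H0 H1]].
    apply is_lim_seq_spec in Hv. destruct (Hv v0) as [N HN]. exists N. intros n Hn.
    specialize (HN n Hn). unfold R_dist.
    pose proof (omega_incr v0 (v n) ltac:(lra)).
    assert (omega (v n) <= Om) by (apply U; exists (v n); split; auto; lra).
    apply Rabs_def1; lra.
Qed.

Lemma sqrt_gap u : 0 < u -> 0 <= 2 * (sqrt (u + 1) - sqrt u) <= / sqrt u.
Proof.
  intros Hu. pose proof (sqrt_lt_R0 u Hu) as S1. pose proof (sqrt_lt_R0 (u + 1) ltac:(lra)) as S2.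
  pose proof (sqrt_sqrt u ltac:(lra)) as E1. pose proof (sqrt_sqrt (u + 1) ltac:(lra)) as E2.
  assert (Hle : sqrt u <= sqrt (u + 1)) by (apply sqrt_le_1; lra).
  split; [lra|]. apply (Rmult_le_reg_r (sqrt u)); auto. rewrite Rinv_l by lra. nra.
Qed.

Lemma ex_series_inv_sqrt_cube : ex_series (fun m => / (sqrt (INR m + 1) * (INR m + 1))).
Proof.
  apply (ex_series_bounded _ 4).
  - intros n. left. apply Rinv_0_lt_compat. pose proof (pos_INR n). apply Rmult_lt_0_compat; [apply sqrt_lt_R0|]; lra.
  - assert (St : forall u, 1 <= u -> / (sqrt u * u) <= 4 * (/ sqrt u - / sqrt (u + 1))).
    { intros u Hu. pose proof (sqrt_lt_R0 u ltac:(lra)) as S1. pose proof (sqrt_lt_R0 (u + 1) ltac:(lra)) as S2.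
      pose proof (sqrt_sqrt u ltac:(lra)) as E1. pose proof (sqrt_sqrt (u + 1) ltac:(lra)) as E2.
      set (r := sqrt u) in *. set (t := sqrt (u + 1)) in *.
      assert (Hrt : r <= t) by (unfold r, t; apply sqrt_le_1; lra).
      assert (Et : 4 * (/ r - / t) = 4 * / (r * t * (t + r))).
      { replace (4 * (/ r - / t)) with (4 * (t - r) / (r * t)) by (field; split; lra).
        replace (t - r) with (/ (t + r)); [field; repeat split; lra|].
        apply (Rmult_eq_reg_r (t + r)); [rewrite Rinv_l by lra; nra|lra]. }
      rewrite Et.
      replace (/ (r * u)) with (4 * / (4 * (r * u))) by (field; split; lra).
      apply Rmult_le_compat_l; [lra|]. apply Rinv_le_contravar.
      - repeat apply Rmult_lt_0_compat; lra.
      - replace (r * t * (t + r)) with (r * (t * t + t * r)) by ring.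
        replace (4 * (r * u)) with (r * (4 * u)) by ring. apply Rmult_le_compat_l; [lra|]. nra. }
    assert (G : forall n, sum_n (fun m => / (sqrt (INR m + 1) * (INR m + 1))) n <= 4 * (1 - / sqrt (INR n + 2))).
    { induction n as [|n IH].
      - rewrite sum_O. simpl. rewrite !Rplus_0_l. specialize (St 1 ltac:(lra)). rewrite sqrt_1 in *.
        replace (1 + 1) with 2 in St by ring. rewrite Rinv_1 in St. lra.
      - rewrite sum_Sn, S_INR. unfold plus; simpl. pose proof (pos_INR n).
        specialize (St (INR n + 1 + 1) ltac:(lra)).
        replace (INR n + 1 + 1 + 1) with (INR n + 1 + 2) in St by ring.
        replace (INR n + 2) with (INR n + 1 + 1) in IH by ring. lra. }
    intros n. eapply Rle_trans; [apply G|].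
    assert (0 < / sqrt (INR n + 2)) by (apply Rinv_0_lt_compat, sqrt_lt_R0; pose proof (pos_INR n); lra). lra.
Qed.

(** The sum is compared with $\int_1^\infty u^{-1/2}\frac{B^2}{B^2+u^2}\,du$, which is [Om * sqrt B]
    minus the integral over $[0,1]$. The latter tends to 2, hence the limit -2; it will cancel the
    [+ 2] of [zeta_half]. [Om] is fixed before the sequence [B]. *)
Lemma root_theta q mu : 0 < q -> koshliakov_root_seq q mu -> exists Om : R,
  forall B : nat -> R, (forall j, 0 < B j) -> is_lim_seq B p_infty ->
  (forall j, ex_series (fun m => 2 * (sqrt (INR m + 2) - sqrt (INR m + 1)) * chi (B j) (mu m))) /\
  is_lim_seq (fun j => Series (fun m => 2 * (sqrt (INR m + 2) - sqrt (INR m + 1)) * chi (B j) (mu m))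
     - Om * sqrt (B j)) (-2).
Proof.
  intros Hq Hmu. destruct omega_limit as [Om HOm]. exists Om. intros B HB HL.
  set (th := fun j m => 2 * (sqrt (INR m + 2) - sqrt (INR m + 1)) * chi (B j) (mu m)).
  (* The integral of $u^{-1/2}\frac{B^2}{B^2+u^2}$ over $[m+1,m+2]$, expressed by [omega]; summed
     over [m] it telescopes. *)
  set (ph := fun j m => sqrt (B j) * (omega (sqrt ((INR m + 2) / B j)) - omega (sqrt ((INR m + 1) / B j)))).
  set (g := fun m => 4 * / (sqrt (INR m + 1) * (INR m + 1))).
  assert (Hg : ex_series g) by (apply (ex_series_scal (V := R_NormedModule) 4), ex_series_inv_sqrt_cube).
  assert (Hph : forall j, is_series (ph j) (sqrt (B j) * (Om - omega (sqrt (1 / B j))))).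
  { intros j. specialize (HB j).
    assert (L : is_lim_seq (fun n => sqrt (B j) * (omega (sqrt ((INR n + 2) / B j)) - omega (sqrt (1 / B j))))
       (sqrt (B j) * (Om - omega (sqrt (1 / B j))))).
    { apply is_lim_seq_mult'; [apply is_lim_seq_const|]. apply is_lim_seq_minus'; [|apply is_lim_seq_const].
      apply HOm. apply is_lim_seq_spec. intros K.
      destruct (nfloor_ex (B j * Rabs K * Rabs K)) as [N HN].
      { pose proof (Rabs_pos K). repeat apply Rmult_le_pos; lra. }
      exists N. intros n Hn. apply le_INR in Hn.
      apply Rle_lt_trans with (sqrt (Rabs K * Rabs K)).
      - rewrite sqrt_square by apply Rabs_pos. apply Rle_abs.
      - apply sqrt_lt_1_alt. split; [pose proof (Rabs_pos K); nra|]. apply (Rmult_lt_reg_r (B j)); auto.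
        replace ((INR n + 2) / B j * B j) with (INR n + 2) by (field; lra).
        replace (Rabs K * Rabs K * B j) with (B j * Rabs K * Rabs K) by ring. lra. }
    assert (G : is_lim_seq (sum_n (ph j)) (sqrt (B j) * (Om - omega (sqrt (1 / B j))))); [|exact G].
    eapply is_lim_seq_ext; [|exact L].
    induction n as [|n IH].
    - rewrite sum_O. unfold ph. simpl. rewrite !Rplus_0_l. reflexivity.
    - rewrite sum_Sn, <- IH. unfold ph. rewrite S_INR.
      replace (INR n + 1 + 1) with (INR n + 2) by ring. unfold plus; simpl. ring. }
  (* Both [ph] and [th] are the gap of square roots times a value of the cut-off between [INR m] and
     [INR m + 2]; their difference is therefore controlled by [chi_gap]. *)
  assert (Hmid : forall j m, 2 * (sqrt (INR m + 2) - sqrt (INR m + 1)) * chi (B j) (INR m + 2) <= ph j m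
     <= 2 * (sqrt (INR m + 2) - sqrt (INR m + 1)) * chi (B j) (INR m)).
  { intros j m. specialize (HB j). pose proof (pos_INR m) as Hm.
    assert (Hs : sqrt ((INR m + 1) / B j) <= sqrt ((INR m + 2) / B j)).
    { apply sqrt_le_1_alt. apply Rmult_le_compat_r; [left; apply Rinv_0_lt_compat; auto|lra]. }
    destruct (omega_mvt _ _ Hs) as [xi [Hxi E]].
    assert (E1 : forall u, 0 <= u -> sqrt (B j) * sqrt (u / B j) = sqrt u).
    { intros u Hu. rewrite <- sqrt_mult_alt by lra. f_equal. field; lra. }
    assert (Eph : ph j m = 2 * (sqrt (INR m + 2) - sqrt (INR m + 1)) * (1 / (1 + xi ^ 4))).
    { unfold ph. rewrite E. rewrite <- (E1 (INR m + 2)), <- (E1 (INR m + 1)) by lra.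
      field. pose proof (quartic_pos xi). lra. }
    rewrite Eph.
    assert (Hgap : 0 <= 2 * (sqrt (INR m + 2) - sqrt (INR m + 1))).
    { pose proof (sqrt_gap (INR m + 1) ltac:(lra)) as G. replace (INR m + 1 + 1) with (INR m + 2) in G by ring. lra. }
    assert (Echi : forall u, chi (B j) u = 1 / (1 + (u / B j) ^ 2)).
    { intros u. unfold chi. assert (0 < B j ^ 2) by (apply pow_lt; auto). pose proof (pow2_ge_0 u).
      assert (0 <= (u / B j) ^ 2) by apply pow2_ge_0.
      field. repeat split; try lra. all: nra. }
    assert (Hxi0 : 0 <= xi) by (pose proof (sqrt_pos ((INR m + 1) / B j)); lra).
    assert (Hx4u : xi ^ 4 <= ((INR m + 2) / B j) ^ 2).
    { replace (((INR m + 2) / B j) ^ 2) with (sqrt ((INR m + 2) / B j) ^ 4).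
      - apply pow_incr. lra.
      - replace (sqrt ((INR m + 2) / B j) ^ 4) with ((sqrt ((INR m + 2) / B j) * sqrt ((INR m + 2) / B j)) ^ 2) by ring.
        rewrite sqrt_sqrt; auto. apply Rmult_le_pos; [lra|left; apply Rinv_0_lt_compat; auto]. }
    assert (Hx4l : (INR m / B j) ^ 2 <= xi ^ 4).
    { apply Rle_trans with (sqrt ((INR m + 1) / B j) ^ 4).
      - replace (sqrt ((INR m + 1) / B j) ^ 4) with ((sqrt ((INR m + 1) / B j) * sqrt ((INR m + 1) / B j)) ^ 2) by ring.
        assert (Hi : 0 < / B j) by (apply Rinv_0_lt_compat; auto).
        rewrite sqrt_sqrt by (apply Rmult_le_pos; lra). apply pow_incr. unfold Rdiv. split; nra.
      - apply pow_incr. split; [apply sqrt_pos|lra]. }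
    rewrite !Echi. pose proof (pow2_ge_0 (INR m / B j)).
    split; apply Rmult_le_compat_l; auto; apply Rmult_le_compat_l; try lra; apply Rinv_le_contravar; lra. }
  assert (Hth : forall j m, 2 * (sqrt (INR m + 2) - sqrt (INR m + 1)) * chi (B j) (INR m + 2) <= th j m
     <= 2 * (sqrt (INR m + 2) - sqrt (INR m + 1)) * chi (B j) (INR m)).
  { intros j m. specialize (HB j). pose proof (pos_INR m) as Hm.
    pose proof (root_seq_bounds q mu m Hq Hmu) as Bm.
    assert (Hgap : 0 <= 2 * (sqrt (INR m + 2) - sqrt (INR m + 1))).
    { pose proof (sqrt_gap (INR m + 1) ltac:(lra)) as G. replace (INR m + 1 + 1) with (INR m + 2) in G by ring. lra. }
    unfold th. split; apply Rmult_le_compat_l; auto; apply chi_decr; auto; lra. }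
  assert (Hbd : forall j m, Rabs (th j m - ph j m) <= g m /\ Rabs (th j m - ph j m) <= 4 * (INR m + 1) / B j ^ 2).
  { intros j m. specialize (Hmid j m). specialize (Hth j m). specialize (HB j). pose proof (pos_INR m) as Hm.
    pose proof (sqrt_gap (INR m + 1) ltac:(lra)) as G. replace (INR m + 1 + 1) with (INR m + 2) in G by ring.
    destruct (chi_gap (B j) (INR m) HB Hm) as [C1 C2].
    assert (S1 : 1 <= sqrt (INR m + 1)) by (rewrite <- sqrt_1 at 1; apply sqrt_le_1; lra).
    set (gp := 2 * (sqrt (INR m + 2) - sqrt (INR m + 1))) in *.
    set (d := chi (B j) (INR m) - chi (B j) (INR m + 2)) in *.
    assert (A : Rabs (th j m - ph j m) <= gp * d) by (apply Rabs_le; unfold d; lra).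
    assert (Hd0 : 0 <= d) by (pose proof (chi_decr (B j) (INR m) (INR m + 2) HB ltac:(lra)); unfold d; lra).
    assert (Hi : 0 < / sqrt (INR m + 1) <= 1).
    { split; [apply Rinv_0_lt_compat; lra|]. apply (Rmult_le_reg_r (sqrt (INR m + 1))); [lra|]. rewrite Rinv_l; lra. }
    split; (eapply Rle_trans; [exact A|]).
    - apply Rle_trans with (/ sqrt (INR m + 1) * (4 * (INR m + 1) / (INR m + 2) ^ 2)).
      + apply Rmult_le_compat; lra.
      + unfold g. replace (4 * / (sqrt (INR m + 1) * (INR m + 1))) with (/ sqrt (INR m + 1) * (4 / (INR m + 1))) by (field; split; lra).
        apply Rmult_le_compat_l; [lra|].
        replace (4 / (INR m + 1)) with (4 * (INR m + 1) / (INR m + 1) ^ 2) by (field; lra).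
        apply Rmult_le_compat_l; [lra|]. apply Rinv_le_contravar; [apply pow_lt; lra|].
        apply pow_incr; lra.
    - apply Rle_trans with (1 * d); [|lra]. apply Rmult_le_compat_r; lra. }
  pose proof (is_lim_seq_inv_p_infty B HL) as Li.
  destruct (tannery (fun j m => th j m - ph j m) (fun _ => 0) g Hg) as [_ T].
  { intros j m. apply Hbd. }
  { intros m. apply is_lim_seq_abs_0.
    apply is_lim_seq_le_le with (fun _ => 0) (fun j => 4 * (INR m + 1) * (/ B j * / B j)).
    - intros j. split; [apply Rabs_pos|]. eapply Rle_trans; [apply Hbd|]. right. specialize (HB j). field. lra.
    - apply is_lim_seq_const.
    - replace 0 with (4 * (INR m + 1) * (0 * 0)) by ring. apply is_lim_seq_mult'; [apply is_lim_seq_const|].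
      apply is_lim_seq_mult'; auto. }
  assert (Ediff : forall j, ex_series (fun m => th j m - ph j m)).
  { intros j. apply (ex_series_le (V := R_CompleteNormedModule) _ g); auto. intros m. apply Hbd. }
  assert (Eph : forall j, ex_series (ph j)) by (intros j; eexists; apply Hph).
  assert (Eth : forall j, ex_series (th j)).
  { intros j. apply ex_series_ext with (fun m => (th j m - ph j m) + ph j m); [intros m; enough (H : th j m - ph j m + ph j m = th j m) by exact H; ring|].
    apply (ex_series_plus (V := R_NormedModule) (fun m => th j m - ph j m) (ph j)); auto. }
  split; [exact Eth|].
  assert (Z0 : Series (fun _ => 0) = 0).
  { apply is_series_unique. assert (G : is_lim_seq (sum_n (fun _ => 0)) 0); [|exact G].
    apply is_lim_seq_ext with (fun _ => 0).
    - intros n. induction n as [|n IH]; [rewrite sum_O; auto|rewrite sum_Sn, <- IH; unfold plus; simpl; ring].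
    - apply is_lim_seq_const. }
  rewrite Z0 in T.
  assert (L1 : is_lim_seq (fun j => sqrt (B j) * omega (sqrt (1 / B j))) 2).
  { apply is_lim_seq_le_le with (fun j => 2 * (1 - / B j * / B j)) (fun _ => 2).
    - intros j. specialize (HB j).
      destruct (omega_mvt 0 (sqrt (1 / B j)) (sqrt_pos _)) as [xi [Hxi E]]. rewrite omega_0 in E.
      assert (E1 : sqrt (B j) * sqrt (1 / B j) = 1).
      { rewrite <- sqrt_mult_alt by lra. replace (B j * (1 / B j)) with 1 by (field; lra). apply sqrt_1. }
      assert (E2 : sqrt (B j) * omega (sqrt (1 / B j)) = 2 / (1 + xi ^ 4)).
      { replace (omega (sqrt (1 / B j))) with (2 / (1 + xi ^ 4) * sqrt (1 / B j)) by lra.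
        replace (sqrt (B j) * (2 / (1 + xi ^ 4) * sqrt (1 / B j))) with (2 / (1 + xi ^ 4) * (sqrt (B j) * sqrt (1 / B j))) by ring.
        rewrite E1. ring. }
      rewrite E2. pose proof (quartic_pos xi) as Q.
      assert (Hx4 : xi ^ 4 <= / B j * / B j).
      { replace (/ B j * / B j) with (sqrt (1 / B j) ^ 4).
        - apply pow_incr; lra.
        - replace (sqrt (1 / B j) ^ 4) with ((sqrt (1 / B j) * sqrt (1 / B j)) ^ 2) by ring.
          assert (Hi : 0 < / B j) by (apply Rinv_0_lt_compat; auto).
          rewrite sqrt_sqrt by (unfold Rdiv; lra). unfold Rdiv; ring. }
      split.
      + apply (Rle_div_r _ _ (1 + xi ^ 4)); [lra|]. set (i2 := / B j * / B j) in *. set (x4 := xi ^ 4) in *.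
        assert (0 <= i2 * x4) by (apply Rmult_le_pos; lra). lra.
      + apply Rle_div_l; lra.
    - replace (Finite 2) with (Finite (2 * (1 - 0 * 0))) by (f_equal; ring). apply is_lim_seq_mult'; [apply is_lim_seq_const|].
      apply is_lim_seq_minus'; [apply is_lim_seq_const|]. apply is_lim_seq_mult'; auto.
    - apply is_lim_seq_const. }
  apply is_lim_seq_ext with (fun j => Series (fun m => th j m - ph j m) - sqrt (B j) * omega (sqrt (1 / B j))).
  - intros j. rewrite Series_minus by auto. rewrite (is_series_unique _ _ (Hph j)). unfold th. ring.
  - replace (-2) with (0 - 2) by ring. apply is_lim_seq_minus'; auto.
Qed.

(** * The transformation formula *)

(* What the cut-off at [B] leaves of the kernel at [y]; it tends to [kk q y]. *)
Definition tau (q B y : R) : R := B ^ 2 / (B ^ 2 - y ^ 2) * (kk q y - y / B * kk q B).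

(** The bound is uniform in the cut-off as long as [B] keeps a distance [g] from [y]; being a
    multiple of [/ y], it is summable over the points [y n]. *)
Lemma tau_bound q B y y0 g : 0 < q -> 0 < y0 -> y0 <= y -> y0 <= B -> 0 < g -> g <= Rabs (B - y) ->
  Rabs (tau q B y) <= (2 / y0 + 1 / g) * / y.
Proof.
  intros Hq Hy0 Hy HB Hg Hd. unfold tau. set (d := Rabs (B - y)) in *.
  assert (Hdd : d * d = (B - y) * (B - y)) by (unfold d; rewrite <- Rabs_mult; apply Rabs_pos_eq, Rle_0_sqr).
  assert (Hdu : d <= B + y) by (unfold d; apply Rabs_le; lra).
  pose proof (kk_le_inv_sq q y Hq ltac:(lra)) as K1. pose proof (kk_le_inv_sq q B Hq ltac:(lra)) as K2.
  assert (E1 : Rabs (B ^ 2 / (B ^ 2 - y ^ 2)) = B ^ 2 / (d * (B + y))).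
  { replace (B ^ 2 - y ^ 2) with ((B - y) * (B + y)) by ring.
    unfold Rdiv. rewrite Rabs_mult, Rabs_inv, Rabs_mult. fold d.
    rewrite (Rabs_pos_eq (B ^ 2)), (Rabs_pos_eq (B + y)); [reflexivity|lra|apply pow2_ge_0]. }
  assert (E2 : Rabs (kk q y - y / B * kk q B) <= / y ^ 2 + y / B * / B ^ 2).
  { unfold Rminus. eapply Rle_trans; [apply Rabs_triang|]. rewrite Rabs_Ropp, Rabs_mult.
    assert (Hyb : 0 < y / B) by (apply Rdiv_lt_0_compat; lra).
    rewrite (Rabs_pos_eq (y / B)) by lra.
    assert (y / B * Rabs (kk q B) <= y / B * / B ^ 2) by (apply Rmult_le_compat_l; lra). lra. }
  rewrite Rabs_mult, E1.
  assert (HdB : 0 < d * (B + y)) by nra.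
  apply Rle_trans with (B ^ 2 / (d * (B + y)) * (/ y ^ 2 + y / B * / B ^ 2)).
  { apply Rmult_le_compat_l; auto. apply Rmult_le_pos; [apply pow2_ge_0|left; apply Rinv_0_lt_compat; auto]. }
  (* The factorisation $B^3+y^3=(B+y)(B^2-By+y^2)$ cancels [B + y], and $B^2-By+y^2=d^2+By$. *)
  replace (B ^ 2 / (d * (B + y)) * (/ y ^ 2 + y / B * / B ^ 2))
    with ((d * d + B * y) / (B * y * d) * / y).
  2:{ rewrite Hdd. field. repeat split; lra. }
  apply Rmult_le_compat_r; [left; apply Rinv_0_lt_compat; lra|].
  replace ((d * d + B * y) / (B * y * d)) with (d / (B * y) + 1 / d) by (field; repeat split; lra).
  apply Rplus_le_compat.
  - apply Rle_trans with ((B + y) / (B * y)).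
    + apply Rmult_le_compat_r; [left; apply Rinv_0_lt_compat; nra|lra].
    + replace ((B + y) / (B * y)) with (/ y + / B) by (field; split; lra).
      assert (/ y <= / y0) by (apply Rinv_le_contravar; lra).
      assert (/ B <= / y0) by (apply Rinv_le_contravar; lra).
      unfold Rdiv. lra.
  - apply Rmult_le_compat_l; [lra|]. apply Rinv_le_contravar; lra.
Qed.

Lemma tau_lim q (B : nat -> R) y : 0 < q -> 0 < y -> (forall j, 0 < B j) -> (forall j, B j <> y) ->
  is_lim_seq B p_infty -> is_lim_seq (fun j => tau q (B j) y) (kk q y).
Proof.
  intros Hq Hy HB Hn HL.
  pose proof (is_lim_seq_inv_p_infty B HL) as Li.
  assert (Lk : is_lim_seq (fun j => kk q (B j)) 0).
  { apply is_lim_seq_abs_0. apply is_lim_seq_le_le with (fun _ => 0) (fun j => / B j); auto.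
    - intros j. split; [apply Rabs_pos|]. apply kk_le_inv; auto.
    - apply is_lim_seq_const. }
  apply is_lim_seq_ext with (fun j => / (1 - y ^ 2 * (/ B j * / B j)) * (kk q y - y * / B j * kk q (B j))).
  { intros j. specialize (HB j). specialize (Hn j). unfold tau.
    assert (B j ^ 2 - y ^ 2 <> 0).
    { replace (B j ^ 2 - y ^ 2) with ((B j - y) * (B j + y)) by ring.
      apply Rmult_integral_contrapositive_currified; lra. }
    unfold Rdiv. f_equal. field. split; lra. }
  replace (Finite (kk q y)) with (Finite (/ (1 - y ^ 2 * (0 * 0)) * (kk q y - y * 0 * 0))) by (f_equal; field).
  apply is_lim_seq_mult'.
  - assert (L0 : is_lim_seq (fun j => 1 - y ^ 2 * (/ B j * / B j)) (1 - y ^ 2 * (0 * 0))).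
    { apply is_lim_seq_minus'; [apply is_lim_seq_const|]. apply is_lim_seq_mult'; [apply is_lim_seq_const|].
      apply is_lim_seq_mult'; auto. }
    apply is_lim_seq_inv in L0; [exact L0|]. intros E. apply Rbar_finite_eq in E. lra.
  - apply is_lim_seq_minus'; [apply is_lim_seq_const|].
    apply is_lim_seq_mult'; auto. apply is_lim_seq_mult'; [apply is_lim_seq_const|auto].
Qed.

(** The product of [/ (y ^ 2 + mu m ^ 2)] with the cut-off is [B ^ 2 / (B ^ 2 - y ^ 2)] times a
    difference of two such fractions, so [trace_real] at [y] and at [B] sums it. The term with
    [kc q] is unaffected by [B], while the constant 1/2 acquires the factor [B / (B + y)], which
    makes it summable over the points [y n]. *)
Lemma regularised_kernel_series q mu B y : 0 < q -> koshliakov_root_seq q mu -> 0 < y -> 0 < B -> B <> y ->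
  is_series (fun m => koshliakov_weight q (mu m) * (y / (y ^ 2 + mu m ^ 2)) * chi B (mu m) / PI)
    (1 / 2 * (B / (B + y)) - kc q / (2 * PI * y) + tau q B y).
Proof.
  intros Hq Hmu Hy HB Hn. pose proof PI_RGT_0 as HP.
  assert (Hd : B ^ 2 - y ^ 2 <> 0).
  { replace (B ^ 2 - y ^ 2) with ((B - y) * (B + y)) by ring.
    apply Rmult_integral_contrapositive_currified; lra. }
  pose proof (is_series_minus (V := R_NormedModule) _ _ _ _ (trace_real q mu y Hq Hmu Hy) (trace_real q mu B Hq Hmu HB)) as S.
  apply (is_series_scal (V := R_NormedModule) (y * B ^ 2 / (B ^ 2 - y ^ 2) / PI)) in S.
  match type of S with is_series _ ?l =>
    replace (1 / 2 * (B / (B + y)) - kc q / (2 * PI * y) + tau q B y) with l end.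
  - eapply is_series_ext; [|exact S]. intros m.
    unfold scal, minus, plus, opp; simpl; unfold mult; simpl. unfold chi.
    destruct (root_seq_phase q mu m Hq Hmu) as [Hm _].
    assert (0 < mu m ^ 2) by (apply pow_lt; auto). assert (0 < y ^ 2) by (apply pow_lt; auto).
    assert (0 < B ^ 2) by (apply pow_lt; auto).
    set (w := koshliakov_weight q (mu m)). clearbody w.
    simpl in *. field. repeat split; try lra; nra.
  - unfold scal, minus, plus, opp; simpl; unfold mult; simpl. unfold tau. simpl in Hd.
    set (k1 := kk q y). set (k2 := kk q B). set (c := kc q). clearbody k1 k2 c.
    field. repeat split; try lra.
Qed.

Lemma sum_n_le_is_series (a : nat -> R) l n : (forall k, 0 <= a k) -> is_series a l -> 0 <= sum_n a n <= l.
Proof.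
  intros Ha H. split.
  - induction n as [|n IH]; [rewrite sum_O; auto|]. rewrite sum_Sn. unfold plus; simpl. specialize (Ha (S n)). lra.
  - apply (is_lim_seq_incr_compare (sum_n a) l); auto.
    intros k. rewrite sum_Sn. unfold plus; simpl. specialize (Ha (S k)). lra.
Qed.

(** By positivity the partial sums over [m] are dominated by the full sums [r], so [tannery] passes
    to the limit under the sum over [n]. *)
Lemma is_series_swap (f : nat -> nat -> R) (r c : nat -> R) l :
  (forall m n, 0 <= f m n) -> (forall n, is_series (fun m => f m n) (r n)) ->
  (forall m, is_series (f m) (c m)) -> is_series r l -> is_series c l.
Proof.
  intros Hf Hr Hc Hl.
  destruct (tannery (fun M n => sum_n (fun m => f m n) M) r r) as [_ T].
  - exists l; auto.
  - intros M n. pose proof (sum_n_le_is_series (fun m => f m n) (r n) M (fun m => Hf m n) (Hr n)).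
    rewrite Rabs_pos_eq; lra.
  - intros n. exact (Hr n).
  - rewrite (is_series_unique _ _ Hl) in T.
    assert (G : is_lim_seq (sum_n c) l); [|exact G].
    eapply is_lim_seq_ext; [|exact T]. intros M. apply is_series_unique.
    induction M as [|M IH].
    + rewrite sum_O. eapply is_series_ext; [|apply Hc]. intros n. rewrite sum_O. auto.
    + rewrite sum_Sn. eapply is_series_ext; [|apply (is_series_plus (V := R_NormedModule) _ _ _ _ IH (Hc (S M)))].
      intros n. rewrite sum_Sn. auto.
Qed.

(** A nonzero coefficient would make the product unbounded; the limit is thus found to be 0 without
    evaluating the coefficient. *)
Lemma lim_scal_p_infty (r : nat -> R) (al be : R) : is_lim_seq r p_infty ->
  is_lim_seq (fun j => al * r j) be -> be = 0.
Proof.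
  intros Hr H. destruct (Req_dec al 0) as [-> |Hn].
  - assert (L : is_lim_seq (fun j => 0 * r j) 0).
    { apply is_lim_seq_ext with (fun _ => 0); [intros; ring|apply is_lim_seq_const]. }
    apply is_lim_seq_unique in L. apply is_lim_seq_unique in H. rewrite H in L. apply Rbar_finite_eq in L. auto.
  - exfalso.
    assert (L : is_lim_seq r (/ al * be)).
    { apply is_lim_seq_ext with (fun j => / al * (al * r j)); [intros; field; auto|].
      apply is_lim_seq_mult'; [apply is_lim_seq_const|auto]. }
    apply is_lim_seq_unique in L. apply is_lim_seq_unique in Hr. rewrite Hr in L. discriminate.
Qed.

Lemma is_lim_seq_sqrt_p_infty (r : nat -> R) : is_lim_seq r p_infty -> is_lim_seq (fun j => sqrt (r j)) p_infty.
Proof.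
  intros H. apply is_lim_seq_spec. intros K. apply is_lim_seq_spec in H. destruct (H (K * K)) as [N HN].
  exists N. intros n Hn. specialize (HN n Hn).
  eapply Rle_lt_trans; [apply Rle_abs|]. rewrite <- sqrt_Rsqr_abs. apply sqrt_lt_1_alt. unfold Rsqr. split; [nra|auto].
Qed.

(* The cut-offs [B j] lie half-way between consecutive [y n], which keeps the
   denominator [B^2 - y^2] of [tau] away from 0. *)
Theorem koshliakov_transformation (p p' : R) (lam mu : nat -> R) (Z : C -> C) (x : R) :
  0 < p -> 0 < p' -> koshliakov_root_seq p lam -> koshliakov_root_seq p' mu ->
  is_koshliakov_zeta p' mu Z -> 0 < x ->
  let lhs n := koshliakov_weight p (lam n) * koshliakov_kernel p' (lam n ^ 2 * x) in
  let rhs n := koshliakov_weight p' (mu n) * (1 / sqrt (mu n)) * koshliakov_G p (2 * PI * mu n / x) in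
  ex_series lhs /\ ex_series rhs /\
  exists z, Z (RtoC (1 / 2)) = RtoC z /\
    Series lhs = kc p / 4
      + kc p' / x * (PI ^ 2 / 6 * (((PI * p) ^ 2 + 3 * (PI * p) + 3) / (PI * p + 1) ^ 2))
      + 1 / 2 * sqrt (PI / x) * (z + Series rhs).
Proof.
  intros Hp Hp' Hlam Hmu HZ Hx lhs rhs. pose proof PI_RGT_0 as HP.
  (* The scaling is chosen so that [lam n ^ 2 * x = 2 * PI * y n], the argument at which the kernel
     becomes [kk p' (y n)]. *)
  set (A := 2 * PI / x). assert (HA : 0 < A) by (unfold A; apply Rdiv_lt_0_compat; lra).
  set (y := fun n => lam n ^ 2 / A).
  set (W := fun n => koshliakov_weight p (lam n)). set (V := fun m => koshliakov_weight p' (mu m)).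
  assert (HW : forall n, 0 < W n <= 1) by (intros n; apply (weight_bounds p (lam n) Hp)).
  assert (HV : forall n, 0 < V n <= 1) by (intros n; apply (weight_bounds p' (mu n) Hp')).
  assert (Hl : forall n, INR n + 1 / 2 < lam n < INR n + 1) by (intros n; apply (root_seq_bounds p lam n Hp Hlam)).
  assert (Hm : forall n, INR n + 1 / 2 < mu n < INR n + 1) by (intros n; apply (root_seq_bounds p' mu n Hp' Hmu)).
  assert (Hlp : forall n, 0 < lam n) by (intros n; specialize (Hl n); pose proof (pos_INR n); lra).
  assert (Hmp : forall n, 0 < mu n) by (intros n; specialize (Hm n); pose proof (pos_INR n); lra).
  assert (Hy : forall n, 0 < y n).
  { intros n. unfold y. apply Rdiv_lt_0_compat; auto. apply pow_lt; auto. }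
  (* Consecutive squares [lam n ^ 2] differ by more than 1, since [lam n < n + 1] and
     [lam (S n) > n + 3/2]. The midpoints then stay at distance at least [/ (2 * A)] from every
     [y n]. *)
  assert (Hgap : forall n, y n + / A <= y (S n)).
  { intros n. unfold y. specialize (Hl n) as L1. pose proof (Hl (S n)) as L2. rewrite S_INR in L2. pose proof (pos_INR n).
    assert (lam n ^ 2 + 1 <= lam (S n) ^ 2) by nra.
    replace (lam n ^ 2 / A + / A) with ((lam n ^ 2 + 1) / A) by (field; lra).
    apply Rmult_le_compat_r; [left; apply Rinv_0_lt_compat|]; auto. }
  assert (HiA : 0 < / A) by (apply Rinv_0_lt_compat; auto).
  assert (Hmono : forall i k, (i <= k)%nat -> y i <= y k).
  { intros i k Hik. induction Hik as [|k Hik IH]; [lra|]. specialize (Hgap k). lra. }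
  set (B := fun j => (y j + y (S j)) / 2).
  assert (HB0 : forall j, y 0%nat <= B j).
  { intros j. unfold B. pose proof (Hmono 0%nat j ltac:(lia)). pose proof (Hmono 0%nat (S j) ltac:(lia)). lra. }
  assert (HB : forall j, 0 < B j) by (intros j; specialize (HB0 j); specialize (Hy 0%nat); lra).
  assert (HBd : forall j n, / (2 * A) <= Rabs (B j - y n)).
  { intros j n. assert (E2 : / (2 * A) = / A / 2) by (field; lra). rewrite E2. unfold B.
    specialize (Hgap j). destruct (Nat.le_gt_cases n j) as [L|L].
    - specialize (Hmono n j L). rewrite Rabs_pos_eq; lra.
    - specialize (Hmono (S j) n L). rewrite Rabs_left1; lra. }
  assert (HBy : forall j n, B j <> y n).
  { intros j n E. specialize (HBd j n). rewrite E, Rminus_diag, Rabs_R0 in HBd.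
    assert (0 < / (2 * A)) by (apply Rinv_0_lt_compat; lra). lra. }
  assert (HBl : is_lim_seq B p_infty).
  { apply is_lim_seq_spec. intros K. destruct (nfloor_ex (A * Rabs K)) as [N HN].
    { pose proof (Rabs_pos K). nra. }
    exists (S N). intros n Hn. apply le_INR in Hn. rewrite S_INR in Hn.
    apply Rle_lt_trans with (Rabs K); [apply Rle_abs|].
    assert (L1 : Rabs K < y n).
    { unfold y. apply (Rmult_lt_reg_r A); auto. replace (lam n ^ 2 / A * A) with (lam n ^ 2) by (field; lra).
      specialize (Hl n). pose proof (pos_INR N). nra. }
    unfold B. specialize (Hgap n). lra. }
  assert (HsB : is_lim_seq (fun j => sqrt (B j)) p_infty) by (apply is_lim_seq_sqrt_p_infty; auto).
  destruct (zeta_half p' mu Z Hp' Hmu HZ) as [Hha [z [Hz Hhs]]].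
  destruct (root_theta p' mu Hp' Hmu) as [Om HOm].
  destruct (HOm B HB HBl) as [Eth Lth]. clear HOm.
  pose proof (zeta_two p lam Hp Hlam) as S2. fold W in S2.
  set (s2 := PI ^ 2 / 6 * (((PI * p) ^ 2 + 3 * (PI * p) + 3) / (PI * p + 1) ^ 2)) in *.
  pose proof (ex_series_root_sq p lam Hp Hlam) as El2.
  assert (Elhs : forall n, lhs n = W n * kk p' (y n)).
  { intros n. unfold lhs. fold (W n). f_equal.
    replace (lam n ^ 2 * x) with (2 * PI * y n) by (unfold y, A; field; lra). apply kernel_kk; auto. }
  set (kap := 2 / y 0%nat + 1 / (/ (2 * A))).
  assert (Egy : ex_series (fun n => kap * / y n)).
  { apply (ex_series_scal (V := R_NormedModule) kap (fun n => / y n)).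
    apply ex_series_ext with (fun n => scal A (/ lam n ^ 2)).
    - intros n. specialize (Hlp n). unfold scal; simpl; unfold mult; simpl. unfold y.
      assert (0 < lam n ^ 2) by (apply pow_lt; auto). simpl in *. field. split; lra.
    - apply (ex_series_scal (V := R_NormedModule) A (fun n => / lam n ^ 2)); auto. }
  assert (Htb : forall j n, Rabs (W n * tau p' (B j) (y n)) <= kap * / y n).
  { intros j n. rewrite Rabs_mult. specialize (HW n). rewrite (Rabs_pos_eq (W n)) by lra.
    apply Rle_trans with (1 * Rabs (tau p' (B j) (y n))).
    - apply Rmult_le_compat_r; [apply Rabs_pos|lra].
    - rewrite Rmult_1_l. apply tau_bound; auto.
      + apply Hmono; lia.
      + apply Rinv_0_lt_compat; lra. }
  destruct (tannery (fun j n => W n * tau p' (B j) (y n)) (fun n => W n * kk p' (y n)) (fun n => kap * / y n)) as [El Ll]; auto.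
  { intros n. apply is_lim_seq_mult'; [apply is_lim_seq_const|]. apply tau_lim; auto. }
  assert (Etau : forall j, ex_series (fun n => W n * tau p' (B j) (y n))).
  { intros j. apply (ex_series_le (V := R_CompleteNormedModule) _ (fun n => kap * / y n)); auto. }
  assert (Exl : ex_series lhs) by (eapply ex_series_ext; [|exact El]; intros n; symmetry; apply Elhs).
  assert (Sl : Series lhs = Series (fun n => W n * kk p' (y n))) by (apply Series_ext; auto).
  set (G := fun m => koshliakov_G p (A * mu m)).
  assert (EG : forall m, rhs m = V m * (1 / sqrt (mu m)) * G m).
  { intros m. unfold rhs, G. fold (V m). f_equal. f_equal. unfold A. field. lra. }
  assert (Hsq : forall m, 0 < 1 / sqrt (mu m) <= 2).
  { intros m. specialize (Hm m). pose proof (pos_INR m).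
    assert (1 / 2 <= sqrt (mu m)).
    { rewrite <- (sqrt_Rsqr (1 / 2)) by lra. apply sqrt_le_1_alt. unfold Rsqr. lra. }
    split; [apply Rdiv_lt_0_compat; lra|]. apply Rle_div_l; lra. }
  destruct (koshliakov_G_bound p (A * (1 / 2)) Hp ltac:(lra)) as [kG [HkG HG]].
  assert (Hrb : forall m, Rabs (rhs m) <= 2 * kG / A ^ 2 * / mu m ^ 2).
  { intros m. rewrite EG. rewrite !Rabs_mult. specialize (HV m). specialize (Hsq m).
    rewrite (Rabs_pos_eq (V m)), (Rabs_pos_eq (1 / sqrt (mu m))) by lra.
    pose proof (Hm m) as B1. pose proof (pos_INR m).
    assert (HGm : Rabs (G m) <= kG * / (A * mu m) ^ 2) by (apply HG; nra).
    assert (0 < A ^ 2) by (apply pow_lt; auto). assert (0 < mu m ^ 2) by (apply pow_lt; auto).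
    apply Rle_trans with (1 * 2 * (kG * / (A * mu m) ^ 2)).
    - apply Rmult_le_compat; [apply Rmult_le_pos; lra|apply Rabs_pos| |auto]. apply Rmult_le_compat; lra.
    - right. specialize (Hmp m). field. split; lra. }
  assert (Emu2 : ex_series (fun m => 2 * kG / A ^ 2 * / mu m ^ 2)).
  { apply (ex_series_scal (V := R_NormedModule) (2 * kG / A ^ 2) (fun m => / mu m ^ 2)).
    apply (ex_series_root_sq p' mu Hp' Hmu). }
  assert (Exr : ex_series rhs).
  { apply (ex_series_le (V := R_CompleteNormedModule) _ _ Hrb Emu2). }
  assert (Hchi : forall j u, 0 < chi (B j) u <= 1) by (intros; apply chi_bounds; auto).
  destruct (tannery (fun j m => rhs m * chi (B j) (mu m)) rhs (fun m => 2 * kG / A ^ 2 * / mu m ^ 2)) as [_ Lr]; auto.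
  { intros j m. rewrite Rabs_mult. specialize (Hchi j (mu m)). rewrite (Rabs_pos_eq (chi _ _)) by lra.
    eapply Rle_trans; [|apply Hrb]. pose proof (Rabs_pos (rhs m)). nra. }
  { intros m. pose proof (chi_lim B (mu m) HB HBl) as L.
    replace (Finite (rhs m)) with (Finite (rhs m * 1)) by (f_equal; ring).
    apply is_lim_seq_mult'; [apply is_lim_seq_const|auto]. }
  assert (Erc : forall j, ex_series (fun m => rhs m * chi (B j) (mu m))).
  { intros j. apply (ex_series_le (V := R_CompleteNormedModule) _ (fun m => 2 * kG / A ^ 2 * / mu m ^ 2)); auto.
    intros m. unfold norm; simpl; unfold abs; simpl. rewrite Rabs_mult. specialize (Hchi j (mu m)).
    rewrite (Rabs_pos_eq (chi _ _)) by lra. eapply Rle_trans; [|apply Hrb]. pose proof (Rabs_pos (rhs m)). nra. }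
  set (h := half_term p' mu) in *.
  destruct (tannery (fun j m => h m * chi (B j) (mu m)) h (fun m => Rabs (h m))) as [_ Lh]; auto.
  { intros j m. rewrite Rabs_mult. specialize (Hchi j (mu m)). rewrite (Rabs_pos_eq (chi _ _)) by lra.
    pose proof (Rabs_pos (h m)). nra. }
  { intros m. pose proof (chi_lim B (mu m) HB HBl) as L.
    replace (Finite (h m)) with (Finite (h m * 1)) by (f_equal; ring).
    apply is_lim_seq_mult'; [apply is_lim_seq_const|auto]. }
  rewrite (is_series_unique _ _ Hhs) in Lh.
  assert (Ehc : forall j, ex_series (fun m => h m * chi (B j) (mu m))).
  { intros j. apply (ex_series_le (V := R_CompleteNormedModule) _ (fun m => Rabs (h m))); auto.
    intros m. unfold norm; simpl; unfold abs; simpl. rewrite Rabs_mult. specialize (Hchi j (mu m)).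
    rewrite (Rabs_pos_eq (chi _ _)) by lra. pose proof (Rabs_pos (h m)). nra. }
  set (th := fun j m => 2 * (sqrt (INR m + 2) - sqrt (INR m + 1)) * chi (B j) (mu m)) in *.
  set (ka := 1 / 2 * sqrt (PI / x)).
  (* As [B j / (B j + y n) = A * B j / (lam n ^ 2 + t j ^ 2)], the sum over [n] of the regularised
     constant is again a trace for [p], at the point [t j]. *)
  set (t := fun j => sqrt (A * B j)).
  assert (Ht : forall j, 0 < t j) by (intros j; apply sqrt_lt_R0; specialize (HB j); nra).
  assert (Ht2 : forall j, t j * t j = A * B j) by (intros j; apply sqrt_sqrt; specialize (HB j); nra).
  assert (Ets : forall j, t j = sqrt A * sqrt (B j)) by (intros j; apply sqrt_mult_alt; lra).
  assert (Hrow : forall j, is_series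
     (fun n => W n * (1 / 2 * (B j / (B j + y n)) - kc p' / (2 * PI * y n) + tau p' (B j) (y n)))
     (1 / 2 * (A * B j) * (PI / t j * (kk p (t j) + 1 / 2) - kc p / (2 * t j ^ 2))
        - kc p' / x * s2 + Series (fun n => W n * tau p' (B j) (y n)))).
  { intros j.
    pose proof (trace_real p lam (t j) Hp Hlam (Ht j)) as R1. fold W in R1.
    apply (is_series_scal (V := R_NormedModule) (1 / 2 * (A * B j))) in R1.
    pose proof (is_series_scal (V := R_NormedModule) (kc p' / x) _ _ S2) as R2.
    pose proof (Series_correct _ (Etau j)) as R3.
    pose proof (is_series_plus (V := R_NormedModule) _ _ _ _
      (is_series_minus (V := R_NormedModule) _ _ _ _ R1 R2) R3) as R.
    unfold scal, minus, plus, opp in R; simpl in R; unfold mult in R; simpl in R.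
    eapply is_series_ext; [|exact R]. intros n. cbv beta. simpl.
    specialize (Ht2 j). specialize (HB j). specialize (Hy n). specialize (Hlp n).
    rewrite !Rmult_1_r. rewrite Ht2.
    assert (Hl2 : 0 < lam n * lam n) by nra.
    assert (Ey : y n = lam n * lam n / A) by (unfold y; field; lra).
    assert (E1 : B j / (B j + y n) = A * B j * / (lam n * lam n + A * B j)).
    { rewrite Ey. field. repeat split; nra. }
    assert (E2 : kc p' / (2 * PI * y n) = kc p' / x * / (lam n * lam n)).
    { rewrite Ey. unfold A. field. repeat split; lra. }
    rewrite E1, E2. unfold W. ring. }
  (* Summed over [n] first, column [m] is a multiple of [1 + G m] by [trace_diag] at [A * mu m]. The
     1 is split into [h], absolutely summable, and the gap of square roots, whose cut-off sum is
     governed by [root_theta]. *)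
  assert (Hcol : forall j, is_series (fun m => ka * (h m * chi (B j) (mu m) + th j m + rhs m * chi (B j) (mu m)))
     (1 / 2 * (A * B j) * (PI / t j * (kk p (t j) + 1 / 2) - kc p / (2 * t j ^ 2))
        - kc p' / x * s2 + Series (fun n => W n * tau p' (B j) (y n)))).
  { intros j.
    apply (is_series_swap (fun m n => W n * (V m * (y n / (y n ^ 2 + mu m ^ 2)) * chi (B j) (mu m) / PI))
      (fun n => W n * (1 / 2 * (B j / (B j + y n)) - kc p' / (2 * PI * y n) + tau p' (B j) (y n)))).
    - intros m n. specialize (HW n). specialize (HV m). specialize (Hchi j (mu m)). specialize (Hy n).
      apply Rmult_le_pos; [lra|]. apply Rmult_le_pos; [|left; apply Rinv_0_lt_compat; lra].
      apply Rmult_le_pos; [|lra]. apply Rmult_le_pos; [lra|].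
      left. apply Rdiv_lt_0_compat; auto. assert (0 < y n ^ 2) by (apply pow_lt; auto).
      pose proof (pow2_ge_0 (mu m)). lra.
    - intros n. apply (is_series_scal (V := R_NormedModule) (W n)). apply regularised_kernel_series; auto.
    - intros m.
      pose proof (trace_diag p lam (A * mu m) Hp Hlam ltac:(specialize (Hmp m); nra)) as D. fold W in D. fold (G m) in D.
      apply (is_series_scal (V := R_NormedModule) (V m * chi (B j) (mu m) / PI * A)) in D.
      specialize (Hmp m). specialize (HB j).
      match type of D with is_series _ ?l =>
        replace (ka * (h m * chi (B j) (mu m) + th j m + rhs m * chi (B j) (mu m))) with l end.
      + eapply is_series_ext; [|exact D]. intros n.
        unfold scal; simpl; unfold mult; simpl. specialize (Hlp n).
        assert (Ey : y n = lam n * lam n / A) by (unfold y; field; lra).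
        rewrite Ey. unfold W.
        assert (0 < lam n * lam n) by nra. assert (0 < lam n * lam n * (lam n * lam n)) by nra.
        assert (0 < A * mu m * (A * mu m)) by (apply Rmult_lt_0_compat; nra).
        field. repeat split; try lra; nra.
      + unfold scal; simpl; unfold mult; simpl. fold (G m).
        rewrite EG. unfold th, h, half_term. fold (V m).
        set (X := chi (B j) (mu m)). set (g := G m). set (v := V m). set (u := sqrt (mu m)).
        assert (Hu : 0 < u) by (apply sqrt_lt_R0; auto).
        set (r := sqrt (PI / x)).
        assert (Hr : 0 < r) by (apply sqrt_lt_R0, Rdiv_lt_0_compat; lra).
        assert (Hr2 : r * r = PI / x) by (apply sqrt_sqrt; left; apply Rdiv_lt_0_compat; lra).
        assert (Eb : sqrt (2 * (A * mu m)) = 2 * r * u).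
        { replace (2 * (A * mu m)) with ((2 * r * u) * (2 * r * u)).
          - apply sqrt_square. nra.
          - replace (2 * r * u * (2 * r * u)) with (4 * (r * r) * (u * u)) by ring.
            rewrite Hr2. unfold u. rewrite sqrt_sqrt by lra. unfold A. field. lra. }
        rewrite Eb. unfold ka. fold r.
        replace A with (2 * (r * r)) by (rewrite Hr2; unfold A; field; lra).
        clearbody X g v u r. field. repeat split; lra.
    - apply Hrow. }
  assert (Heq : forall j, ka * (Series (fun m => h m * chi (B j) (mu m)) + Series (th j) + Series (fun m => rhs m * chi (B j) (mu m)))
     = PI * t j / 2 * kk p (t j) + PI * t j / 4 - kc p / 4 - kc p' / x * s2 + Series (fun n => W n * tau p' (B j) (y n))).
  { intros j. pose proof (is_series_unique _ _ (Hcol j)) as U.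
    rewrite Series_scal_l in U.
    assert (Eh : ex_series (fun m => h m * chi (B j) (mu m) + th j m))
      by (apply (ex_series_plus (V := R_NormedModule) (fun m => h m * chi (B j) (mu m)) (th j)); auto; apply Eth).
    rewrite (Series_plus _ _ Eh (Erc j)), (Series_plus (fun m => h m * chi (B j) (mu m)) (th j) (Ehc j) (Eth j)) in U.
    rewrite U. specialize (Ht j). rewrite <- (Ht2 j). field. split; lra. }
  assert (Lt : is_lim_seq t p_infty).
  { apply is_lim_seq_ext with (fun j => sqrt A * sqrt (B j)); [intros; symmetry; apply Ets|].
    replace p_infty with (Rbar_mult (sqrt A) p_infty).
    - apply is_lim_seq_scal_l; auto.
    - apply is_Rbar_mult_unique. apply is_Rbar_mult_sym. apply is_Rbar_mult_p_infty_pos. simpl. apply sqrt_lt_R0; auto. }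
  (* The quadratic decay of [kk] beats the factor [t j]. *)
  assert (Lk : is_lim_seq (fun j => PI * t j / 2 * kk p (t j)) 0).
  { apply is_lim_seq_abs_0. apply is_lim_seq_le_le with (fun _ => 0) (fun j => PI / 2 * / t j).
    - intros j. split; [apply Rabs_pos|]. specialize (Ht j). rewrite Rabs_mult.
      rewrite (Rabs_pos_eq (PI * t j / 2)) by nra.
      apply Rle_trans with (PI * t j / 2 * / t j ^ 2).
      + apply Rmult_le_compat_l; [nra|]. apply kk_le_inv_sq; auto.
      + right. field. lra.
    - apply is_lim_seq_const.
    - replace (Finite 0) with (Finite (PI / 2 * 0)) by (f_equal; ring).
      apply is_lim_seq_mult'; [apply is_lim_seq_const|].
      apply is_lim_seq_inv_p_infty; auto. }
  split; [auto|split; [auto|]]. exists z. split; [auto|].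
  (* A multiple of [sqrt (B j)] equals a convergent sequence, hence the limit is 0. *)
  assert (Hfin : 0 - kc p / 4 - kc p' / x * s2 + Series lhs - ka * (z + 2 + -2 + Series rhs) = 0).
  { apply (lim_scal_p_infty (fun j => sqrt (B j)) (ka * Om - PI / 4 * sqrt A)); auto.
    apply is_lim_seq_ext with (fun j => PI * t j / 2 * kk p (t j) - kc p / 4 - kc p' / x * s2
       + Series (fun n => W n * tau p' (B j) (y n))
       - ka * (Series (fun m => h m * chi (B j) (mu m)) + (Series (th j) - Om * sqrt (B j))
          + Series (fun m => rhs m * chi (B j) (mu m)))).
    - intros j. specialize (Heq j). rewrite (Ets j) in *. lra.
    - rewrite Sl.
      lim_arith. }
  fold s2 ka. lra.
Qed.

Theorem theorem2p1
  (p p' : R) (hp : 0 < p) (hp' : 0 < p')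
  (lam lam' : nat -> R)
  (hlam : koshliakov_root_seq p lam)
  (hlam' : koshliakov_root_seq p' lam')
  (zeta' : C -> C) (hzeta' : is_koshliakov_zeta p' lam' zeta')
  (x : R) (hx : 0 < x) :
  let lhs_term := fun n : nat =>
    koshliakov_weight p (lam n) * koshliakov_kernel p' (lam n ^ 2 * x) in
  let rhs_term := fun n : nat =>
    koshliakov_weight p' (lam' n) * (1 / sqrt (lam' n))
      * koshliakov_G p (2 * PI * lam' n / x) in
  ex_series lhs_term /\
  ex_series rhs_term /\
  RtoC (Series lhs_term) =
    (RtoC (1 / (4 * (1 + 1 / (PI * p))))
     + RtoC (PI ^ 2 / (6 * x)
             * ((1 + 3 / (PI * p) * (1 + 1 / (PI * p)))
                / ((1 + 1 / (PI * p')) * (1 + 1 / (PI * p)) ^ 2)))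
     + RtoC (1 / 2 * sqrt (PI / x)) * zeta' (RtoC (1 / 2))
     + RtoC (1 / 2 * sqrt (PI / x) * Series rhs_term))%C.
Proof.
  intros lhs_term rhs_term. pose proof PI_RGT_0 as HP.
  destruct (koshliakov_transformation p p' lam lam' zeta' x hp hp' hlam hlam' hzeta' hx)
    as (E1 & E2 & z & Hz & H).
  fold lhs_term in E1, H. fold rhs_term in E2, H.
  split; [exact E1|split; [exact E2|]].
  (* The value of [zeta'] at 1/2 is real, so the complex identity reduces to a real one. *)
  rewrite Hz, <- RtoC_mult, <- !RtoC_plus. f_equal. rewrite H.
  unfold kc.
  assert (0 < PI * p) by nra. assert (0 < PI * p') by nra.
  field. repeat split; try lra; nra.
Qed.
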